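(* Let $K$ be a field of prime characteristic $p$ and let $C$ be a cyclic $p$-group of order $q>1$. Then for all $r$ with $q/p\le r\le q$ and all $n>0$, $$\psi_S^n(V_r)-\Big((-1)^{n-1}\Omega^n\big(\psi_\Lambda^n(V_{q-r})\big)+(n,q)V_{q/(n,q)}\Big)\in\mathbb{Z}V_q,$$ where $(n,q)$ is the greatest common divisor of $n$ and $q$.
   Context: $KC$-modules are finite-dimensional right modules. The indecomposable $KC$-modules up to isomorphism are $V_1,\dots,V_q$ with $\dim V_r=r$ ($V_q$ is the regular module), and $V_0:=0$. The Green ring $R_{KC}$ has $\mathbb{Z}$-basis $V_1,\dots,V_q$, addition from direct sum, multiplication from tensor product. Adams operations: $\psi_\Lambda^1(V)-\psi_\Lambda^2(V)t+\cdots=\frac{d}{dt}\log\sum_{n\ge0}\Lambda^n(V)t^n$ and $\psi_S^1(V)+\psi_S^2(V)t+\cdots=\frac{d}{dt}\log\sum_{n\ge0}S^n(V)t^n$ (exterior and symmetric powers), extended $\mathbb{Z}$-linearly to $R_{KC}$. $\Omega$ is the Heller translate (kernel of a projective cover), extended to a $\mathbb{Z}$-linear map $R_{KC}\to R_{KC}$; explicitly $\Omega(V_r)=V_{q-r}$. $\Omega^n$ denotes the $n$-fold composite ($\Omega^0$ the identity). *)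

(* Defs.v *)
From HB Require Import structures.
From mathcomp Require Import all_boot all_order all_algebra.
From mathcomp Require Import mxtens.
From Stdlib Require Import ClassicalEpsilon.
Set Implicit Arguments.
Unset Strict Implicit.
Unset Printing Implicit Defensive.
Import Order.TTheory GRing.Theory Num.Theory.
Local Open Scope ring_scope.

Section Green.
Variables (K : fieldType) (q : nat).

(* A KC-module (C = <c> cyclic of order q) of dimension d is represented by the
   matrix g : 'M[K]_d of the action of the generator c on row vectors
   (right module: v |-> v *m g). *)

(* Direct sum of Jordan blocks (unipotent, upper bidiagonal) of sizes s;
   the block of size r is the matrix of the indecomposable V_r. *)
Definition jordan_mx (d : nat) (s : seq nat) : 'M[K]_d :=
  \matrix_(i, j) (((i : nat) == j)%:R
                  + (((j : nat) == i.+1) && ((j : nat) \notin scanl addn 0%N s))%:R).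

Definition Vmod (r : nat) : 'M[K]_r := jordan_mx r [:: r].

Definition decomp (d : nat) (g : 'M[K]_d) (s : seq nat) : Prop :=
  all (fun x => (0 < x <= q)%N) s /\ sumn s = d /\
  exists P : 'M[K]_d, P \in unitmx /\ P *m g = jordan_mx d s *m P.

(* The Green ring R_{KC}: Z-linear combinations of V_1,...,V_q;
   coordinate i : 'I_q is the coefficient of V_(i+1). *)
Definition green := {ffun 'I_q -> int}.

(* The basis element V_r (V_0 = 0, and V_r = 0 for r > q). *)
Definition V (r : nat) : green := [ffun i : 'I_q => ((i.+1 == r) : nat)%:Z].

(* The class [M] in R_{KC} of a module M (well defined by Krull-Schmidt). *)
Definition cls (d : nat) (g : 'M[K]_d) : green :=
  let s := epsilon (inhabits [::]) (decomp g) in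
  [ffun i : 'I_q => (count_mem i.+1 s)%:Z].

Definition gmul (a b : green) : green :=
  \sum_(i < q) \sum_(j < q)
     (cls (Vmod i.+1 *t Vmod j.+1)) *~ (a i * b j).

(* Exterior power: basis e_{t_1} /\ ... /\ e_{t_n}, t strictly increasing. *)
Definition ext_idx (d n : nat) :=
  {t : n.-tuple 'I_d | sorted (fun x y : 'I_d => (x < y)%N) t}.
Definition extpow (d : nat) (g : 'M[K]_d) (n : nat) : 'M[K]_#|{: ext_idx d n}| :=
  \matrix_(i < #|{: ext_idx d n}|, j < #|{: ext_idx d n}|) \det (\matrix_(a < n, b < n)
       g (tnth (val (enum_val i)) a) (tnth (val (enum_val j)) b)).

(* Symmetric power: basis monomials e_{t_1} ... e_{t_n}, t weakly increasing. *)
Definition sym_idx (d n : nat) :=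
  {t : n.-tuple 'I_d | sorted (fun x y : 'I_d => (x <= y)%N) t}.
Definition sympow (d : nat) (g : 'M[K]_d) (n : nat) : 'M[K]_#|{: sym_idx d n}| :=
  \matrix_(i < #|{: sym_idx d n}|, j < #|{: sym_idx d n}|) \sum_(t : n.-tuple 'I_d | perm_eq t (val (enum_val j)))
       \prod_(a < n) g (tnth (val (enum_val i)) a) (tnth t a).

(* Adams operations from  psi^1 - psi^2 t + ... = d/dt log sum_n Lambda^n t^n,
   i.e. (comparing coefficients of t^(n-1), Lambda^0 = 1)
     n Lambda^n = sum_(i=1..n) (-1)^(i-1) psi^i Lambda^(n-i),
   solved recursively.  The list contains psi^1, ..., psi^n. *)
Fixpoint adamsL_seq (lam : nat -> green) (n : nat) : seq green :=
  match n with
  | 0 => [::]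
  | n'.+1 =>
      let s := adamsL_seq lam n' in
      rcons s (((lam n) *~ n%:Z
                - \sum_(i < n') (gmul (nth 0 s i) (lam (n - i.+1)%N)) *~ ((-1) ^+ i))
               *~ ((-1) ^+ n'))
  end.

(* psi_S^1 + psi_S^2 t + ... = d/dt log sum_n S^n t^n, i.e.
     n S^n = sum_(i=1..n) psi_S^i S^(n-i). *)
Fixpoint adamsS_seq (sym : nat -> green) (n : nat) : seq green :=
  match n with
  | 0 => [::]
  | n'.+1 =>
      let s := adamsS_seq sym n' in
      rcons s ((sym n) *~ n%:Z - \sum_(i < n') gmul (nth 0 s i) (sym (n - i.+1)%N))
  end.

Definition psiL (n : nat) (d : nat) (g : 'M[K]_d) : green :=
  nth 0 (adamsL_seq (fun m => cls (extpow g m)) n) n.-1.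
Definition psiS (n : nat) (d : nat) (g : 'M[K]_d) : green :=
  nth 0 (adamsS_seq (fun m => cls (sympow g m)) n) n.-1.

Definition Omega (a : green) : green := \sum_(i < q) V (q - i.+1)%N *~ a i.

End Green.

(* Main.v *)
Require Import Defs.
From HB Require Import structures.
From mathcomp Require Import all_boot all_order all_algebra.
From mathcomp Require Import fingroup perm.
From mathcomp Require Import mxtens.
From Stdlib Require Import ClassicalEpsilon.
From mathcomp Require Import zify ring.
Set Implicit Arguments.
Unset Strict Implicit.
Unset Printing Implicit Defensive.
Import GRing.Theory Num.Theory.
Local Open Scope ring_scope.

(* Write P = V_q, U = V_(q-r), so that V_r = P/U, and let Z be the subgroup of
   order p of C. In the Koszul complex of the modules Lambda^i(U) (x) S^j(P),
   the symmetric power S^j(P) is the direct sum of a free module and of the span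
   B^j of the monomials fixed by Z. As r >= q/p, the map S(P) -> S(V_(q/p)) kills U,
   and it is split injective on B^j (p-th powers of monomials). Hence Lambda^i(U)
   (x) B^j splits off the cokernel of the differential ending in Lambda^i(U) (x)
   S^j(P), and, modulo projectives,
     S^n(V_r) = sum_i Omega^i (Lambda^i(U) (x) S^(n-i)(P)).
   Since Omega is multiplication by Omega(1) modulo projectives, taking
   logarithmic derivatives of generating functions gives the result, once
   psi_S^n(V_q) = (n,q) V_(q/(n,q)); this last identity is an equality of fixed
   point counts of permutation modules.

   Classes are computed from the ranks of the powers of g - 1: the multiplicity
   of V_s is the second difference of the rank sequence at s. The complex used
   below is the dual one. *)

(** * Rank sequences of nilpotent endomorphisms *)

(** Two bases of the regular module are needed: the Jordan basis shows the submodules and the Koszul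
    differential, the permutation basis shows the orbits. The binomial matrix [qK] passes between
    them, and r >= q/p is where they meet: a function of period q/p in the permutation basis is one
    supported on indices below q/p in the Jordan basis, and the differential, which reads only
    indices from r on, does not see it. The subgroup Z decides freeness because every nontrivial
    subgroup of C contains it: a multiset not fixed by Z has an orbit of full length q. The terms of
    the Koszul complex are not projective, so exactness alone gives no Heller shift. The shift holds
    because in each term the complement of the free summand lies in the kernel of the differential
    leaving it. Submodules are stable subspaces of function spaces, and a class depends only on the
    dimensions of images of powers of g - 1, so exact sequences become equations between
    dimensions. *)

Section RankSequence.
Variables (K : fieldType).
Implicit Types vT wT : vectType K.

Definition itl vT (N : 'End(vT)) l : 'End(vT) := iter l (comp_lfun N) \1%VF.

Lemma itlE vT (N : 'End(vT)) l v : itl N l v = iter l N v.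
Proof. by elim: l => [|l IH] /=; rewrite ?id_lfunE // comp_lfunE IH. Qed.

Definition rk vT (N : 'End(vT)) (U : {vspace vT}) l := \dim (itl N l @: U).

Definition stable vT (N : 'End(vT)) (U : {vspace vT}) := (N @: U <= U)%VS.

Lemma stableP vT (N : 'End(vT)) (U : {vspace vT}) :
  reflect (forall u, u \in U -> N u \in U) (stable N U).
Proof.
apply: (iffP subvP) => [H u uU|H _ /memv_imgP[u uU ->]]; last exact: H.
exact/H/memv_img.
Qed.

Lemma stable_iter vT (N : 'End(vT)) (U : {vspace vT}) l u :
  stable N U -> u \in U -> iter l N u \in U.
Proof. by move=> /stableP sU uU; elim: l => //= l; apply: sU. Qed.

Lemma stablef vT (N : 'End(vT)) : stable N fullv.
Proof. exact: subvf. Qed.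

Lemma itl_imgP vT (N : 'End(vT)) l (U : {vspace vT}) w :
  reflect (exists2 u, u \in U & w = iter l N u) (w \in itl N l @: U)%VS.
Proof.
by apply: (iffP memv_imgP) => -[u uU ->]; exists u; rewrite ?itlE.
Qed.

Lemma rk0 vT (N : 'End(vT)) (U : {vspace vT}) : rk N U 0 = \dim U.
Proof.
rewrite /rk; congr (\dim _); apply/vspaceP => u.
by apply/itl_imgP/idP => [[v vU ->] //|uU]; exists u.
Qed.

Lemma iter_morph vT wT (N : 'End(vT)) (M : 'End(wT)) (f : 'Hom(vT, wT)) (U : {vspace vT}) l :
  stable N U -> {in U, forall u, f (N u) = M (f u)} ->
  {in U, forall u, f (iter l N u) = iter l M (f u)}.
Proof.
move=> sU H u uU; elim: l => //= l IH.
by rewrite H ?IH // stable_iter.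
Qed.

Lemma img_itl vT wT (N : 'End(vT)) (M : 'End(wT)) (f : 'Hom(vT, wT)) (U : {vspace vT}) l :
  stable N U -> {in U, forall u, f (N u) = M (f u)} ->
  (itl M l @: (f @: U) = f @: (itl N l @: U))%VS.
Proof.
move=> sU H; apply/vspaceP => w; apply/itl_imgP/memv_imgP.
  move=> [_ /memv_imgP[u uU ->] ->]; exists (iter l N u).
    by apply/itl_imgP; exists u.
  by rewrite (iter_morph l sU H).
move=> [_ /itl_imgP[u uU ->] ->]; exists (f u); first exact: memv_img.
by rewrite (iter_morph l sU H).
Qed.

Lemma itl_sub vT (N : 'End(vT)) (U : {vspace vT}) l : stable N U -> (itl N l @: U <= U)%VS.
Proof.
by move=> sU; apply/subvP => _ /itl_imgP[u uU ->]; apply: stable_iter.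
Qed.

Lemma stable_img vT wT (N : 'End(vT)) (M : 'End(wT)) (f : 'Hom(vT, wT)) (U : {vspace vT}) :
  stable N U -> {in U, forall u, f (N u) = M (f u)} -> stable M (f @: U).
Proof.
move=> sU H; apply/stableP => _ /memv_imgP[u uU ->].
by rewrite -H // memv_img // (stableP _ _ sU).
Qed.

Lemma stable_ker vT wT (N : 'End(vT)) (M : 'End(wT)) (f : 'Hom(vT, wT)) (U : {vspace vT}) :
  stable N U -> {in U, forall u, f (N u) = M (f u)} ->
  stable N (U :&: lker f)%VS.
Proof.
move=> sU H; apply/stableP => u; rewrite !memv_cap !memv_ker => /andP[uU /eqP fu].
by rewrite (stableP _ _ sU) // H // fu linear0 eqxx.
Qed.

Lemma rk_inj vT wT (N : 'End(vT)) (M : 'End(wT)) (f : 'Hom(vT, wT)) (U : {vspace vT}) l :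
  stable N U -> {in U, forall u, f (N u) = M (f u)} ->
  (U :&: lker f = 0)%VS -> rk M (f @: U) l = rk N U l.
Proof.
move=> sU H inj; rewrite /rk (img_itl l sU H) limg_dim_eq //.
by apply/eqP; rewrite -subv0 -inj capvS // itl_sub.
Qed.

Lemma rk_addv vT (N : 'End(vT)) (U W : {vspace vT}) l :
  stable N U -> stable N W -> (U :&: W = 0)%VS ->
  rk N (U + W) l = (rk N U l + rk N W l)%N.
Proof.
move=> sU sW UW; rewrite /rk limgD dimv_disjoint_sum //.
by apply/eqP; rewrite -subv0 -UW capvS // itl_sub.
Qed.

(* On a subspace with [ker N] inside [N^(q-1)], all Jordan blocks of [N] have
   size [q]. *)
Definition free_on q vT (N : 'End(vT)) (F : {vspace vT}) :=
  [/\ stable N F, forall v, v \in F -> iter q N v = 0 &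
      (F :&: lker N <= itl N q.-1 @: F)%VS].

Lemma itl_add vT (N : 'End(vT)) (U : {vspace vT}) l m :
  (itl N (l + m) @: U = itl N l @: (itl N m @: U))%VS.
Proof.
apply/vspaceP => w; apply/itl_imgP/itl_imgP.
  move=> [u uU ->]; exists (iter m N u); rewrite ?iterD //.
  by apply/itl_imgP; exists u.
by move=> [_ /itl_imgP[u uU ->] ->]; exists u; rewrite ?iterD.
Qed.

Lemma itl1 vT (N : 'End(vT)) (U : {vspace vT}) : (itl N 1 @: U = N @: U)%VS.
Proof.
apply/vspaceP => w; apply/itl_imgP/memv_imgP => -[u uU ->]; by exists u.
Qed.

Lemma itl_anti vT (N : 'End(vT)) (U : {vspace vT}) l m : stable N U -> (l <= m)%N ->
  (itl N m @: U <= itl N l @: U)%VS.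
Proof.
by move=> sU lm; rewrite -(subnKC lm) itl_add limgS // itl_sub.
Qed.

(** Since [F :&: lker N] lies in N^(q-1) F, it is also the kernel of N on every N^m F with m < q; so
    each step lowers the rank by the same amount [rk N F q.-1], down to 0 at q. *)
Lemma rk_free q vT (N : 'End(vT)) (F : {vspace vT}) l : (0 < q)%N -> free_on q N F ->
  (l <= q)%N -> rk N F l = ((q - l) * rk N F q.-1)%N.
Proof.
move=> q0 [sF Nq kerN]; have rkq : rk N F q = 0%N.
  apply/eqP; rewrite /rk dimv_eq0 -subv0; apply/subvP => _ /itl_imgP[u uF ->].
  by rewrite Nq // mem0v.
have step m : (m < q)%N -> rk N F m = (rk N F q.-1 + rk N F m.+1)%N.
  move=> mq; rewrite {1}/rk -(limg_ker_dim N) -[(N @: (_ @: _))%VS]itl1 -itl_add add1n.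
  congr (_ + _)%N; rewrite /rk; congr (\dim _); apply/eqP; rewrite eqEsubv.
  rewrite (subv_trans _ kerN) ?capvS ?itl_sub //= subv_cap itl_anti //=; last by lia.
  rewrite lkerE -itl1 -itl_add add1n prednK //.
  by rewrite -dimv_eq0; apply/eqP; exact: rkq.
move=> lq; rewrite -{1}(subKn lq); have : (q - l <= q)%N by apply: leq_subr.
elim: (q - l)%N => [|m IH] mq; first by rewrite subn0 rkq.
by rewrite step; [rewrite mulSn -IH; [congr (_ + rk _ _ _)%N|]|]; lia.
Qed.

(** N^q = 0 gives one inclusion; the dimensions agree because by [rk_free] the ranks at l and q - l
    add up to the dimension of F. *)
Lemma free_ker q vT (N : 'End(vT)) (F : {vspace vT}) l : (0 < q)%N -> free_on q N F ->
  (l <= q)%N -> (itl N (q - l) @: F = F :&: lker (itl N l))%VS.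
Proof.
move=> q0 fF lq; have [sF Nq kerN] := fF.
apply/eqP; rewrite eqEdim; apply/andP; split.
  rewrite subv_cap itl_sub //= lkerE -itl_add subnKC //.
  by rewrite -subv0; apply/subvP => _ /itl_imgP[u uF ->]; rewrite Nq // mem0v.
have := limg_ker_dim (itl N l) F; rewrite -/(rk N F l) -/(rk N F (q - l)).
have lq' : (q - l <= q)%N by apply: leq_subr.
rewrite -(rk0 N F) (rk_free q0 fF lq) (rk_free q0 fF lq') (rk_free q0 fF (leq0n q)).
rewrite subn0 subKn // => E; rewrite -(leq_add2r ((q - l) * rk N F q.-1)) E.
by rewrite -mulnDl subnKC.
Qed.

(* The Heller translate on ranks: passing from [A] to [F/A] reverses the rank
   sequence, [l -> q - l], up to an affine function of [l]. *)
Lemma rk_omega q vT wT (N : 'End(vT)) (M : 'End(wT)) (f : 'Hom(vT, wT)) (F : {vspace vT}) l :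
  (0 < q)%N -> free_on q N F -> {in F, forall u, f (N u) = M (f u)} ->
  (l <= q)%N ->
  (rk M (f @: F) l + \dim (F :&: lker f) =
   (q - l) * rk N F q.-1 + rk N (F :&: lker f) (q - l))%N.
Proof.
move=> q0 fF H lq; have [sF Nq kerN] := fF.
have lq' : (q - l <= q)%N by apply: leq_subr.
rewrite -(rk_free q0 fF lq) {1}/rk (img_itl l sF H).
have E1 := limg_ker_dim f (itl N l @: F).
have E2 := limg_ker_dim (itl N (q - l)) (F :&: lker f).
(* By [free_ker], N^l F is the kernel of N^(q-l) on F, so the part of it killed by f is the kernel
   of N^(q-l) on the submodule. *)
suff E : (itl N l @: F :&: lker f = F :&: lker f :&: lker (itl N (q - l)))%VS.
  by rewrite -E2 -E /rk -E1; lia.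
rewrite -{1}(subKn lq) (free_ker q0 fF lq').
by rewrite -!capvA; congr (_ :&: _)%VS; rewrite capvC.
Qed.

End RankSequence.

(** * Matrices over finite index types *)

Section KernelOperators.
Variable K : fieldType.

Notation Fn I := {ffun I -> K^o}.

(* A function [A : I -> J -> K] is a matrix with finite index types, acting on
   columns. *)
Definition kact (I J : finType) (A : I -> J -> K) (f : Fn J) : Fn I :=
  [ffun i => \sum_j A i j * f j].

Fact kact_linear (I J : finType) (A : I -> J -> K) : linear (kact A).
Proof.
move=> a f g; apply/ffunP => i; rewrite !ffunE scaler_sumr -big_split /=.
by apply: eq_bigr => j _; rewrite !ffunE mulrDr /GRing.scale /= mulrCA.
Qed.

HB.instance Definition _ (I J : finType) (A : I -> J -> K) :=
  GRing.isLinear.Build K (Fn J) (Fn I) _ (kact A) (kact_linear A).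

Definition kop (I J : finType) (A : I -> J -> K) : 'Hom(Fn J, Fn I) :=
  linfun (kact A).

Lemma kopE (I J : finType) (A : I -> J -> K) f i :
  kop A f i = \sum_j A i j * f j.
Proof. by rewrite lfunE /= ffunE. Qed.

Definition kmul (I J L : finType) (A : I -> J -> K) (B : J -> L -> K) i l :=
  \sum_j A i j * B j l.

Lemma kop_mul (I J L : finType) (A : I -> J -> K) (B : J -> L -> K) f :
  kop (kmul A B) f = kop A (kop B f).
Proof.
apply/ffunP => i; rewrite !kopE.
under eq_bigr do rewrite /kmul mulr_suml.
rewrite exchange_big /=; apply: eq_bigr => j _.
by rewrite kopE mulr_sumr; apply: eq_bigr => l _; rewrite mulrA.
Qed.

Lemma eq_kop (I J : finType) (A B : I -> J -> K) : A =2 B -> kop A = kop B.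
Proof.
move=> AB; apply/lfunP => f; apply/ffunP => i; rewrite !kopE.
by apply: eq_bigr => j _; rewrite AB.
Qed.

Definition kid (I : finType) (i j : I) : K := (i == j)%:R.

Lemma kop_id (I : finType) f : kop (@kid I) f = f.
Proof.
apply/ffunP => i; rewrite kopE (bigD1 i) //= /kid eqxx mul1r big1 ?addr0 //.
by move=> j ji; rewrite eq_sym (negbTE ji) mul0r.
Qed.

Lemma kid_suml (I : finType) (F : I -> K) i : \sum_j kid i j * F j = F i.
Proof.
rewrite (bigD1 i) //= /kid eqxx mul1r big1 ?addr0 // => j ji.
by rewrite eq_sym (negbTE ji) mul0r.
Qed.

Lemma kid_sumr (I : finType) (F : I -> K) i : \sum_j F j * kid j i = F i.
Proof.
rewrite -[RHS]kid_suml; apply: eq_bigr => j _.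
by rewrite mulrC /kid eq_sym.
Qed.

(** Product index types, instead of linearised indices, make commutativity and associativity plain
    reindexings. *)
Definition ktens (I J I' J' : finType) (A : I -> J -> K) (B : I' -> J' -> K)
  (x : I * I') (y : J * J') := A x.1 y.1 * B x.2 y.2.

Lemma ktens_mul (I J L I' J' L' : finType) (A : I -> J -> K) (B : J -> L -> K)
  (A' : I' -> J' -> K) (B' : J' -> L' -> K) :
  kmul (ktens A A') (ktens B B') =2 ktens (kmul A B) (kmul A' B').
Proof.
move=> x y; rewrite /kmul /ktens big_distrlr /= pair_big /=.
by apply: eq_bigr => j _; rewrite mulrACA.
Qed.

Lemma ktens_id (I J : finType) : ktens (@kid I) (@kid J) =2 @kid (I * J)%type.
Proof. by move=> [a b] [c d]; rewrite /ktens /kid xpair_eqE -natrM mulnb. Qed.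

Lemma eq_ktens (I J I' J' : finType) (A B : I -> J -> K) (A' B' : I' -> J' -> K) :
  A =2 B -> A' =2 B' -> ktens A A' =2 ktens B B'.
Proof. by move=> E E' x y; rewrite /ktens E E'. Qed.

Lemma eq_kmul (I J L : finType) (A B : I -> J -> K) (A' B' : J -> L -> K) :
  A =2 B -> A' =2 B' -> kmul A A' =2 kmul B B'.
Proof. by move=> E E' x y; apply: eq_bigr => j _; rewrite E E'. Qed.

Lemma kmul1l (I J : finType) (A : I -> J -> K) : kmul (@kid I) A =2 A.
Proof. by move=> x y; rewrite /kmul kid_suml. Qed.

Lemma kmul1r (I J : finType) (A : I -> J -> K) : kmul A (@kid J) =2 A.
Proof. by move=> x y; rewrite /kmul kid_sumr. Qed.

Lemma kmulA (I J L M : finType) (A : I -> J -> K) (B : J -> L -> K) (C : L -> M -> K) :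
  kmul A (kmul B C) =2 kmul (kmul A B) C.
Proof.
move=> x y; rewrite /kmul.
under eq_bigr do rewrite mulr_sumr.
rewrite exchange_big /=; apply: eq_bigr => l _.
by rewrite mulr_suml; apply: eq_bigr => j _; rewrite mulrA.
Qed.

Lemma dim_Fn (I : finType) : \dim (fullv : {vspace Fn I}) = #|I|.
Proof. by rewrite dimvf /dim /= muln1. Qed.

End KernelOperators.

(** * Operators of p-power order: the norm and Higman's criterion *)

Section PolynomialAction.
Variables (K : fieldType) (vT : vectType K) (G : 'End(vT)).

(** The action of P evaluated at G. Identities between powers of G and of G - 1 are proved for
    polynomials over K, where the Frobenius map and cancellation of X - 1 are available. *)
Definition pact (v : vT) (P : {poly K}) := \sum_(i < size P) P`_i *: iter i G v.

Lemma pactE v (P : {poly K}) n : (size P <= n)%N -> pact v P = \sum_(i < n) P`_i *: iter i G v.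
Proof.
move=> le; rewrite /pact [LHS](big_ord_widen n (fun i => P`_i *: iter i G v)) // [LHS]big_mkcond /=.
by apply: eq_bigr => i _; case: ltnP => // Pi; rewrite nth_default // scale0r.
Qed.

Lemma pactD v (P Q : {poly K}) : pact v (P + Q) = pact v P + pact v Q.
Proof.
pose n := maxn (size P) (size Q).
rewrite !(@pactE v _ n) ?leq_maxl ?leq_maxr ?size_polyD // -big_split /=.
by apply: eq_bigr => i _; rewrite coefD scalerDl.
Qed.

Lemma pactN v (P : {poly K}) : pact v (- P) = - pact v P.
Proof.
rewrite /pact size_polyN -sumrN; apply: eq_bigr => i _.
by rewrite coefN scaleNr.
Qed.

Lemma pactX v (P : {poly K}) : pact v ('X * P) = G (pact v P).
Proof.
rewrite (@pactE v _ (size P).+1); last first.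
  by rewrite (leq_trans (size_polyMleq _ _)) // size_polyX.
rewrite big_ord_recl coefXM eqxx scale0r add0r linear_sum /=.
by apply: eq_bigr => i _; rewrite coefXM /= linearZ.
Qed.

Lemma pact1 v : pact v (1 : {poly K}) = v.
Proof. by rewrite /pact size_poly1 big_ord1 coefC eqxx scale1r. Qed.

Lemma pactXn v n : pact v 'X^n = iter n G v.
Proof. by elim: n => [|n IH]; rewrite ?expr0 ?pact1 // exprS pactX IH. Qed.

Lemma pact_sum v (I : Type) (r : seq I) (F : I -> {poly K}) :
  pact v (\sum_(i <- r) F i) = \sum_(i <- r) pact v (F i).
Proof.
elim: r => [|i r IH]; last by rewrite !big_cons pactD IH.
by rewrite !big_nil /pact size_poly0 big_ord0.
Qed.

Lemma pact_X1n v n : pact v (('X - 1) ^+ n) = iter n (G - \1%VF) v.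
Proof.
elim: n => [|n IH]; first by rewrite expr0 pact1.
rewrite exprS mulrBl mul1r pactD pactN pactX IH /=.
by rewrite add_lfunE opp_lfunE id_lfunE.
Qed.

Variables (p k : nat).
Hypothesis charK : p \in [pchar K].

Lemma X1_pow : ('X - 1 : {poly K}) ^+ (p ^ k) = 'X^(p ^ k) - 1.
Proof.
have cP : p \in [pchar {poly K}] by rewrite pchar_poly.
elim: k => [|m IH]; first by rewrite !expr1.
by rewrite ?expn0 // expnSr !exprM IH -!(pFrobenius_autE cP)
  pFrobenius_autB_comm ?pFrobenius_aut1 //; apply: commr1.
Qed.

Lemma iter_sub1 v : iter (p ^ k) (G - \1%VF) v = iter (p ^ k) G v - v.
Proof. by rewrite -pact_X1n X1_pow pactD pactN pactXn pact1. Qed.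

(** With q = p^k, both (X - 1)^(q-1) and 1 + X + ... + X^(q-1) become X^q - 1 after multiplication
    by X - 1. So the (q-1)-st power of G - 1 is the norm. *)
Lemma iter_trace v :
  iter (p ^ k).-1 (G - \1%VF) v = \sum_(a < p ^ k) iter a G v.
Proof.
have p0 : (0 < p ^ k)%N by rewrite expn_gt0 prime_gt0 // (pcharf_prime charK).
rewrite -pact_X1n; under eq_bigr do rewrite -pactXn.
rewrite -pact_sum; congr pact.
have X0 : 'X - 1 != 0 :> {poly K} by rewrite -polyC1 polyXsubC_eq0.
apply: (mulfI X0); rewrite -exprS prednK // X1_pow subrX1.
by congr (_ * _); apply: eq_bigr => i _.
Qed.

(** Higman's criterion: when each fixed v is the norm of [th v], [iter_trace] puts the fixed
    vectors, which are the kernel of G - 1, inside the image of its (q-1)-st power, where q =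
    p^k. *)
Lemma higman (F : {vspace vT}) (th : vT -> vT) :
  (forall v, v \in F -> G v \in F) ->
  (forall v, v \in F -> iter (p ^ k) G v = v) ->
  (forall v, v \in F -> th v \in F) ->
  (forall v, v \in F -> G v = v -> \sum_(a < p ^ k) iter a G (th v) = v) ->
  free_on (p ^ k) (G - \1%VF) F.
Proof.
move=> sG qG sth tr; split.
- apply/stableP => u uF; rewrite add_lfunE opp_lfunE id_lfunE.
  by rewrite rpredB // sG.
- by move=> v vF; rewrite iter_sub1 qG // subrr.
apply/subvP => v; rewrite memv_cap memv_ker => /andP[vF].
rewrite add_lfunE opp_lfunE id_lfunE subr_eq0 => /eqP Gv.
apply/itl_imgP; exists (th v); first exact: sth.
by rewrite iter_trace tr.
Qed.

End PolynomialAction.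

(** * The Green ring modulo the regular module *)

Section StableGreen.
Variables (K : fieldType) (q : nat).
Implicit Types a b c : green q.

Definition gcl (vT : vectType K) (N : 'End(vT)) (U : {vspace vT}) : green q :=
  [ffun i : 'I_q => (rk N U i)%:Z - (rk N U i.+1)%:Z *+ 2 + (rk N U i.+2)%:Z].

Lemma eq_gcl (vT wT : vectType K) (N : 'End(vT)) (M : 'End(wT)) U W :
  rk N U =1 rk M W -> gcl N U = gcl M W.
Proof. by move=> E; apply/ffunP => i; rewrite !ffunE !E. Qed.

Lemma gclD (vT wT xT : vectType K) (N : 'End(vT)) (M : 'End(wT)) (L : 'End(xT)) U W X :
  (forall l, rk L X l = rk N U l + rk M W l)%N -> gcl L X = gcl N U + gcl M W.
Proof. by move=> E; apply/ffunP => i; rewrite !ffunE !E; lia. Qed.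

(* Congruence modulo [Z V_q]: the last coordinate is ignored. *)
Definition eqm a b := forall i : 'I_q, (i.+1 < q)%N -> a i = b i.
Local Notation "a =~ b" := (eqm a b) (at level 70).

Lemma eqm_refl a : a =~ a. Proof. by []. Qed.
Lemma eqm_sym a b : a =~ b -> b =~ a.
Proof. by move=> H i iq; rewrite H. Qed.
Lemma eqm_trans b a c : a =~ b -> b =~ c -> a =~ c.
Proof. by move=> H H' i iq; rewrite H ?H'. Qed.
Lemma eqmD a b a' b' : a =~ b -> a' =~ b' -> a + a' =~ b + b'.
Proof. by move=> H H' i iq; rewrite !ffunE H ?H'. Qed.
Lemma eqmN a b : a =~ b -> - a =~ - b.
Proof. by move=> H i iq; rewrite !ffunE H. Qed.
Lemma eqm_sum (I : Type) (r : seq I) (P : pred I) (F G : I -> green q) :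
  (forall i, P i -> F i =~ G i) -> \sum_(i <- r | P i) F i =~ \sum_(i <- r | P i) G i.
Proof. by move=> H; elim/big_rec2: _ => // i x y Pi; apply/eqmD/H. Qed.

Lemma green_mulz a (z : int) i : (a *~ z) i = a i *~ z.
Proof.
by case: z => n; rewrite ?NegzE ?mulrNz ?ffunE -!pmulrn ?ffunMnE.
Qed.

Lemma eqmZ a b (z : int) : a =~ b -> a *~ z =~ b *~ z.
Proof. by move=> H i iq; rewrite !green_mulz H. Qed.

Lemma eqmP a b : a =~ b <-> exists m : int, a - b = V q q *~ m.
Proof.
split=> [H|[m E] i iq]; last first.
  move/ffunP/(_ i): E; rewrite green_mulz !ffunE.
  by case: eqP => [|_]; [lia | rewrite mul0rz => /eqP; rewrite subr_eq0 => /eqP].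
case: (posnP q) => [q0|q_gt0].
  by exists 0; apply/ffunP => -[i iq]; exfalso; lia.
have lq : (q.-1 < q)%N by rewrite prednK.
exists (a (Ordinal lq) - b (Ordinal lq)).
apply/ffunP => i; rewrite green_mulz !ffunE.
case: eqP => [E|E]; last first.
  by rewrite mul0rz H ?subrr //; have := ltn_ord i; lia.
have -> : i = Ordinal lq by apply: val_inj => /=; lia.
by rewrite /= intz.
Qed.

Lemma Omega_is_additive : zmod_morphism (@Omega q).
Proof.
move=> a b; rewrite /Omega -sumrB; apply: eq_bigr => i _.
by rewrite !ffunE mulrzBr.
Qed.
HB.instance Definition _ :=
  GRing.isZmodMorphism.Build (green q) (green q) (@Omega q) Omega_is_additive.

(** The condition reads (i + 1) + (j + 1) = q, as coordinate i belongs to V_(i+1). So Omega permutes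
    the coordinates below the last one, which makes it compatible with the congruence. *)
Lemma OmegaE a (i j : 'I_q) : (i + j).+2 = q -> Omega a i = a j.
Proof.
move=> E; rewrite /Omega sum_ffunE (bigD1 j) //= big1 => [|l lj].
  by rewrite green_mulz ffunE addr0; case: eqP => [_|]; [rewrite intz|lia].
rewrite green_mulz ffunE; case: eqP => [E'|]; last by rewrite mul0rz.
case/eqP: lj; apply: val_inj => /=; have := ltn_ord l; lia.
Qed.

Lemma co_ord (i : 'I_q) : (i.+1 < q)%N ->
  exists2 j : 'I_q, (j.+1 < q)%N & (i + j).+2 = q.
Proof.
move=> iq; have H : (q - i.+2 < q)%N by lia.
by exists (Ordinal H) => /=; lia.
Qed.

Lemma eqm_Omega a b : a =~ b -> Omega a =~ Omega b.
Proof.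
by move=> H i iq; have [j jq E] := co_ord iq; rewrite !(OmegaE _ E) H.
Qed.

Lemma eqm_iter_Omega a b n : a =~ b -> iter n (@Omega q) a =~ iter n (@Omega q) b.
Proof. by move=> H; elim: n => //= n; apply: eqm_Omega. Qed.

(** The ranks are affine in l up to l = q, so the second differences centred below q vanish; only
    the ignored coordinate can survive. *)
Lemma gcl_free (vT : vectType K) (N : 'End(vT)) F : (0 < q)%N ->
  free_on q N F -> gcl N F =~ 0.
Proof.
move=> q0 fF i iq; have R l (lq : (l <= q)%N) := rk_free q0 fF lq.
rewrite !ffunE.
have := R i; have := R i.+1; have := R i.+2.
have -> : (q - i = (q - i.+2).+2)%N by lia.
have -> : (q - i.+1 = (q - i.+2).+1)%N by lia.
rewrite !mulSn; set x := ((q - i.+2) * _)%N; lia.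
Qed.

(** The affine term of [rk_omega] disappears in second differences, and the reversal of l into q - l
    is what Omega does to coordinates. *)
Lemma gcl_omega (vT wT : vectType K) (N : 'End(vT)) (M : 'End(wT))
    (f : 'Hom(vT, wT)) F :
  (0 < q)%N -> free_on q N F -> {in F, forall u, f (N u) = M (f u)} ->
  gcl N (F :&: lker f)%VS =~ Omega (gcl M (f @: F)).
Proof.
move=> q0 fF H i iq; have [j jq E] := co_ord iq; rewrite (OmegaE _ E) !ffunE.
have R l (lq : (l <= q)%N) := rk_omega (M := M) q0 fF H lq.
have := R j; have := R j.+1; have := R j.+2.
have -> : (q - j.+2 = i)%N by lia.
have -> : (q - j.+1 = i.+1)%N by lia.
have -> : (q - j = i.+2)%N by lia.
rewrite !mulSn; set x := (i * _)%N; lia.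
Qed.

(* [ker f] is the direct sum of [im e] and [ker e :&: ker f], and the free module
   [ker e] is mapped by [f] onto [im f]. *)
Lemma gcl_split (vT wT : vectType K) (N : 'End(vT)) (M : 'End(wT))
    (f : 'Hom(vT, wT)) (e : 'End(vT)) :
  (0 < q)%N -> (forall u, e (N u) = N (e u)) -> (forall u, f (N u) = M (f u)) ->
  (forall u, e (e u) = e u) -> (forall u, f (e u) = 0) -> free_on q N (lker e) ->
  gcl N (lker f) =~ gcl N fullv + Omega (gcl M (limg f)).
Proof.
move=> q0 eN fN ee fe fK.
have [sK _ _] := fK.
have sI : stable N (limg e) by apply: stable_img (stablef N) _ => u _; rewrite eN.
have IK0 : (limg e :&: lker e = 0)%VS.
  apply/eqP; rewrite -subv0; apply/subvP => _ /memv_capP[/memv_imgP[u _ ->]].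
  by rewrite memv_ker ee memv0.
have dec u : u = e u + (u - e u) by rewrite addrC subrK.
have kdec u : u - e u \in lker e by rewrite memv_ker linearB /= ee subrr.
have full : (fullv = limg e + lker e)%VS.
  apply/eqP; rewrite eq_sym eqEsubv subvf; apply/subvP => u _.
  by rewrite (dec u) memv_add // memv_img // memvf.
have kf : (lker f = limg e + (lker e :&: lker f))%VS.
  apply/eqP; rewrite eqEsubv; apply/andP; split; apply/subvP => u.
    rewrite memv_ker => /eqP fu; rewrite (dec u) memv_add ?memv_img ?memvf //.
    by rewrite memv_cap kdec memv_ker linearB /= fe fu subr0 eqxx.
  case/memv_addP => _ /memv_imgP[v _ ->] [w /memv_capP[_ wf] ->].
  by move: wf; rewrite !memv_ker linearD /= fe add0r.
have imf : (limg f = f @: lker e)%VS.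
  rewrite full limgD; apply/addv_idPr; apply/subvP => _ /memv_imgP[_ /memv_imgP[v _ ->] ->].
  by rewrite fe mem0v.
have E1 : gcl N fullv = gcl N (limg e) + gcl N (lker e).
  by apply: gclD => l; rewrite {1}full rk_addv.
have E2 : gcl N (lker f) = gcl N (limg e) + gcl N (lker e :&: lker f)%VS.
  apply: gclD => l; rewrite {1}kf rk_addv //.
    by apply: (@stable_ker _ _ _ _ M) => // u _; apply: fN.
  by apply/eqP; rewrite -subv0 -IK0 capvS ?capvSl.
rewrite E1 E2 -addrA; apply: eqmD => //.
apply: eqm_trans (gcl_omega (M := M) q0 fK _) _; first by move=> u _; apply: fN.
rewrite imf -[X in X =~ _]add0r; apply: eqmD => //.
exact/eqm_sym/gcl_free.
Qed.

Definition kcl (I : finType) (A : I -> I -> K) : green q :=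
  gcl (kop A - \1%VF) fullv.

End StableGreen.

(** * Classes of matrices: isomorphism, direct sums, powers *)

Section KernelClasses.
Variable K : fieldType.
Notation Fn I := {ffun I -> K^o}.

Definition kN (I : finType) (A : I -> I -> K) : 'End(Fn I) := kop A - \1%VF.

Lemma kNE (I : finType) (A : I -> I -> K) f : kN A f = kop A f - f.
Proof. by rewrite add_lfunE opp_lfunE id_lfunE. Qed.

Lemma rk_iso (I J : finType) (A : I -> I -> K) (B : J -> J -> K)
    (X : J -> I -> K) (Y : I -> J -> K) l :
  kmul Y X =2 @kid K I -> kmul X Y =2 @kid K J -> kmul X A =2 kmul B X ->
  rk (kN A) fullv l = rk (kN B) fullv l.
Proof.
move=> YX XY XA.
have fY : (fullv = kop X @: fullv)%VS.
  apply/eqP; rewrite eq_sym eqEsubv subvf; apply/subvP => f _.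
  apply/memv_imgP; exists (kop Y f); first exact: memvf.
  by rewrite -kop_mul (eq_kop XY) kop_id.
rewrite [in RHS]fY; symmetry; apply: rk_inj; first exact: stablef.
  by move=> f _; rewrite !kNE linearB /= -!kop_mul (eq_kop XA).
apply/eqP; rewrite -subv0; apply/subvP => f; rewrite memv_cap memv_ker => /andP[_ /eqP Xf].
by rewrite memv0 -[f]kop_id -(eq_kop YX) kop_mul Xf linear0.
Qed.

Lemma kcl_iso q (I J : finType) (A : I -> I -> K) (B : J -> J -> K)
    (X : J -> I -> K) (Y : I -> J -> K) :
  kmul Y X =2 @kid K I -> kmul X Y =2 @kid K J -> kmul X A =2 kmul B X ->
  kcl q A = kcl q B.
Proof. by move=> YX XY XA; apply: eq_gcl => l; apply: rk_iso YX XY XA. Qed.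

Lemma eq_kcl q (I : finType) (A B : I -> I -> K) : A =2 B -> kcl q A = kcl q B.
Proof. by move=> E; rewrite /kcl (eq_kop E). Qed.

Lemma rk_reindex (I J : finType) (phi : I -> J) (B : J -> J -> K) l :
  bijective phi ->
  rk (kN (fun x y => B (phi x) (phi y))) fullv l = rk (kN B) fullv l.
Proof.
move=> [psi phiK psiK].
apply: (@rk_iso _ _ _ _ (fun j i => (j == phi i)%:R) (fun i j => (j == phi i)%:R)).
- move=> x y; rewrite /kmul (bigD1 (phi x)) //= eqxx mul1r big1 => [|j jx].
    by rewrite addr0 /kid (inj_eq (can_inj phiK)).
  by rewrite (negbTE jx) mul0r.
- move=> x y; rewrite /kmul (bigD1 (psi x)) //= psiK eqxx mul1r big1 => [|j jx].
    by rewrite addr0 /kid eq_sym.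
  by rewrite -(can_eq psiK) phiK eq_sym (negbTE jx) mul0r.
move=> x y; rewrite /kmul (bigD1 (psi x)) //= psiK eqxx mul1r big1 => [|j jx].
  rewrite (bigD1 (phi y)) //= eqxx mulr1 big1 => [|j jy]; first by rewrite !addr0.
  by rewrite (negbTE jy) mulr0.
by rewrite -(can_eq psiK) phiK eq_sym (negbTE jx) mul0r.
Qed.

Lemma kcl_reindex q (I J : finType) (phi : I -> J) (B : J -> J -> K) :
  bijective phi -> kcl q (fun x y => B (phi x) (phi y)) = kcl q B.
Proof. by move=> H; apply: eq_gcl => l; apply: rk_reindex. Qed.

Definition ksum (I J : finType) (A : I -> I -> K) (B : J -> J -> K) (x y : I + J) : K :=
  match x, y with
  | inl i, inl i' => A i i' | inr j, inr j' => B j j' | _, _ => 0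
  end.

Lemma rk_ksum (I J : finType) (A : I -> I -> K) (B : J -> J -> K) l :
  rk (kN (ksum A B)) fullv l = (rk (kN A) fullv l + rk (kN B) fullv l)%N.
Proof.
pose iL : (I + J)%type -> I -> K := fun x i => (x == inl i)%:R.
pose iR : (I + J)%type -> J -> K := fun x j => (x == inr j)%:R.
have LE f x : kop iL f x = if x is inl i then f i else 0.
  rewrite kopE; case: x => i; last first.
    by rewrite big1 // => j _; rewrite /iL mul0r.
  by rewrite -[RHS]kid_suml; apply: eq_bigr.
have RE f x : kop iR f x = if x is inr i then f i else 0.
  rewrite kopE; case: x => i.
    by rewrite big1 // => j _; rewrite /iR mul0r.
  by rewrite -[RHS]kid_suml; apply: eq_bigr.
have LN f : kop iL (kN A f) = kN (ksum A B) (kop iL f).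
  apply/ffunP => x; rewrite !kNE LE !ffunE LE kopE big_sumType /=.
  rewrite [X in _ + X - _]big1 => [|j _]; last by rewrite LE mulr0.
  case: x => i; last by rewrite big1 => [|j _]; rewrite ?mul0r //= subr0 addr0.
  by rewrite addr0 !ffunE kopE; congr (_ - _); apply: eq_bigr => j _; rewrite LE.
have RN f : kop iR (kN B f) = kN (ksum A B) (kop iR f).
  apply/ffunP => x; rewrite !kNE RE !ffunE RE kopE big_sumType /=.
  rewrite [X in X + _ - _]big1 => [|j _]; last by rewrite RE mulr0.
  case: x => i; first by rewrite big1 => [|j _]; rewrite ?mul0r //= subr0 addr0.
  by rewrite add0r !ffunE kopE; congr (_ - _); apply: eq_bigr => j _; rewrite RE.
have sL : stable (kN (ksum A B)) (limg (kop iL)).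
  by apply: stable_img (stablef (kN A)) _ => u _; rewrite LN.
have sR : stable (kN (ksum A B)) (limg (kop iR)).
  by apply: stable_img (stablef (kN B)) _ => u _; rewrite RN.
have -> : fullv = (limg (kop iL) + limg (kop iR))%VS.
  apply/eqP; rewrite eq_sym eqEsubv subvf; apply/subvP => f _.
  apply/memv_addP; exists (kop iL [ffun i => f (inl i)]); first by rewrite memv_img ?memvf.
  exists (kop iR [ffun i => f (inr i)]); first by rewrite memv_img ?memvf.
  by apply/ffunP => -[] i; rewrite ffunE LE RE !ffunE ?addr0 ?add0r.
have kL : (fullv :&: lker (kop iL) = 0)%VS.
  apply/eqP; rewrite -subv0; apply/subvP => f; rewrite memv_cap memv_ker => /andP[_ /eqP E].
  by rewrite memv0; apply/eqP/ffunP => i; move/ffunP/(_ (inl i)): E; rewrite LE !ffunE.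
have kR : (fullv :&: lker (kop iR) = 0)%VS.
  apply/eqP; rewrite -subv0; apply/subvP => f; rewrite memv_cap memv_ker => /andP[_ /eqP E].
  by rewrite memv0; apply/eqP/ffunP => i; move/ffunP/(_ (inr i)): E; rewrite RE !ffunE.
rewrite rk_addv //.
  by congr (_ + _)%N; apply: rk_inj => //; try exact: stablef; move=> u _; rewrite ?LN ?RN.
apply/eqP; rewrite -subv0; apply/subvP => f.
case/memv_capP => /memv_imgP[u _ ->] /memv_imgP[v _ E]; rewrite memv0.
by apply/eqP/ffunP => -[] i; rewrite [RHS]ffunE; [rewrite E RE | rewrite LE].
Qed.

Definition kpow (I : finType) (A : I -> I -> K) n : I -> I -> K :=
  iter n (kmul A) (@kid K I).

Lemma eq_kpow (I : finType) (A B : I -> I -> K) n : A =2 B -> kpow A n =2 kpow B n.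
Proof. by move=> E; elim: n => //= n IH; apply: eq_kmul. Qed.

Lemma kop_kpow (I : finType) (A : I -> I -> K) n f :
  kop (kpow A n) f = iter n (kop A) f.
Proof. by elim: n => [|n IH] /=; rewrite ?kop_id // kop_mul IH. Qed.

Lemma kpow_tens (I J : finType) (A : I -> I -> K) (B : J -> J -> K) n :
  kpow (ktens A B) n =2 ktens (kpow A n) (kpow B n).
Proof.
elim: n => [|n IH] x y /=; first by rewrite ktens_id.
by rewrite -ktens_mul; apply: eq_kmul.
Qed.

Lemma kpow_reindex (I J : finType) (phi : I -> J) (B : J -> J -> K) n :
  bijective phi ->
  kpow (fun x y => B (phi x) (phi y)) n =2 (fun x y => kpow B n (phi x) (phi y)).
Proof.
move=> bij x y; elim: n x y => [|n IH] x y /=.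
  by rewrite /kid (inj_eq (bij_inj bij)).
rewrite /kmul [RHS](reindex phi) /=; last exact: onW_bij.
by apply: eq_bigr => j _; rewrite IH.
Qed.

(** The relation needed for A to give a module of the cyclic group of order q. It passes to tensor
    products and to symmetric and exterior powers because these respect matrix products. *)
Definition kuni q (I : finType) (A : I -> I -> K) := kpow A q =2 @kid K I.

Lemma kuni_iter q (I : finType) (A : I -> I -> K) f :
  kuni q A -> iter q (kop A) f = f.
Proof. by move=> uA; rewrite -kop_kpow (eq_kop uA) kop_id. Qed.

Lemma eq_kuni q (I : finType) (A B : I -> I -> K) : A =2 B -> kuni q A -> kuni q B.
Proof. by move=> E uA x y; rewrite -uA; apply: eq_kpow => i j; rewrite E. Qed.

Lemma kuni_tens q (I J : finType) (A : I -> I -> K) (B : J -> J -> K) :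
  kuni q A -> kuni q B -> kuni q (ktens A B).
Proof.
move=> uA uB x y; rewrite kpow_tens -ktens_id; exact: eq_ktens.
Qed.

Lemma kuni_reindex q (I J : finType) (phi : I -> J) (B : J -> J -> K) :
  bijective phi -> kuni q B -> kuni q (fun x y => B (phi x) (phi y)).
Proof.
by move=> bij uB x y; rewrite kpow_reindex // uB /kid (inj_eq (bij_inj bij)).
Qed.

End KernelClasses.

(** * Jordan decomposition *)

Section JordanBasis.
Variables (K : fieldType) (vT : vectType K) (N : 'End(vT)).

Definition chain (v : vT) m := mkseq (fun i => iter i N v) m.

Lemma nth_chain v m i : (i < m)%N -> nth 0 (chain v m) i = iter i N v.
Proof. by move=> im; rewrite nth_mkseq. Qed.

Section Complement.
Variables (phi : 'Hom(vT, K^o)) (v : vT) (m : nat).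

(** Its kernel will be the N-stable complement of the chain of v: the u such that phi kills u, N u,
    ..., N^(m-1) u. *)
Definition phis : 'Hom(vT, {ffun 'I_m -> K^o}) :=
  linfun (fun u : vT => [ffun i : 'I_m => phi (iter i N u)] : {ffun 'I_m -> K^o}).

Lemma iter_linear i : linear (iter i N).
Proof. by move=> a x y; rewrite -!itlE linearP. Qed.

Lemma phisE u i : phis u i = phi (iter i N u).
Proof.
pose f := fun u : vT => [ffun i : 'I_m => phi (iter i N u)] : {ffun 'I_m -> K^o}.
have lf : linear f.
  by move=> a x y; apply/ffunP => j; rewrite !ffunE iter_linear linearP.
pose F : {linear vT -> {ffun 'I_m -> K^o}} :=
  HB.pack f (GRing.isLinear.Build _ _ _ _ f lf).
by rewrite /phis (lfunE F) ffunE.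
Qed.

(** The matrix of the values phi(N^(i+l) v), for i, l < m, vanishes for i + l >= m and is a nonzero
    constant on the antidiagonal i + l = m - 1. This gives both the independence of the chain and
    its trivial intersection with the kernel of [phis]. *)
Lemma chain_free (c : 'I_m -> K) :
  iter m N v = 0 -> phi (iter m.-1 N v) != 0 ->
  phis (\sum_(i < m) c i *: iter i N v) = 0 -> forall i, c i = 0.
Proof.
move=> Nm phi0 E i.
have [n] := ubnP i; elim: n i => // n IH i; rewrite ltnS => le_in.
have H : (m.-1 - i < m)%N by case: i {le_in} => i /= im; lia.
move/ffunP/(_ (Ordinal H)): E; rewrite phisE ffunE /=.
rewrite -itlE linear_sum linear_sum (bigD1 i) //= big1 => [|j ji].
  rewrite addr0 !linearZ /= itlE -iterD.
  have -> : (m.-1 - i + i)%N = m.-1 by case: i {H le_in} => i /= im; lia.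
  by move=> /eqP; rewrite mulf_eq0 (negbTE phi0) orbF => /eqP.
case: (ltnP j i) => [lt_ji|le_ij].
  by rewrite IH ?scale0r ?linear0 //; lia.
have lt_ij : (i < j)%N by rewrite ltn_neqAle le_ij andbT eq_sym.
rewrite !linearZ /= itlE -iterD.
have -> : (m.-1 - i + j = (m.-1 - i + j - m) + m)%N.
  by move: lt_ij; case: i {H le_in ji le_ij} => i /= im; lia.
by rewrite iterD Nm -itlE !linear0.
Qed.

End Complement.

(** The values of [scanl addn 0] are the partial sums of s, that is the ends of the blocks: N sends
    each vector to the next, except at the end of a block. *)
Definition jordan_basis q (U : {vspace vT}) (s : seq nat) (X : seq vT) :=
  [/\ basis_of U X, all (fun x => (0 < x <= q)%N) s, sumn s = size X &
    forall i, (i < size X)%N ->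
      N X`_i = if i.+1 \in scanl addn 0%N s then 0 else X`_i.+1].

Lemma scanl_addn n s : scanl addn n s = map (addn n) (scanl addn 0%N s).
Proof.
elim: s n => //= x s IH n; rewrite add0n IH [in RHS]IH -map_comp; congr (_ :: _).
by apply: eq_map => y /=; rewrite addnA.
Qed.

(** Induction on the dimension, splitting off a chain of maximal length; maximality makes the
    complement N-stable. [coord v] stands for a functional that does not vanish at v. *)
Lemma jordan_exists q (coord : vT -> 'Hom(vT, K^o)) :
  (forall v, v != 0 -> coord v v != 0) ->
  forall U : {vspace vT}, stable N U -> (forall u, u \in U -> iter q N u = 0) ->
  exists s X, jordan_basis q U s X.
Proof.
move=> coordP U.
have [n] := ubnP (\dim U); elim: n U => // n IH U; rewrite ltnS => dimU sU NqU.
case: (boolP (U == 0%VS)) => [/eqP -> | U0].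
  by exists [::], [::]; split => //; rewrite /basis_of span_nil eqxx nil_free.
have exm : exists m, (itl N m @: U == 0)%VS.
  exists q; rewrite -subv0; apply/subvP => _ /itl_imgP[u uU ->].
  by rewrite NqU // mem0v.
have [m /eqP Nm minm] := ex_minnP exm.
have m0 : (0 < m)%N.
  case: m Nm {minm} => // E; case/eqP: U0.
  by apply/eqP; rewrite -dimv_eq0 -(rk0 N) /rk E dimv0.
have mq : (m <= q)%N.
  apply: minm; rewrite -subv0; apply/subvP => _ /itl_imgP[u uU ->].
  by rewrite NqU // mem0v.
have NmU u : u \in U -> iter m N u = 0.
  by move=> uU; apply/eqP; rewrite -memv0 -Nm; apply/itl_imgP; exists u.
have : (itl N m.-1 @: U != 0)%VS by apply/negP => /minm; lia.
rewrite -subv0 => /subvPn[_ /itl_imgP[v vU ->]]; rewrite memv0 => w0.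
pose phi := coord (iter m.-1 N v); have phi0 := coordP _ w0.
rewrite -/phi in phi0.
pose U' := (U :&: lker (phis phi m))%VS.
have cfree := chain_free (NmU v vU) phi0.
have sU' : stable N U'.
  apply/stableP => u /memv_capP[uU]; rewrite memv_ker => /eqP E.
  rewrite memv_cap (stableP _ _ sU) //= memv_ker; apply/eqP/ffunP => i.
  rewrite phisE ffunE -iterSr; case: (ltnP i.+1 m) => [im|mi].
    by move/ffunP/(_ (Ordinal im)): E; rewrite phisE ffunE.
  have -> : i.+1 = m by have := ltn_ord i; lia.
  by rewrite NmU // linear0.
have vC i : iter i N v \in U by apply: stable_iter.
have csz : size (chain v m) = m by rewrite size_mkseq.
have freeC : free (chain v m).
  have sz : size (chain v m) == m by rewrite csz.
  apply/(@freeP _ _ _ (Tuple sz)) => c E; apply: cfree.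
  rewrite -[RHS](linear0 (phis phi m)) -[in RHS]E; congr (phis _ _ _).
  by apply: eq_bigr => i _; rewrite /= nth_chain.
have dimC : \dim <<chain v m>> = m by rewrite -[RHS]csz; apply/eqP; exact: freeC.
have CU : (<<chain v m>> <= U)%VS.
  by apply/span_subvP => _ /mapP[i _ ->].
have CK : (<<chain v m>> :&: U' = 0)%VS.
  apply/eqP; rewrite -subv0; apply/subvP => u /memv_capP[uC /memv_capP[_]].
  rewrite memv_ker memv0 => /eqP E.
  have sz : size (chain v m) == m by rewrite csz.
  move: E; rewrite (coord_span (X := Tuple sz) uC).
  under eq_bigr => i _ do rewrite /= nth_chain //.
  by move/cfree => c0; apply/eqP; rewrite big1 // => i _; rewrite c0 scale0r.
(* The complement is cut out by m linear forms, so at most m dimensions are lost, and the chain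
   supplies exactly m. *)
have dU : (\dim U <= \dim U' + m)%N.
  rewrite -(limg_ker_dim (phis phi m) U) leq_add2l.
  by rewrite (leq_trans (dimvS (subvf _))) // dim_Fn card_ord.
have UE : (<<chain v m>> + U' = U)%VS.
  apply/eqP; rewrite eqEdim subv_add CU capvSl /=.
  by rewrite dimv_disjoint_sum // dimC addnC.
have [|s [X [bX all_s sumX NX]]] := IH U' _ sU' (fun u uU' => NqU u (subvP (capvSl _ _) u uU')).
  rewrite (leq_trans _ dimU) // -UE dimv_disjoint_sum // dimC; clear -m0; lia.
exists (m :: s), (chain v m ++ X); split.
- rewrite /basis_of span_cat (span_basis bX) UE eqxx /= cat_free freeC (basis_free bX) /=.
  by rewrite directvE /= (span_basis bX) dimv_disjoint_sum // (span_basis bX).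
- by rewrite /= m0 mq.
- by rewrite /= sumX size_cat csz.
move=> i; rewrite size_cat csz => isz; rewrite !nth_cat csz /= add0n scanl_addn inE.
case: (ltnP i m) => im.
  rewrite nth_chain //; case: eqP => [E|ne].
    rewrite /= -{1}(NmU v vU) -E //.
  have im' : (i.+1 < m)%N by clear -im ne; lia.
  by rewrite im' nth_chain //; case: mapP => // -[j _ E]; clear -im' E; lia.
have -> : (i.+1 < m)%N = false by clear -im; lia.
have -> : (i.+1 == m) = false by clear -im; lia.
rewrite NX; last by clear -im isz; lia.
rewrite subSn // (_ : i.+1 = m + (i - m).+1)%N; last by clear -im; lia.
by rewrite (mem_map (@addnI m)).
Qed.

End JordanBasis.

Section Classes.
Variables (K : fieldType).

Definition kmatrix d (g : 'M[K]_d) : 'I_d -> 'I_d -> K := fun i j => g i j.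

Lemma row_iter d (g : 'M[K]_d) (v : 'rV_d) n :
  iter n (mulmx^~ g) v = v *m \matrix_(i, j) kpow (kmatrix g) n i j.
Proof.
elim: n v => [|n IH] v.
  rewrite /= (_ : \matrix_(i, j) _ = 1%:M) ?mulmx1 //.
  by apply/matrixP => i j; rewrite !mxE.
rewrite iterSr IH -mulmxA; congr (_ *m _); apply/matrixP => i j; rewrite !mxE.
by apply: eq_bigr => l _; rewrite mxE.
Qed.

Lemma decomp_exists p k d (g : 'M[K]_d) : p \in [pchar K] ->
  kuni (p ^ k) (kmatrix g) -> exists s, decomp (p ^ k) g s.
Proof.
move=> charK ug.
pose G : 'End('rV[K]_d) := linfun (mulmxr g).
have GE v : G v = v *m g by rewrite lfunE.
have itG n v : iter n G v = iter n (mulmx^~ g) v.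
  by elim: n => //= n ->; rewrite GE.
pose N := G - \1%VF.
have NE v : N v = v *m g - v by rewrite add_lfunE opp_lfunE id_lfunE GE.
have Nq u : u \in fullv -> iter (p ^ k) N u = 0.
  move=> _; rewrite (iter_sub1 _ _ charK) itG row_iter.
  rewrite (_ : \matrix_(i, j) _ = 1%:M) ?mulmx1 ?subrr //.
  by apply/matrixP => i j; rewrite !mxE ug.
pose cf (i : 'I_d) (u : 'rV[K]_d) : K^o := u 0 i.
have cfl i : linear (cf i) by move=> a x y; rewrite /cf !mxE.
pose cF i : {linear 'rV[K]_d -> K^o} := HB.pack (cf i) (GRing.isLinear.Build _ _ _ _ (cf i) (cfl i)).
pose coord (v : 'rV[K]_d) : 'Hom('rV[K]_d, K^o) :=
  if [pick i | v 0 i != 0] is Some i then linfun (cF i) else 0.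
have coordP v : v != 0 -> coord v v != 0.
  move=> v0; rewrite /coord; case: pickP => [i vi|H]; first by rewrite lfunE.
  case/eqP: v0; apply/rowP => i; rewrite mxE; apply/eqP; exact: (negbFE (H i)).
have [s [X [bX all_s sumX NX]]] := jordan_exists coordP (stablef N) Nq.
have szX : size X = d.
  have /eqP <- : \dim <<X>> == size X := basis_free bX.
  by rewrite (span_basis bX) dimvf; exact: mul1n.
exists s; split => //; split; first by rewrite sumX.
exists (\matrix_(i < d) X`_i); split.
  rewrite -row_free_unit -kermx_eq0; apply/eqP/row_matrixP => i.
  have sz : size X == d by rewrite szX.
  have fX : free (Tuple sz) := basis_free bX.
  rewrite row0; apply/rowP => j; rewrite [RHS]mxE.
  have H := elimT (@freeP _ _ _ (Tuple sz)) fX (fun j => row i (kermx (\matrix_(i < d) X`_i)) 0 j).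
  apply: H.
  rewrite -[RHS](_ : row i (kermx (\matrix_(i < d) X`_i)) *m (\matrix_(i < d) X`_i) = 0).
    rewrite mulmx_sum_row; apply: eq_bigr => l _; by rewrite rowK.
  by rewrite -row_mul mulmx_ker row0.
apply/row_matrixP => i; rewrite !row_mul rowK.
have := NX i; rewrite szX NE => /(_ (ltn_ord i)) /eqP; rewrite subr_eq => /eqP ->.
rewrite mulmx_sum_row; under eq_bigr do rewrite rowK !mxE scalerDl.
rewrite big_split /= addrC; congr (_ + _); last first.
  rewrite (bigD1 i) //= eqxx scale1r big1 ?addr0 // => j ji.
  by rewrite -val_eqE eq_sym /= in ji; rewrite (negbTE ji) scale0r.
case: (ltnP i.+1 d) => id.
  rewrite (bigD1 (Ordinal id)) //= eqxx /= big1 ?addr0 => [|j ji].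
    by case: ifP => _; rewrite ?scale0r ?scale1r.
  by rewrite -val_eqE /= in ji; rewrite (negbTE ji) scale0r.
rewrite big1 => [|j _]; last first.
  by rewrite (_ : (j : nat) == i.+1 = false) ?scale0r //; have := ltn_ord j; lia.
by case: ifP => // _; rewrite nth_default // szX.
Qed.

End Classes.

(** * Tensor products *)

Section GreenProduct.
Variables (K : fieldType).
Notation Fn I := {ffun I -> K^o}.

Lemma VmodE x (i j : 'I_x) :
  kmatrix (Vmod K x) i j = ((i : nat) == j)%:R + ((j : nat) == i.+1)%:R.
Proof.
rewrite /kmatrix mxE; congr (_ + (_ : bool)%:R).
by case: eqP => // _; rewrite inE neq_ltn (ltn_ord j).
Qed.

(** Extension by 0 beyond x. With it, N on V_x is the shift f(n) -> f(n+1) without a boundary case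
    at the last index. *)
Definition at_ord x (f : Fn 'I_x) n : K := oapp f 0 (insub n).

Lemma at_ordE x (f : Fn 'I_x) (i : 'I_x) : at_ord f i = f i.
Proof. by rewrite /at_ord valK. Qed.

Lemma at_ord_big x (f : Fn 'I_x) n : (x <= n)%N -> at_ord f n = 0.
Proof. by move=> xn; rewrite /at_ord insubN // -leqNgt. Qed.

Lemma kN_Vmod x (f : Fn 'I_x) n : (n < x)%N ->
  at_ord (kN (kmatrix (Vmod K x)) f) n = at_ord f n.+1.
Proof.
move=> nx; rewrite -[n]/(val (Ordinal nx)) at_ordE kNE !ffunE kopE.
under eq_bigr do rewrite VmodE mulrDl.
rewrite big_split /= (bigD1 (Ordinal nx)) //= eqxx mul1r big1 => [|j ji]; last first.
  by rewrite -val_eqE eq_sym /= in ji; rewrite (negbTE ji) mul0r.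
rewrite addr0 addrAC subrr add0r; case: (ltnP n.+1 x) => nx'.
  rewrite (bigD1 (Ordinal nx')) //= eqxx mul1r big1 => [|j ji].
    by rewrite addr0 -at_ordE.
  by rewrite -val_eqE /= in ji; rewrite (negbTE ji) mul0r.
rewrite at_ord_big // big1 // => j _; rewrite (_ : _ == _ = false) ?mul0r //.
by have := ltn_ord j; clear -nx'; lia.
Qed.

Lemma iter_kN_Vmod x (f : Fn 'I_x) l n :
  at_ord (iter l (kN (kmatrix (Vmod K x))) f) n = if (n < x)%N then at_ord f (n + l) else 0.
Proof.
elim: l n => [|l IH] n /=.
  by rewrite addn0; case: ltnP => // xn; rewrite at_ord_big.
case: ltnP => nx; last by rewrite at_ord_big.
rewrite kN_Vmod // IH addSnnS; case: ltnP => // xn.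
by rewrite at_ord_big // (leq_trans xn) // -addSnnS leq_addr.
Qed.

(** [free_on] is used here with x in the role of q: V_x is a single Jordan block of size x, and
    [rk_free] then yields its ranks x - l. *)
Lemma free_Vmod x : (0 < x)%N -> free_on x (kN (kmatrix (Vmod K x))) fullv.
Proof.
move=> x0; split; first exact: stablef.
  move=> f _; apply/ffunP => i; rewrite -at_ordE iter_kN_Vmod ltn_ord ffunE.
  by rewrite at_ord_big // leq_addl.
apply/subvP => f; rewrite memv_cap memv_ker => /andP[_ /eqP Nf].
have x1 : (x.-1 < x)%N by rewrite prednK.
(* An element of the kernel is concentrated at index 0; its value is placed at the last index, from
   where x - 1 shifts bring it back. *)
apply/itl_imgP; exists [ffun i => if i == Ordinal x1 then at_ord f 0 else 0]; first exact: memvf.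
apply/ffunP => i; rewrite -[RHS]at_ordE iter_kN_Vmod ltn_ord.
case: i => -[|n] /= nx.
  by rewrite add0n -[x.-1]/(val (Ordinal x1)) at_ordE ffunE eqxx -[LHS]at_ordE.
rewrite at_ord_big; last by clear -x0; lia.
rewrite -at_ordE /= -kN_Vmod; last by apply: ltnW.
by rewrite Nf /at_ord; case: insub => //= j; rewrite ffunE.
Qed.

Lemma rk_Vmod x l : rk (kN (kmatrix (Vmod K x))) fullv l = (x - l)%N.
Proof.
case: (posnP x) => [->|x0].
  apply/eqP; rewrite sub0n -leqn0; apply: leq_trans (dimvS (subvf _)) _.
  by rewrite dim_Fn card_ord.
have fV := free_Vmod x0.
have r1 : rk (kN (kmatrix (Vmod K x))) fullv x.-1 = 1%N.
  have := rk_free x0 fV (leq0n x); rewrite rk0 dim_Fn card_ord subn0.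
  by clear -x0; nia.
case: (leqP l x) => lx; first by rewrite (rk_free x0 fV lx) r1 muln1.
apply/eqP; have -> : (x - l = 0)%N by apply/eqP; rewrite subn_eq0 ltnW.
rewrite -leqn0 (leq_trans (dimvS (itl_anti _ (ltnW lx)))) //; first exact: stablef.
by have := rk_free x0 fV (leqnn x); rewrite /rk subnn mul0n => ->.
Qed.

Lemma kcl_Vmod q x : kcl q (kmatrix (Vmod K x)) = V q x.
Proof.
by apply/ffunP => i; rewrite !ffunE !rk_Vmod; case: eqP; lia.
Qed.

Lemma kuniP q (I : finType) (A : I -> I -> K) :
  (forall f, iter q (kop A) f = f) -> kuni q A.
Proof.
move=> H x y; have := H [ffun z => (z == y)%:R]; rewrite -kop_kpow.
move/ffunP/(_ x); rewrite kopE ffunE -[X in _ = X]/(kid K x y) => <-; rewrite -[LHS]kid_sumr.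
by apply: eq_bigr => z _; rewrite ffunE.
Qed.

Lemma kuni_Vmod p k x : p \in [pchar K] -> (x <= p ^ k)%N -> kuni (p ^ k) (kmatrix (Vmod K x)).
Proof.
move=> cK xq; apply: kuniP => f; apply/eqP; rewrite -subr_eq0 -(iter_sub1 _ k cK).
apply/eqP/ffunP => i; rewrite -at_ordE iter_kN_Vmod ltn_ord ffunE at_ord_big //.
by apply: leq_trans xq _; apply: leq_addl.
Qed.

Lemma jordan_split x s (i j : 'I_x + 'I_(sumn s)) :
  kmatrix (jordan_mx K (x + sumn s) (x :: s)) (unsplit i) (unsplit j) =
  ksum (kmatrix (Vmod K x)) (kmatrix (jordan_mx K (sumn s) s)) i j.
Proof.
rewrite {1}/kmatrix mxE /= add0n scanl_addn.
case: i => i; case: j => j /=; rewrite ?VmodE /kmatrix ?mxE /=.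
- rewrite (_ : _ \notin _ = true) ?andbT //; rewrite inE negb_or neq_ltn ltn_ord /=.
  by apply/mapP => -[y _ E]; have := ltn_ord j; rewrite E ltnNge leq_addr.
- have ix := ltn_ord i; have -> : (i == x + j :> nat)%N = false by clear -ix; lia.
  rewrite add0r.
  case: eqP => //= E; rewrite inE negb_or; have H := ltn_ord i.
  by rewrite (_ : _ == x = true) //; clear -E H; lia.
- have jx := ltn_ord j.
  have -> : (x + i == j)%N = false by clear -jx; lia.
  have -> : (j == (x + i).+1 :> nat) = false by clear -jx; lia.
  by rewrite addr0.
rewrite -addnS !eqn_add2l inE (mem_map (@addnI x)); congr (_ + (_ : bool)%:R).
by case: eqP => //= E; rewrite E negb_or (_ : _ == x = false) //; clear; lia.
Qed.

Lemma unsplit_bij m n : bijective (@unsplit m n).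
Proof. by exists (@split m n); [exact: unsplitK|exact: splitK]. Qed.

Lemma ktens_ksum (I1 I2 J : finType) (A1 : I1 -> I1 -> K) (A2 : I2 -> I2 -> K)
    (B : J -> J -> K) l :
  rk (kN (ktens (ksum A1 A2) B)) fullv l =
  (rk (kN (ktens A1 B)) fullv l + rk (kN (ktens A2 B)) fullv l)%N.
Proof.
pose phi (x : I1 * J + I2 * J) : (I1 + I2) * J :=
  match x with inl y => (inl y.1, y.2) | inr y => (inr y.1, y.2) end.
have bij : bijective phi.
  exists (fun x => match x.1 with inl y => inl (y, x.2) | inr y => inr (y, x.2) end).
    by move=> [[a b]|[a b]].
  by move=> [[a|a] b].
rewrite -(rk_reindex _ _ bij) -rk_ksum; congr (rk _ _ _); rewrite /kN; congr (_ - _).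
apply: eq_kop => -[[a b]|[a b]] [[c d]|[c d]] //=; by rewrite /ktens /= mul0r.
Qed.

Lemma eq_rk (I : finType) (A B : I -> I -> K) l : A =2 B ->
  rk (kN A) fullv l = rk (kN B) fullv l.
Proof. by move=> E; rewrite /kN (eq_kop E). Qed.

Lemma rk_ktens_jordan (J : finType) (B : J -> J -> K) s l :
  rk (kN (ktens (kmatrix (jordan_mx K (sumn s) s)) B)) fullv l =
  (\sum_(x <- s) rk (kN (ktens (kmatrix (Vmod K x)) B)) fullv l)%N.
Proof.
elim: s => [|x s IH].
  rewrite big_nil; apply/eqP; rewrite -leqn0.
  by rewrite (leq_trans (dimvS (subvf _))) // dim_Fn card_prod card_ord.
rewrite big_cons -IH -ktens_ksum.
pose phi (x : ('I_x + 'I_(sumn s)) * J) := (unsplit x.1, x.2).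
have bij : bijective phi.
  have [psi phiK psiK] := @unsplit_bij x (sumn s).
  by exists (fun x => (psi x.1, x.2)) => -[a b]; rewrite /phi /= ?phiK ?psiK.
rewrite -(rk_reindex _ _ bij); apply: eq_rk => -[a b] [c d].
by rewrite /ktens /= jordan_split.
Qed.

Lemma ktens_iso (I I' J : finType) (A : I -> I -> K) (B : I' -> I' -> K)
    (X : I' -> I -> K) (Y : I -> I' -> K) (C : J -> J -> K) l :
  kmul Y X =2 @kid K I -> kmul X Y =2 @kid K I' -> kmul X A =2 kmul B X ->
  rk (kN (ktens A C)) fullv l = rk (kN (ktens B C)) fullv l.
Proof.
move=> YX XY XA; apply: (rk_iso (X := ktens X (@kid K J)) (Y := ktens Y (@kid K J))).
- by move=> x y; rewrite ktens_mul -ktens_id; apply: eq_ktens => //; apply: kmul1l.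
- by move=> x y; rewrite ktens_mul -ktens_id; apply: eq_ktens => //; apply: kmul1l.
by move=> x y; rewrite !ktens_mul; apply: eq_ktens => // a b; rewrite kmul1l kmul1r.
Qed.

Definition kmx (I : finType) (A : I -> I -> K) : 'M[K]_#|I| :=
  \matrix_(i, j) A (enum_val i) (enum_val j).

Lemma kmxE (I : finType) (A : I -> I -> K) :
  kmatrix (kmx A) =2 fun x y => A (enum_val x) (enum_val y).
Proof. by move=> x y; rewrite /kmatrix mxE. Qed.

Lemma kuni_kmx q (I : finType) (A : I -> I -> K) : kuni q A -> kuni q (kmatrix (kmx A)).
Proof.
move=> uA; apply: eq_kuni (kuni_reindex (@enum_val_bij I) uA) => x y.
by rewrite kmxE.
Qed.

Lemma ktens_kmx (I J : finType) (A : I -> I -> K) (B : J -> J -> K) l :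
  rk (kN (ktens (kmatrix (kmx A)) B)) fullv l = rk (kN (ktens A B)) fullv l.
Proof.
pose phi (x : 'I_#|I| * J) : I * J := (enum_val x.1, x.2).
have bij : bijective phi.
  have [psi phiK psiK] := @enum_val_bij I.
  by exists (fun x => (psi x.1, x.2)) => -[a b]; rewrite /phi /= ?phiK ?psiK.
rewrite -(rk_reindex _ _ bij); apply: eq_rk => -[a b] [c d].
by rewrite /ktens /= kmxE.
Qed.

Lemma kcl_kmx q (I : finType) (A : I -> I -> K) : kcl q (kmatrix (kmx A)) = kcl q A.
Proof.
by rewrite (eq_kcl _ (@kmxE I A)) (kcl_reindex _ _ (@enum_val_bij I)).
Qed.

(** The trivial module on one point: tensoring with it specialises results on tensor products to a
    single module. *)
Definition kunit (x y : unit) : K := 1.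

Lemma kuni_unit q : kuni q kunit.
Proof.
apply: kuniP => f; elim: q => //= n ->; apply/ffunP => -[].
by rewrite kopE (bigD1 tt) //= mul1r big1 ?addr0 // => -[].
Qed.

Lemma rk_ktens1 (I : finType) (A : I -> I -> K) l :
  rk (kN (ktens A kunit)) fullv l = rk (kN A) fullv l.
Proof.
rewrite -(rk_reindex (phi := fun x : I => (x, tt))); last by exists fst => [|[a []]].
by apply: eq_rk => a b; rewrite /ktens mulr1.
Qed.

Lemma rk_sumz (I : Type) (r : seq I) (F : I -> nat) :
  ((\sum_(x <- r) F x)%N)%:Z = \sum_(x <- r) (F x)%:Z.
Proof. exact: (big_morph Posz PoszD). Qed.

Lemma gcl_sum q (I : Type) (r : seq I) (vT : vectType K) (N : 'End(vT)) U
    (wT : I -> vectType K) (M : forall i, 'End(wT i)) (W : forall i, {vspace wT i}) :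
  (forall l, rk N U l = \sum_(x <- r) rk (M x) (W x) l)%N ->
  gcl q N U = \sum_(x <- r) gcl q (M x) (W x).
Proof.
move=> E; apply/ffunP => i; rewrite sum_ffunE !ffunE !E !rk_sumz -sumrMnl -sumrB -big_split /=.
by apply: eq_bigr => x _; rewrite ffunE.
Qed.

(** A Jordan type may be substituted inside a tensor product. With B arbitrary, the factors of a
    product can be reduced to Jordan blocks in turn; with B trivial, the class itself is
    obtained. *)
Lemma decomp_ktens q d (g : 'M[K]_d) s : decomp q g s ->
  forall (J : finType) (B : J -> J -> K),
    kcl q (ktens (kmatrix g) B) = \sum_(x <- s) kcl q (ktens (kmatrix (Vmod K x)) B).
Proof.
move=> [_ [sd [P [uP PgJ]]]] J B; apply: gcl_sum => l.
rewrite -rk_ktens_jordan.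
move: P g uP PgJ; rewrite -{d}sd => P g uP PgJ.
apply: (ktens_iso (X := kmatrix P) (Y := kmatrix (invmx P))).
- move=> x y; have /matrixP/(_ x y) := mulVmx uP; rewrite !mxE /kid => <-.
  by apply: eq_bigr.
- move=> x y; have /matrixP/(_ x y) := mulmxV uP; rewrite !mxE /kid => <-.
  by apply: eq_bigr.
by move=> x y; move/matrixP/(_ x y): PgJ; rewrite !mxE.
Qed.

Lemma kcl_ktens1 q (I : finType) (A : I -> I -> K) : kcl q (ktens A kunit) = kcl q A.
Proof. by apply: eq_gcl => l; apply: rk_ktens1. Qed.

Lemma decomp_kcl q d (g : 'M[K]_d) s : decomp q g s ->
  kcl q (kmatrix g) = \sum_(x <- s) V q x.
Proof.
move=> D; rewrite -kcl_ktens1 (decomp_ktens D).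
by apply: eq_bigr => x _; rewrite kcl_ktens1 kcl_Vmod.
Qed.

Lemma sum_V_count q s :
  \sum_(x <- s) V q x = [ffun i : 'I_q => (count_mem i.+1 s)%:Z].
Proof.
apply/ffunP => i; rewrite sum_ffunE ffunE; elim: s => [|x s IH].
  by rewrite big_nil.
by rewrite big_cons IH /= PoszD ffunE eq_sym.
Qed.

(** Whatever list [epsilon] selects, its multiplicities are second differences of ranks, hence
    independent of the choice. [decomp] asks for conjugacy to the Jordan matrix, so the ranks may be
    computed on columns. *)
Lemma cls_kcl p k d (g : 'M[K]_d) : p \in [pchar K] -> kuni (p ^ k) (kmatrix g) ->
  cls (p ^ k) g = kcl (p ^ k) (kmatrix g).
Proof.
move=> cK ug; have ex := decomp_exists cK ug.
have D := epsilon_spec (inhabits [::]) (decomp (p ^ k) g) ex.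
by rewrite (decomp_kcl D) sum_V_count.
Qed.

Lemma cls_kmx p k (I : finType) (A : I -> I -> K) : p \in [pchar K] ->
  kuni (p ^ k) A -> cls (p ^ k) (kmx A) = kcl (p ^ k) A.
Proof. by move=> cK uA; rewrite (cls_kcl cK (kuni_kmx uA)) kcl_kmx. Qed.

Section Bilinear.
Variable q : nat.
Implicit Types a b c : green q.

Lemma gmul_is_additive a : zmod_morphism (gmul K a).
Proof.
move=> b c; rewrite /gmul -sumrB; apply: eq_bigr => i _; rewrite -sumrB.
by apply: eq_bigr => j _; rewrite !ffunE mulrBr mulrzBr.
Qed.
HB.instance Definition _ a :=
  GRing.isZmodMorphism.Build (green q) (green q) (gmul K a) (gmul_is_additive a).

Definition gmulr b a := gmul K a b.

Lemma gmulr_is_additive b : zmod_morphism (gmulr b).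
Proof.
move=> a c; rewrite /gmulr /gmul -sumrB; apply: eq_bigr => i _; rewrite -sumrB.
by apply: eq_bigr => j _; rewrite !ffunE mulrBl mulrzBr.
Qed.
HB.instance Definition _ b :=
  GRing.isZmodMorphism.Build (green q) (green q) (gmulr b) (gmulr_is_additive b).

Lemma green_basis a : a = \sum_(i < q) V q i.+1 *~ a i.
Proof.
apply/ffunP => j; rewrite sum_ffunE (bigD1 j) //= green_mulz ffunE eqxx intz.
rewrite big1 ?addr0 // => i ij; rewrite green_mulz ffunE eqSS.
by rewrite -val_eqE eq_sym /= in ij; rewrite (negbTE ij) mul0rz.
Qed.

Lemma green_ext_mod (f g : {additive green q -> green q}) :
  (forall x, (0 < x <= q)%N -> eqm (f (V q x)) (g (V q x))) -> forall a, eqm (f a) (g a).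
Proof.
move=> H a; rewrite (green_basis a) !raddf_sum; apply: eqm_sum => i _.
by rewrite !raddfMz; apply: eqmZ; apply: H; rewrite /= ltn_ord.
Qed.

Lemma green_ext (f g : {additive green q -> green q}) :
  (forall x, (0 < x <= q)%N -> f (V q x) = g (V q x)) -> f =1 g.
Proof.
move=> H a; rewrite (green_basis a) !raddf_sum; apply: eq_bigr => i _.
by rewrite !raddfMz H //= ltn_ord.
Qed.

End Bilinear.

Section Modules.
Variables (p k : nat).
Hypothesis cK : p \in [pchar K].
Let q := (p ^ k)%N.

Lemma kcl_tensmx m n (A : 'M[K]_m) (B : 'M[K]_n) :
  kcl q (kmatrix (A *t B)) = kcl q (ktens (kmatrix A) (kmatrix B)).
Proof.
have bij : bijective (@mxtens_unindex m n).
  by exists (@mxtens_index m n); [exact: mxtens_unindexK|exact: mxtens_indexK].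
rewrite -(kcl_reindex _ _ bij); apply: eq_kcl => x y.
by rewrite /kmatrix /tensmx mxE.
Qed.

Lemma kuni_tensmx m n (A : 'M[K]_m) (B : 'M[K]_n) :
  kuni q (kmatrix A) -> kuni q (kmatrix B) -> kuni q (kmatrix (A *t B)).
Proof.
move=> uA uB; have bij : bijective (@mxtens_unindex m n).
  by exists (@mxtens_index m n); [exact: mxtens_unindexK|exact: mxtens_indexK].
apply: eq_kuni (kuni_reindex bij (kuni_tens uA uB)) => x y.
by rewrite /kmatrix /tensmx mxE.
Qed.

Lemma gmul_V x y : (0 < x <= q)%N -> (0 < y <= q)%N ->
  gmul K (V q x) (V q y) = kcl q (ktens (kmatrix (Vmod K x)) (kmatrix (Vmod K y))).
Proof.
case: x y => // x [] // y /= xq yq; rewrite /gmul (bigD1 (Ordinal xq)) //=.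
rewrite [X in _ + X]big1 ?addr0 => [|i ix]; last first.
  rewrite big1 // => j _; rewrite ffunE eqSS.
  by rewrite -val_eqE /= in ix; rewrite (negbTE ix) mul0r mulr0z.
rewrite (bigD1 (Ordinal yq)) //= [X in _ + X]big1 ?addr0 => [|i ix]; last first.
  rewrite !ffunE eqSS [(i.+1 == _)]eqSS.
  by rewrite -val_eqE /= in ix; rewrite (negbTE ix) mulr0 mulr0z.
rewrite !ffunE !eqxx mulr1 mulr1z.
by rewrite (cls_kcl cK) ?kcl_tensmx //; apply: kuni_tensmx; apply: kuni_Vmod.
Qed.

Lemma kcl_ktensC (I J : finType) (A : I -> I -> K) (B : J -> J -> K) :
  kcl q (ktens A B) = kcl q (ktens B A).
Proof.
rewrite -(kcl_reindex _ (phi := fun x : J * I => (x.2, x.1))); last first.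
  by exists (fun x => (x.2, x.1)) => -[].
by apply: eq_kcl => x y; rewrite /ktens mulrC.
Qed.

Lemma kcl_ktensA (I J L : finType) (A : I -> I -> K) (B : J -> J -> K) (C : L -> L -> K) :
  kcl q (ktens A (ktens B C)) = kcl q (ktens (ktens A B) C).
Proof.
rewrite -(kcl_reindex _ (phi := fun x : I * J * L => (x.1.1, (x.1.2, x.2)))); last first.
  by exists (fun x => (x.1, x.2.1, x.2.2)) => [[[]]|[? []]].
by apply: eq_kcl => x y; rewrite /ktens /= mulrA.
Qed.

Lemma kcl_ktens_kmx (I J : finType) (A : I -> I -> K) (B : J -> J -> K) :
  kcl q (ktens (kmatrix (kmx A)) B) = kcl q (ktens A B).
Proof. by apply: eq_gcl => l; apply: ktens_kmx. Qed.

(** [gmul] is prescribed on basis elements only; both factors are broken into Jordan blocks, over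
    which the class of the tensor product is additive in each argument. *)
Lemma gmul_kcl (I J : finType) (A : I -> I -> K) (B : J -> J -> K) :
  kuni q A -> kuni q B -> gmul K (kcl q A) (kcl q B) = kcl q (ktens A B).
Proof.
move=> uA uB.
have [s Ds] := decomp_exists cK (kuni_kmx uA).
have [t Dt] := decomp_exists cK (kuni_kmx uB).
rewrite -(kcl_kmx _ A) -(kcl_kmx _ B) (decomp_kcl Ds) (decomp_kcl Dt).
rewrite -kcl_ktens_kmx (decomp_ktens Ds).
rewrite -[LHS]/(gmulr (\sum_(y <- t) V q y) _) raddf_sum.
have [/allP sq _] := Ds; have [/allP tq _] := Dt.
apply: eq_big_seq => x /sq xq.
rewrite -[LHS]/(gmul K (V q x) (\sum_(y <- t) V q y)) raddf_sum.
rewrite kcl_ktensC -kcl_ktens_kmx (decomp_ktens Dt).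
apply: eq_big_seq => y /tq yq.
by rewrite -[LHS]/(gmul K (V q x) (V q y)) gmul_V // kcl_ktensC.
Qed.

Implicit Types a b c : green q.

Lemma V_kcl x : (0 < x <= q)%N ->
  exists2 A : 'I_x -> 'I_x -> K, kuni q A & V q x = kcl q A.
Proof.
move=> /andP[_ xq]; exists (kmatrix (Vmod K x)); first exact: kuni_Vmod.
by rewrite kcl_Vmod.
Qed.

Lemma gmulC a b : gmul K a b = gmul K b a.
Proof.
rewrite -[RHS]/(gmulr a b); move: b; apply: green_ext => y yq.
rewrite /= /gmulr -[LHS]/(gmulr (V q y) a); move: a; apply: green_ext => x xq.
rewrite /= /gmulr; have [A uA ->] := V_kcl xq; have [B uB ->] := V_kcl yq.
by rewrite !gmul_kcl // kcl_ktensC.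
Qed.

Lemma gmulA a b c : gmul K a (gmul K b c) = gmul K (gmul K a b) c.
Proof.
move: c; apply: (@green_ext _ (gmul K a \o gmul K b) (gmul K (gmul K a b))) => z zq /=.
move: b; apply: (@green_ext _ (gmul K a \o gmulr (V q z)) (gmulr (V q z) \o gmul K a)) => y yq /=.
rewrite /gmulr; move: a.
apply: (@green_ext _ (gmulr (gmul K (V q y) (V q z))) (gmulr (V q z) \o gmulr (V q y))) => x xq /=.
rewrite /gmulr; have [A uA ->] := V_kcl xq; have [B uB ->] := V_kcl yq.
have [C uC ->] := V_kcl zq.
by rewrite !gmul_kcl ?kcl_ktensA //; apply: kuni_tens.
Qed.

Lemma kcl_unit : kcl q kunit = V q 1.
Proof.
rewrite -kcl_Vmod -[RHS](kcl_reindex _ (phi := fun _ : unit => ord0)); last first.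
  by exists (fun _ => tt); [case|move=> x; rewrite [RHS]ord1].
by apply: eq_kcl => x y; rewrite VmodE eqxx addr0.
Qed.

Lemma gmul1r a : gmul K a (V q 1) = a.
Proof.
rewrite -[LHS]/(gmulr (V q 1) a); move: a.
apply: (@green_ext _ (gmulr (V q 1)) idfun) => x xq; rewrite /= /gmulr.
have [A uA ->] := V_kcl xq; rewrite -kcl_unit gmul_kcl ?kcl_ktens1 //.
exact: kuni_unit.
Qed.

End Modules.
End GreenProduct.

(** * Permutation modules *)

Section PermutationModules.
Variable K : fieldType.
Notation Fn I := {ffun I -> K^o}.

Definition kperm (X : finType) (s : X -> X) (x y : X) : K := (y == s x)%:R.

Lemma kop_perm (X : finType) (s : X -> X) f x : kop (kperm s) f x = f (s x).
Proof.
rewrite kopE (bigD1 (s x)) //= /kperm eqxx mul1r big1 ?addr0 // => y ys.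
by rewrite (negbTE ys) mul0r.
Qed.

Lemma iter_kop_perm (X : finType) (s : X -> X) n f x :
  iter n (kop (kperm s)) f x = f (iter n s x).
Proof. by elim: n x => //= n IH x; rewrite kop_perm IH -iterSr. Qed.

Lemma kuni_perm q (X : finType) (s : X -> X) :
  (forall x, iter q s x = x) -> kuni q (kperm s).
Proof. by move=> sq; apply: kuniP => f; apply/ffunP => x; rewrite iter_kop_perm sq. Qed.

Lemma kop_ktensE (I J I' J' : finType) (A : I -> J -> K) (B : I' -> J' -> K) f x y :
  kop (ktens A B) f (x, y) = \sum_a \sum_b A x a * B y b * f (a, b).
Proof.
by rewrite kopE pair_bigA; apply: eq_bigr => -[].
Qed.

Section Free.
Variables (p k : nat) (X Y : finType) (s : X -> X) (h : Y -> Y -> K).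
Hypothesis cK : p \in [pchar K].
Let q := (p ^ k.+1)%N.
Hypothesis sq : forall x, iter q s x = x.

(** s^(p^k) generates the subgroup Z of order p. Orbit lengths divide p^(k+1), so a point moved by Z
    has an orbit of length exactly q ([perm_order]). *)
Definition zfix x := iter (p ^ k) s x == x.

Let p_pr : prime p := pcharf_prime cK.
Let q0 : (0 < q)%N. Proof. by rewrite expn_gt0 prime_gt0. Qed.

Lemma iter_id_inj : injective s.
Proof.
move=> x y E; rewrite -(sq x) -(sq y) -(prednK q0) !iterSr.
by rewrite E.
Qed.

Lemma zfixS x : zfix (s x) = zfix x.
Proof. by rewrite /zfix -iterSr iterS (inj_eq iter_id_inj). Qed.

Lemma perm_order x : ~~ zfix x -> fingraph.order s x = q.
Proof.
move=> nz.
have oq : (fingraph.order s x %| q)%N.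
  apply/eqP; have H : (q %% fingraph.order s x < fingraph.order s x)%N by rewrite ltn_mod fingraph.order_gt0.
  rewrite -(findex_iter H) -[RHS](findex0 s x); congr findex.
  have E m : iter (m * fingraph.order s x) s x = x.
    by elim: m => // m IH; rewrite mulSn addnC iterD (iter_order iter_id_inj) IH.
  by rewrite -[RHS](sq x) [in RHS](divn_eq q (fingraph.order s x)) addnC iterD E.
have [j jk oE] := dvdn_pfactor _ _ p_pr oq.
move: jk; rewrite leq_eqVlt ltnS oE => /orP[/eqP -> //|jk].
case/negP: nz; apply/eqP; rewrite -(subnKC jk) expnD -oE mulnC.
elim: (p ^ (k - j))%N => // m IH.
by rewrite mulSn addnC iterD (iter_order iter_id_inj) IH.
Qed.

Lemma root_count x : ~~ zfix x ->
  \sum_(a < q) ((froot s (iter a s x) == iter a s x)%:R : K) = 1.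
Proof.
move=> nz; have cs := fconnect_sym iter_id_inj.
have rE a : froot s (iter a s x) = froot s x.
  by apply/eqP; rewrite (root_connect cs) cs fconnect_iter.
have cr : fconnect s x (froot s x) by apply: connect_root.
have lt : (findex s x (froot s x) < q)%N by rewrite -(perm_order nz) findex_max.
rewrite (bigD1 (Ordinal lt)) //= rE iter_findex // eqxx big1 ?addr0 // => a ne.
rewrite rE; case: eqP => // E; case/eqP: ne; apply: val_inj => /=.
by rewrite E findex_iter // (perm_order nz).
Qed.

Let G := kop (ktens (kperm s) h).

Lemma kop_permtens f x y : G f (x, y) = \sum_y' h y y' * f (s x, y').
Proof.
rewrite kop_ktensE.
rewrite (bigD1 (s x)) //= [X in _ + X]big1 => [|a ax].
  by rewrite addr0; apply: eq_bigr => b _; rewrite /kperm eqxx mul1r.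
by rewrite big1 // => b _; rewrite /kperm (negbTE ax) !mul0r.
Qed.

Definition cut (e : X -> bool) (f : Fn (X * Y)%type) : Fn (X * Y)%type :=
  [ffun x => (e x.1)%:R * f x].

Lemma iter_cut e f a : iter a G (cut e f) = cut (fun x => e (iter a s x)) (iter a G f).
Proof.
elim: a e => // a IH e; rewrite !iterS IH; apply/ffunP => -[x y].
rewrite kop_permtens ffunE [in RHS]kop_permtens mulr_sumr /=.
by apply: eq_bigr => y' _; rewrite ffunE /= -iterSr mulrCA.
Qed.

(** Higman's criterion, with [th] the restriction of f to one point per orbit of s. For an invariant
    f, the norm of this restriction is f times the sum of the translates of the indicator function
    of these points, which is 1 on free orbits ([root_count]). *)
Lemma free_perm (F : {vspace Fn (X * Y)%type}) : kuni q h ->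
  (forall f : Fn (X * Y)%type, reflect (forall x y, zfix x -> f (x, y) = 0) (f \in F)) ->
  free_on q (kN (ktens (kperm s) h)) F.
Proof.
move=> uh FP; apply: (@higman _ _ _ _ k.+1 cK F (cut (fun x => froot s x == x))).
- move=> f /FP Ff; apply/FP => x y zx; rewrite kop_permtens big1 // => y' _.
  by rewrite Ff ?mulr0 // zfixS.
- by move=> f _; rewrite (kuni_iter _ (kuni_tens (kuni_perm sq) uh)).
- by move=> f /FP Ff; apply/FP => x y zx; rewrite ffunE Ff // mulr0.
move=> f /FP Ff Gf; have itG a : iter a G f = f by elim: a => //= a ->.
under eq_bigr do rewrite -/G iter_cut itG.
apply/ffunP => -[x y]; rewrite sum_ffunE.
under eq_bigr do rewrite ffunE.
rewrite -mulr_suml /=; case: (boolP (zfix x)) => zx; first by rewrite Ff ?mulr0.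
by rewrite root_count // mul1r.
Qed.

End Free.

Definition fix_card (X : finType) (s : X -> X) n := #|[pred x | iter n s x == x]|.

Definition fix_diff p (X : finType) (s : X -> X) a : rat :=
  (fix_card s (p ^ a))%:R - (if a is b.+1 then fix_card s (p ^ b) else 0)%:R.

(* The ranks of a permutation module are determined by fixed point counts: the
   orbits of length [p^a] number [fix_diff p s a / p^a]. *)
Lemma rk_perm p k (X : finType) (s : X -> X) l : p \in [pchar K] ->
  (forall x, iter (p ^ k) s x = x) ->
  (rk (kN (kperm s)) fullv l)%:R =
  \sum_(a < k.+1) (p ^ a - l)%N%:R / (p ^ a)%:R * fix_diff p s a :> rat.
Proof.
move=> cK; have p0 : (0 < p)%N := prime_gt0 (pcharf_prime cK).
elim: k X s => [|k IH] X s sq.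
  rewrite big_ord1 /fix_diff /= expn0 subr0 divr1.
  have -> : fix_card s 1 = #|X|.
    by apply: eq_card => x; rewrite !inE; apply/eqP; exact: (sq x).
  have N0 f : kN (kperm s) f = 0.
    by apply/ffunP => x; rewrite kNE !ffunE kop_perm -[s x]/(iter (p ^ 0) s x) sq subrr.
  case: l => [|l]; first by rewrite rk0 dim_Fn mul1r.
  rewrite subSS sub0n mul0r (_ : rk _ _ _ = 0%N) //; apply/eqP; rewrite dimv_eq0 -subv0.
  by apply/subvP => _ /itl_imgP[f _ ->]; rewrite iterS N0 mem0v.
(* The points fixed by Z carry an action of period p^k, to which the induction applies; on the
   others all orbits have length p^(k+1). *)
pose P x := zfix p k s x.
have PS x : P (s x) = P x by apply: (zfixS cK sq).
pose X0 := {x | P x}; pose X1 := {x | ~~ P x}.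
have H0 (x : X0) : P (s (val x)) by rewrite PS (valP x).
have H1 (x : X1) : ~~ P (s (val x)) by rewrite PS (valP x).
pose s0 (x : X0) : X0 := exist (fun x => is_true (P x)) (s (val x)) (H0 x).
pose s1 (x : X1) : X1 := exist (fun x => is_true (~~ P x)) (s (val x)) (H1 x).
have vs0 n x : val (iter n s0 x) = iter n s (val x) by elim: n => //= n ->.
have vs1 n x : val (iter n s1 x) = iter n s (val x) by elim: n => //= n ->.
pose phi (x : X0 + X1) : X := match x with inl y => val y | inr y => val y end.
have bij : bijective phi.
  pose psi (x : X) : X0 + X1 :=
    match boolP (P x) with
    | AltTrue h => inl (exist (fun x => is_true (P x)) x h) | AltFalse h => inr (exist (fun x => is_true (~~ P x)) x h) end.
  exists psi => [[x|x]|x]; rewrite /psi.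
  - case: {-}_ / boolP => h; first by congr inl; apply: val_inj.
    by have := valP x; rewrite -[P _]/(P (val x)) (negbTE h).
  - case: {-}_ / boolP => h; last by congr inr; apply: val_inj.
    by have := valP x; rewrite h.
  by case: {-}_ / boolP.
have sq0 x : iter (p ^ k) s0 x = x by apply: val_inj; rewrite vs0; apply/eqP/(valP x).
have sq1 x : iter (p ^ k.+1) s1 x = x by apply: val_inj; rewrite vs1 sq.
have -> : rk (kN (kperm s)) fullv l =
          (rk (kN (kperm s0)) fullv l + rk (kN (kperm s1)) fullv l)%N.
  rewrite -(rk_reindex _ _ bij) -rk_ksum; apply: eq_rk => -[x|x] [y|y] //=.
  - by rewrite /kperm; case: eqP => // E; have := valP y; rewrite /= E PS (valP x).
  - by rewrite /kperm; case: eqP => // E; have := valP y; rewrite /= E PS (negbTE (valP x)).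
have fx0 a : (a <= k)%N -> fix_card s0 (p ^ a) = fix_card s (p ^ a).
  move=> ak; rewrite /fix_card -(card_imset _ val_inj); apply: eq_card => x.
  apply/imsetP/idP => [[y]|]; rewrite !inE.
    by move=> /eqP E ->; rewrite -vs0 E.
  move=> /eqP E; have Px : P x.
    rewrite /P /zfix -(subnKC ak) expnD mulnC.
    by elim: (p ^ (k - a))%N => // m IHm; rewrite mulSn iterD (eqP IHm) E.
  by exists (exist (fun x => is_true (P x)) x Px) => //; rewrite inE; apply/eqP/val_inj; rewrite vs0.
rewrite natrD IH // [RHS]big_ord_recr /=; congr (_ + _).
  apply: eq_bigr => a _; congr (_ * _); rewrite /fix_diff.
  case: (a : nat) (ltn_ord a) => [|b] bk; first by rewrite fx0.
  by rewrite !fx0 //; clear -bk; lia.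
have cX0 : #|{: X0}| = fix_card s (p ^ k) by rewrite card_sig.
have cX : #|X| = fix_card s (p ^ k.+1).
  by apply: eq_card => x; rewrite !inE sq eqxx.
have cX1 : (fix_card s (p ^ k) + #|{: X1}|)%N = fix_card s (p ^ k.+1).
  by rewrite -cX -cX0 -card_sum; apply: bij_eq_card bij.
have fF : free_on (p ^ k.+1) (kN (ktens (kperm s1) (@kunit K))) fullv.
  apply: (free_perm cK sq1); first by apply: kuni_unit.
  move=> f; rewrite memvf; constructor => x y.
  rewrite /zfix -val_eqE vs1; by have := valP x; rewrite /P /zfix => /negbTE ->.
have q0 : (0 < p ^ k.+1)%N by rewrite expn_gt0 p0.
rewrite -rk_ktens1 /fix_diff -cX1 natrD addrAC subrr add0r.
have dF := rk_free q0 fF (leq0n _).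
rewrite subn0 rk0 dim_Fn card_prod card_unit muln1 in dF.
rewrite dF; set r := rk _ _ (p ^ k.+1).-1; rewrite natrM mulrA mulfVK; last first.
  by rewrite pnatr_eq0 -lt0n.
rewrite -natrM; congr (_%:R); case: (leqP l (p ^ k.+1)) => lq.
  by rewrite (rk_free q0 fF lq).
have -> : (p ^ k.+1 - l = 0)%N by apply/eqP; rewrite subn_eq0 ltnW.
apply/eqP; rewrite mul0n -leqn0 (leq_trans (dimvS (itl_anti _ (ltnW lq)))) //.
  exact: stablef.
by have := rk_free q0 fF (leqnn _); rewrite /rk subnn mul0n => ->.
Qed.

End PermutationModules.

(** * The regular module *)

Section RegularModule.
Variable K : fieldType.
Notation Fn I := {ffun I -> K^o}.

Lemma sum_ord_nat n m (F : nat -> K) :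
  \sum_(l < n) ((l : nat) == m)%:R * F l = if (m < n)%N then F m else 0.
Proof.
case: ltnP => mn; last first.
  by rewrite big1 // => l _; rewrite ltn_eqF ?mul0r // (leq_trans (ltn_ord l)).
rewrite (bigD1 (Ordinal mn)) //= eqxx mul1r big1 ?addr0 // => l lm.
by rewrite -val_eqE /= in lm; rewrite (negbTE lm) mul0r.
Qed.

Lemma bin_coef n i : 'C(n, i)%:R = (('X + 1 : {poly K}) ^+ n)`_i.
Proof.
elim: n i => [|n IH] i; first by rewrite expr0 coefC bin0n; case: i.
rewrite exprS mulrDl mul1r coefD coefXM.
by case: i => [|i] /=; rewrite -!IH ?bin0 ?add0r // binS natrD addrC.
Qed.

Section Frobenius.
Variables (p k : nat).
Hypothesis cK : p \in [pchar K].
Let q := (p ^ k)%N.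

(** In characteristic p, (X + 1)^(a+q) = (X + 1)^a (X^q + 1), and multiplication by X^q does not
    reach the coefficients below q. *)
Lemma bin_period a i : (i < q)%N -> 'C(a + q, i)%:R = 'C(a, i)%:R :> K.
Proof.
move=> iq; rewrite !bin_coef exprD.
have -> : ('X + 1 : {poly K}) ^+ q = 'X^q + 1.
  have cP : p \in [pchar {poly K}] by rewrite pchar_poly.
  rewrite /q; elim: k => [|m IH]; first by rewrite !expr1.
  rewrite expnSr !exprM IH -!(pFrobenius_autE cP).
  by rewrite pFrobenius_autD_comm ?pFrobenius_aut1 //; apply: commr1.
by rewrite mulrDr mulr1 coefD coefMXn iq add0r.
Qed.

(* Newton's expansion: [f] in Jordan coordinates is sent to the function
   [a |-> sum_i f_i 'C(a, i)], of period [q] in characteristic [p]. *)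
Definition qK n m (a : 'I_n) (i : 'I_m) : K := 'C(a, i)%:R.

Lemma bin_mod w a i : w = q -> (i < w)%N -> 'C(a %% w, i)%:R = 'C(a, i)%:R :> K.
Proof.
move=> -> iq; rewrite [in RHS](divn_eq a q) addnC.
elim: (a %/ q)%N => [|m IH]; first by rewrite addn0.
by rewrite mulSn addnCA addnC bin_period.
Qed.

(** Pascal's rule: in Jordan coordinates the generator adds C(a, i-1) to C(a, i), giving C(a+1, i).
    The wrap-around at a = q - 1 is harmless by periodicity. *)
Lemma qK_shift : kmul (@qK q q) (kmatrix (Vmod K q)) =2 kmul (kperm K (@ordS q)) (@qK q q).
Proof.
move=> a i; rewrite /kmul.
under eq_bigr do rewrite VmodE mulrDr.
rewrite big_split /=.
have -> : \sum_(j < q) qK a j * ((j : nat) == i)%:R = 'C(a, i)%:R.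
  under eq_bigr do rewrite mulrC /qK.
  by rewrite (sum_ord_nat q i (fun j => 'C(a, j)%:R)) ltn_ord.
have -> : \sum_(j < q) qK a j * ((i : nat) == j.+1)%:R = (if (i : nat) is j.+1 then 'C(a, j) else 0)%:R.
  case: i => -[|i] /= iq; first by rewrite big1 // => j _; rewrite mulr0.
  under eq_bigr => j _ do rewrite eqSS eq_sym mulrC /qK.
  by rewrite (sum_ord_nat q i (fun j => 'C(a, j)%:R)) ltnW.
rewrite [RHS](bigD1 (ordS a)) //= [X in _ = _ + X]big1 ?addr0; last first.
  by move=> j ja; rewrite /kperm (negbTE ja) mul0r.
rewrite /kperm eqxx mul1r /qK /= bin_mod // -natrD; congr _%:R.
by case: i => -[|i] iq; rewrite ?bin0 ?addn0 // binS.
Qed.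

End Frobenius.

Lemma qK_inv q : exists2 Y : 'I_q -> 'I_q -> K,
  kmul Y (@qK q q) =2 @kid K _ & kmul (@qK q q) Y =2 @kid K _.
Proof.
pose Q : 'M[K]_q := \matrix_(a, i) qK a i.
have uQ : Q \in unitmx.
  have tQ : is_trig_mx Q by apply/is_trig_mxP => i j ij; rewrite mxE /qK bin_small.
  rewrite unitmxE (det_trig tQ) big1 ?unitr1 // => i _; by rewrite mxE /qK binn.
exists (fun i j => invmx Q i j) => x y.
  have /matrixP/(_ x y) := mulVmx uQ; rewrite !mxE /kid => <-.
  by apply: eq_bigr => z _; rewrite mxE.
have /matrixP/(_ x y) := mulmxV uQ; rewrite !mxE /kid => <-.
by apply: eq_bigr => z _; rewrite mxE.
Qed.

(** N moves values to smaller indices, so the functions supported below r form a submodule V_r,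
    included by [incK], and reading the indices from r on, by [rstK], is the quotient map to
    V_(q-r). *)
Definition incK n m (i : 'I_n) (j : 'I_m) : K := ((i : nat) == j)%:R.
Definition rstK (r n m : nat) (v : 'I_m) (b : 'I_n) : K := ((b : nat) == r + v)%N%:R.

Lemma incK_V q r : (r <= q)%N ->
  kmul (kmatrix (Vmod K q)) (@incK q r) =2 kmul (@incK q r) (kmatrix (Vmod K r)).
Proof.
move=> rq i j; rewrite /kmul.
under eq_bigr do rewrite VmodE mulrC /incK.
rewrite (sum_ord_nat q j (fun l => ((i : nat) == l)%:R + (l == i.+1)%:R)).
rewrite (leq_trans (ltn_ord j)) //.
under eq_bigr do rewrite VmodE /incK eq_sym.
rewrite (sum_ord_nat r i (fun l => (l == j)%:R + ((j : nat) == l.+1)%:R)).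
case: ltnP => // ir; have jr := ltn_ord j.
have -> : (i == j :> nat) = false by clear -ir jr; lia.
have -> : (j == i.+1 :> nat) = false by clear -ir jr; lia.
by rewrite addr0.
Qed.

Lemma rstK_V r m q : (r + m)%N = q ->
  kmul (@rstK r q m) (kmatrix (Vmod K q)) =2 kmul (kmatrix (Vmod K m)) (@rstK r q m).
Proof.
move=> E v b; rewrite /kmul.
under eq_bigr do rewrite VmodE /rstK.
rewrite (sum_ord_nat q (r + v) (fun l => (l == b)%:R + ((b : nat) == l.+1)%:R)).
have vm := ltn_ord v; have bq := ltn_ord b.
have -> : (r + v < q)%N by clear -vm E; lia.
case: (ltnP b r) => br.
  rewrite big1; last first.
    by move=> l _; rewrite /rstK (_ : _ == _ = false) ?mulr0 //; clear -br; lia.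
  have -> : (r + v == b)%N = false by clear -br; lia.
  have -> : (b == (r + v).+1 :> nat) = false by clear -br; lia.
  by rewrite addr0.
have H : (b - r < m)%N by clear -bq br E; lia.
rewrite (bigD1 (Ordinal H)) //= VmodE /rstK /= subnKC // eqxx mulr1.
rewrite big1 => [|l lb]; last first.
  rewrite (_ : (b : nat) == _ = false) ?mulr0 //.
  by apply/eqP => E'; case/eqP: lb; apply: val_inj => /=; rewrite E' addKn.
rewrite addr0; congr (_%:R + _%:R); congr nat_of_bool; apply/eqP/eqP; clear -br; lia.
Qed.

Lemma kop_incK (q r : nat) (J : finType) f (b : 'I_q) (y : J) :
  kop (ktens (@incK q r) (@kid K J)) f (b, y) =
  if insub (b : nat) is Some c then f (c, y) else 0.
Proof.
rewrite kop_ktensE; under eq_bigr => a _.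
  under eq_bigr do rewrite -mulrA.
  rewrite -mulr_sumr kid_suml; over.
case: insubP => [c _ E|nb].
  rewrite (bigD1 c) //= /incK E eqxx mul1r big1 ?addr0 // => a ac.
  by rewrite -E (_ : _ == _ = false) ?mul0r //; apply/eqP => /esym/val_inj/eqP; rewrite (negbTE ac).
rewrite big1 // => a _; rewrite /incK (_ : _ == _ = false) ?mul0r //.
by apply/eqP => E; rewrite E ltn_ord in nb.
Qed.

Lemma kop_rstK (r q m : nat) (J : finType) f (v : 'I_m) (b : 'I_q) (y : J) : (b : nat) = (r + v)%N ->
  kop (ktens (@rstK r q m) (@kid K J)) f (v, y) = f (b, y).
Proof.
move=> E; rewrite kop_ktensE; under eq_bigr => a _.
  under eq_bigr do rewrite -mulrA.
  rewrite -mulr_sumr kid_suml; over.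
rewrite (bigD1 b) //= /rstK E eqxx mul1r big1 ?addr0 // => a ac.
by rewrite -E val_eqE (negbTE ac) mul0r.
Qed.

Lemma kop_kmulN (I J : finType) (A : J -> I -> K) (B : I -> I -> K) (C : J -> J -> K) f :
  kmul A B =2 kmul C A -> kop A (kN B f) = kN C (kop A f).
Proof. by move=> E; rewrite !kNE linearB /= -!kop_mul (eq_kop E). Qed.

Lemma kmul_conj (I J : finType) (A : I -> I -> K) (B : J -> J -> K)
    (X : J -> I -> K) (Y : I -> J -> K) :
  kmul Y X =2 @kid K I -> kmul X Y =2 @kid K J -> kmul X A =2 kmul B X ->
  kmul Y B =2 kmul A Y.
Proof.
move=> YX XY XA x y; rewrite -(kmul1r (kmul Y B) x y) -(eq_kmul (fun _ _ => erefl) XY) -kmulA.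
rewrite -[RHS]kmul1l -(eq_kmul YX (fun _ _ => erefl)) -!kmulA.
by apply: eq_kmul => // a b; rewrite !kmulA; apply: eq_kmul => // c d; rewrite XA.
Qed.

Lemma free_iso q (I J : finType) (A : I -> I -> K) (B : J -> J -> K)
    (X : J -> I -> K) (Y : I -> J -> K) :
  kmul Y X =2 @kid K I -> kmul X Y =2 @kid K J -> kmul X A =2 kmul B X ->
  free_on q (kN A) fullv -> free_on q (kN B) fullv.
Proof.
move=> YX XY XA [sF Nq kerN].
have YB := kmul_conj YX XY XA.
have XN f : kop X (kN A f) = kN B (kop X f) by apply: kop_kmulN.
have YN f : kop Y (kN B f) = kN A (kop Y f) by apply: kop_kmulN.
have XK f : kop X (kop Y f) = f by rewrite -kop_mul (eq_kop XY) kop_id.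
have itX n f : kop X (iter n (kN A) f) = iter n (kN B) (kop X f).
  by elim: n => //= n IH; rewrite XN IH.
split; first exact: stablef.
  by move=> f _; rewrite -(XK f) -itX Nq ?memvf // linear0.
apply/subvP => f; rewrite memv_cap memv_ker => /andP[_ /eqP Nf].
have : kop Y f \in (fullv :&: lker (kN A))%VS.
  by rewrite memv_cap memvf memv_ker -YN Nf linear0 eqxx.
move/(subvP kerN)/itl_imgP => [g _ E]; apply/itl_imgP; exists (kop X g) => //.
  exact: memvf.
by rewrite -itX -E XK.
Qed.

Section Stable.
Variables (p k : nat).
Hypothesis cK : p \in [pchar K].
Let q := (p ^ k.+1)%N.
Let p_pr : prime p := pcharf_prime cK.
Let q0 : (0 < q)%N. Proof. by rewrite expn_gt0 prime_gt0. Qed.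

Lemma iter_ordS m n (x : 'I_m) : iter n (@ordS m) x = ((x + n) %% m)%N :> nat.
Proof.
elim: n => [|n IH]; first by rewrite addn0 modn_small.
by rewrite iterS /= IH addnS -[in LHS]addn1 modnDml addn1.
Qed.

Lemma ordS_period x : iter q (@ordS q) x = x.
Proof. by apply: val_inj; rewrite /= iter_ordS modnDr modn_small. Qed.

Lemma ordS_nzfix x : ~~ zfix p k (@ordS q) x.
Proof.
rewrite /zfix -val_eqE /= iter_ordS.
have w0 : (0 < p ^ k)%N by rewrite expn_gt0 prime_gt0.
have wq : (p ^ k < q)%N by rewrite /q expnS ltn_Pmull // prime_gt1.
have xq := ltn_ord x.
case: (ltnP (x + p ^ k) q) => H; first by rewrite modn_small //; clear -w0; lia.
have -> : (x + p ^ k = (x + p ^ k - q) + q)%N by clear -H; lia.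
by rewrite modnDr modn_small; clear -wq xq H; lia.
Qed.

(** In the permutation basis the generator translates Z/q, and translation by p^k fixes no point, so
    [free_perm] applies to the whole space. *)
Lemma free_regular (J : finType) (B : J -> J -> K) : kuni q B ->
  free_on q (kN (ktens (kmatrix (Vmod K q)) B)) fullv.
Proof.
move=> uB; have [Y YQ QY] := qK_inv q.
apply: (@free_iso q _ _ (ktens (kperm K (@ordS q)) B) _ (ktens Y (@kid K J)) (ktens (@qK q q) (@kid K J))).
- by move=> x y; rewrite ktens_mul -ktens_id; apply: eq_ktens => //; apply: kmul1l.
- by move=> x y; rewrite ktens_mul -ktens_id; apply: eq_ktens => //; apply: kmul1l.
- move=> x y; rewrite !ktens_mul; apply: eq_ktens => a b; last by rewrite kmul1l kmul1r.
  exact: (kmul_conj YQ QY (qK_shift cK)).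
apply: (free_perm cK ordS_period uB) => f; rewrite memvf; constructor => x y.
by rewrite (negbTE (ordS_nzfix x)).
Qed.

Local Notation "a =~ b" := (eqm a b) (at level 70).

Lemma gmul_regular (b : green q) : gmul K (V q q) b =~ 0.
Proof.
move: b; apply: (@green_ext_mod q (gmul K (V q q)) \0) => y yq /=.
have [B uB ->] := V_kcl cK yq; rewrite -(kcl_Vmod K) (gmul_kcl cK) //.
  exact/gcl_free/free_regular.
exact: kuni_Vmod.
Qed.

(** By [gmul_regular] the multiples of V_q form an ideal, so the congruence respects products. *)
Lemma eqm_gmul (a b c d : green q) : a =~ b -> c =~ d -> gmul K a c =~ gmul K b d.
Proof.
have H (x y z : green q) : x =~ y -> gmul K z x =~ gmul K z y.
  move=> /eqmP [m E] i iq; apply/eqP; rewrite -subr_eq0.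
  have -> : gmul K z x i - gmul K z y i = (gmul K z x - gmul K z y) i by rewrite !ffunE.
  rewrite -raddfB E raddfMz green_mulz.
  have := gmul_regular z iq; rewrite (@gmulC K p k.+1 cK) => ->.
  by rewrite ffunE mul0rz.
move=> ab cd; apply: eqm_trans (H _ _ a cd) _.
by rewrite !(@gmulC K p k.+1 cK _ d); apply: H.
Qed.

(** The sequence V_i -> V_q -> V_(q-i) stays exact after tensoring with B, and its middle term is
    free. *)
Lemma kcl_omega (J : finType) (B : J -> J -> K) i : kuni q B -> (i <= q)%N ->
  kcl q (ktens (kmatrix (Vmod K i)) B) =~ Omega (kcl q (ktens (kmatrix (Vmod K (q - i))) B)).
Proof.
move=> uB iq; have fF := free_regular uB.
pose f := kop (ktens (@rstK i q (q - i)) (@kid K J)).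
pose e := kop (ktens (@incK q i) (@kid K J)).
have eN u : e (kN (ktens (kmatrix (Vmod K i)) B) u) = kN (ktens (kmatrix (Vmod K q)) B) (e u).
  apply: kop_kmulN => x y; rewrite !ktens_mul; apply: eq_ktens => a b.
    by rewrite incK_V.
  by rewrite kmul1l kmul1r.
have fN u : f (kN (ktens (kmatrix (Vmod K q)) B) u) = kN (ktens (kmatrix (Vmod K (q - i))) B) (f u).
  apply: kop_kmulN => x y; rewrite !ktens_mul; apply: eq_ktens => a b.
    by rewrite rstK_V ?subnKC.
  by rewrite kmul1l kmul1r.
have E1 : (fullv :&: lker f = limg e)%VS.
  apply/vspaceP => u; rewrite memv_cap memvf memv_ker /=; apply/eqP/memv_imgP.
    move=> fu; exists [ffun x : 'I_i * J => u (widen_ord iq x.1, x.2)]; first exact: memvf.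
    apply/ffunP => -[b y]; rewrite kop_incK; case: insubP => [c _ E|].
      by rewrite ffunE /=; congr (u (_, _)); apply: val_inj; rewrite /= E.
    rewrite -leqNgt => ib; have H : (b - i < q - i)%N by have := ltn_ord b; clear -ib; lia.
    rewrite -(@kop_rstK i q (q - i) J u (Ordinal H) b y) /= ?subnKC //.
    by move/ffunP/(_ (Ordinal H, y)): fu; rewrite ffunE.
  move=> [v _ ->]; apply/ffunP => -[w y].
  have H : (i + w < q)%N by have := ltn_ord w; clear; lia.
  rewrite (@kop_rstK i q _ J _ w (Ordinal H) y) // kop_incK ffunE insubN //= -leqNgt.
  exact: leq_addr.
have E2 : limg f = fullv.
  apply/eqP; rewrite eqEsubv subvf; apply/subvP => v _; apply/memv_imgP.
  pose u : Fn ('I_q * J)%type := [ffun x : 'I_q * J => if insub ((x.1 : nat) - i)%N is Some w then v (w, x.2) else (0 : K^o)].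
  exists u; first exact: memvf.
  apply/ffunP => -[w y].
  have H : (i + w < q)%N by have := ltn_ord w; clear; lia.
  by rewrite (@kop_rstK i q _ J _ w (Ordinal H) y) // ffunE /= addKn valK.
have := gcl_omega (M := kN (ktens (kmatrix (Vmod K (q - i))) B)) q0 fF (fun u _ => fN u).
rewrite E1 E2 (_ : gcl q _ (limg e) = kcl q (ktens (kmatrix (Vmod K i)) B)) //.
apply: eq_gcl => l; apply: rk_inj; [exact: stablef | by move=> u _; apply: eN |].
apply/eqP; rewrite -subv0; apply/subvP => u; rewrite memv_cap memv_ker memv0 => /andP[_ /eqP eu].
apply/eqP/ffunP => -[w y]; move/ffunP/(_ (widen_ord iq w, y)): eu.
by rewrite kop_incK /= valK !ffunE.
Qed.

Lemma gmul_Omega (a b : green q) : gmul K (Omega a) b =~ Omega (gmul K a b).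
Proof.
rewrite -[gmul K (Omega a) b]/(gmulr K b (Omega a)); move: b; rewrite /gmulr.
apply: (@green_ext_mod q (gmul K (Omega a)) (@Omega q \o gmul K a)) => y yq /=.
move: a; apply: (@green_ext_mod q (gmulr K (V q y) \o @Omega q) (@Omega q \o gmulr K (V q y))) => x xq /=.
rewrite /gmulr; have -> : Omega (V q x) = V q (q - x).
  case: x xq => // x xq; rewrite /Omega (bigD1 (Ordinal xq)) //= ffunE eqxx mulr1z.
  rewrite big1 ?addr0 // => i ix; rewrite ffunE eqSS.
  by rewrite -val_eqE /= in ix; rewrite (negbTE ix) mulr0z.
have /andP[_ xq'] := xq; have [B uB ->] := V_kcl cK yq.
have u1 : kuni q (kmatrix (Vmod K x)) by apply: kuni_Vmod.
have u2 : kuni q (kmatrix (Vmod K (q - x))) by apply: kuni_Vmod => //; apply: leq_subr.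
rewrite -!(kcl_Vmod K) !(gmul_kcl cK) //.
by have := kcl_omega uB (leq_subr x q); rewrite subKn.
Qed.

End Stable.
End RegularModule.

(** * Symmetric and exterior powers *)

Section Tensors.
Variable K : fieldType.

Definition Ten d e n (A : 'I_d -> 'I_e -> K) (s : n.-tuple 'I_d) (t : n.-tuple 'I_e) : K :=
  \prod_(a < n) A (tnth s a) (tnth t a).

Lemma sum_tuple_prod (J : finType) n (F : 'I_n -> J -> K) :
  \sum_(t : n.-tuple J) \prod_(a < n) F a (tnth t a) = \prod_(a < n) \sum_j F a j.
Proof.
rewrite bigA_distr_bigA (reindex (fun f : {ffun 'I_n -> J} => [tuple f i | i < n])) /=.
  by apply: eq_bigr => f _; apply: eq_bigr => a _; rewrite tnth_mktuple.
exists (fun t => [ffun i => tnth t i]) => [f|t] _.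
  by apply/ffunP => i; rewrite ffunE tnth_mktuple.
by apply: eq_from_tnth => i; rewrite tnth_mktuple ffunE.
Qed.

Lemma Ten_mul d e f n (A : 'I_d -> 'I_e -> K) (B : 'I_e -> 'I_f -> K)
    (s : n.-tuple _) (u : n.-tuple _) :
  \sum_t Ten A s t * Ten B t u = Ten (kmul A B) s u.
Proof.
under eq_bigr do rewrite -big_split /=.
by rewrite (sum_tuple_prod (fun a j => A (tnth s a) j * B j (tnth u a))).
Qed.

Lemma prod_bool n (b : pred 'I_n) : \prod_(a < n) (b a)%:R = [forall a, b a]%:R :> K.
Proof.
case: forallP => [H|]; first by rewrite big1 // => a _; rewrite H.
move/forallP; rewrite negb_forall => /existsP[a /negbTE ba].
by rewrite (bigD1 a) //= ba mul0r.
Qed.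

Lemma Ten_fun d e n (c : 'I_d -> 'I_e) (s : n.-tuple 'I_d) (t : n.-tuple 'I_e) :
  Ten (fun i j => (j == c i)%:R) s t = (t == map_tuple c s)%:R.
Proof.
rewrite /Ten (prod_bool (fun a => tnth t a == c (tnth s a))); congr (nat_of_bool _)%:R.
apply/forallP/eqP => [H|-> a]; last by rewrite tnth_map.
by apply: eq_from_tnth => a; rewrite tnth_map (eqP (H a)).
Qed.

Definition tperm_act (T : Type) n (t : n.-tuple T) (s : 'S_n) : n.-tuple T :=
  [tuple tnth t (s i) | i < n].

Lemma tperm_actK (T : Type) n (s : 'S_n) :
  cancel (fun t : n.-tuple T => tperm_act t s) (fun t => tperm_act t s^-1%g).
Proof. by move=> t; apply: eq_from_tnth => i; rewrite !tnth_mktuple permKV. Qed.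

Lemma tperm_act_perm (T : eqType) n (t : n.-tuple T) (s : 'S_n) : perm_eq (tperm_act t s) t.
Proof. by apply/tuple_permP; exists s. Qed.

Lemma Ten_act d e n (A : 'I_d -> 'I_e -> K) (x : n.-tuple _) (t : n.-tuple _) (s : 'S_n) :
  Ten A (tperm_act x s) (tperm_act t s) = Ten A x t.
Proof.
rewrite /Ten [RHS](reindex_inj (@perm_inj _ s)) /=.
by apply: eq_bigr => a _; rewrite !tnth_mktuple.
Qed.

Section Symmetric.

Definition Sy d e n (A : 'I_d -> 'I_e -> K) (s : n.-tuple 'I_d) (y : seq 'I_e) : K :=
  \sum_(t : n.-tuple 'I_e | perm_eq t y) Ten A s t.

(* [sympow] and [extpow] act on columns, that is on functions of sorted tuples:
   these are the symmetric, resp. alternating, tensors of the dual module, and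
   dualizing does not change the class of a module of a cyclic group. *)
Definition symK d e n (A : 'I_d -> 'I_e -> K) (x : sym_idx d n) (y : sym_idx e n) : K :=
  Sy A (val x) (val y).

Lemma sympow_kmx d (g : 'M[K]_d) n : sympow g n = kmx (symK (n := n) (kmatrix g)).
Proof. by apply/matrixP => i j; rewrite !mxE. Qed.

Definition ord_le d (x y : 'I_d) := (x <= y)%N.

Lemma ord_le_total d : total (@ord_le d). Proof. by move=> x y; apply: leq_total. Qed.
Lemma ord_le_trans d : transitive (@ord_le d). Proof. by move=> y x z; apply: leq_trans. Qed.
Lemma ord_le_anti d : antisymmetric (@ord_le d).
Proof. by move=> x y H; apply/val_inj/anti_leq. Qed.

Definition sort_idx d n (t : n.-tuple 'I_d) : sym_idx d n :=
  exist (fun t : n.-tuple 'I_d => is_true (sorted (@ord_le d) t))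
    (sort_tuple (@ord_le d) t) (sort_sorted (@ord_le_total d) t).

Lemma sort_idx_perm d n (t : n.-tuple 'I_d) : perm_eq (val (sort_idx t)) t.
Proof. by rewrite /= perm_sort. Qed.

Lemma sort_idxE d n (t : n.-tuple 'I_d) (x : sym_idx d n) :
  (sort_idx t == x) = perm_eq t (val x).
Proof.
apply/eqP/idP => [<-|H]; first by rewrite perm_sym sort_idx_perm.
apply/val_inj/val_inj/(sorted_eq (@ord_le_trans d) (@ord_le_anti d)).
- exact: (valP (sort_idx t)).
- exact: (valP x).
by apply: perm_trans H; apply: sort_idx_perm.
Qed.

Lemma sym_idx_inj d n (x y : sym_idx d n) : perm_eq (val x) (val y) -> x = y.
Proof. by rewrite -sort_idxE => /eqP <-; apply/esym/eqP; rewrite sort_idxE. Qed.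

Lemma sum_sym d n (F : n.-tuple 'I_d -> K) :
  \sum_(x : sym_idx d n) \sum_(t : n.-tuple _ | perm_eq t (val x)) F t = \sum_t F t.
Proof.
rewrite [RHS](partition_big (@sort_idx d n) xpredT) //=.
by apply: eq_bigr => x _; apply: eq_bigl => t; rewrite sort_idxE.
Qed.

(** Rearranging both tuples at once leaves [Ten] unchanged. This independence of the order is what
    makes [symK] multiplicative. *)
Lemma Sy_perml d e n (A : 'I_d -> 'I_e -> K) (s s' : n.-tuple 'I_d) y :
  perm_eq s s' -> Sy A s y = Sy A s' y.
Proof.
case/tuple_permP => pi E; have {E} -> : s = tperm_act s' pi by apply: val_inj.
rewrite /Sy (reindex_inj (can_inj (@tperm_actK _ n pi))) /=.
apply: eq_big => [t|t _]; last exact: Ten_act.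
by rewrite (permPl (tperm_act_perm t pi)).
Qed.

Lemma eq_Sy d e n (A B : 'I_d -> 'I_e -> K) (s : n.-tuple 'I_d) y :
  A =2 B -> Sy A s y = Sy B s y.
Proof. by move=> E; apply: eq_bigr => t _; apply: eq_bigr => a _; rewrite E. Qed.

Lemma Sy_mul d e f n (A : 'I_d -> 'I_e -> K) (B : 'I_e -> 'I_f -> K) (s : n.-tuple _) w :
  \sum_(y : sym_idx e n) Sy A s (val y) * Sy B (val y) w = Sy (kmul A B) s w.
Proof.
transitivity (\sum_(t : n.-tuple 'I_e) Ten A s t * Sy B t w).
  rewrite -[RHS]sum_sym; apply: eq_bigr => y _; rewrite {1}/Sy mulr_suml.
  by apply: eq_bigr => t ty; rewrite (Sy_perml B w ty).
under eq_bigr do rewrite mulr_sumr.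
by rewrite exchange_big /=; apply: eq_bigr => u _; apply: Ten_mul.
Qed.

Lemma symK_mul d e f n (A : 'I_d -> 'I_e -> K) (B : 'I_e -> 'I_f -> K) :
  kmul (symK (n := n) A) (symK B) =2 symK (kmul A B).
Proof. by move=> x y; apply: Sy_mul. Qed.

Lemma eq_symK d e n (A B : 'I_d -> 'I_e -> K) : A =2 B -> symK (n := n) A =2 symK B.
Proof. by move=> E x y; apply: eq_Sy. Qed.

Lemma Sy_fun d e n (c : 'I_d -> 'I_e) (s : n.-tuple 'I_d) (y : seq 'I_e) :
  Sy (fun i j => (j == c i)%:R) s y = (perm_eq (map c s) y)%:R.
Proof.
rewrite /Sy; under eq_bigr do rewrite Ten_fun.
case: (boolP (perm_eq _ y)) => H.
  rewrite (bigD1 (map_tuple c s)) //= eqxx big1 ?addr0 // => t /andP[_ /negbTE ->] //.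
by rewrite big1 // => t ty; case: eqP => // E; move: ty; rewrite E (negbTE H).
Qed.

Lemma symK_id d n : symK (n := n) (@kid K 'I_d) =2 @kid K _.
Proof.
move=> x y; rewrite /symK.
rewrite -(@eq_Sy _ _ _ (fun i j => (j == id i)%:R)) ?Sy_fun ?map_id => [|i j].
  by rewrite -sort_idxE /kid; congr (_ == _)%:R; apply: sym_idx_inj; apply: sort_idx_perm.
by rewrite /kid eq_sym.
Qed.

Definition sym_map d n (c : 'I_d -> 'I_d) (x : sym_idx d n) : sym_idx d n :=
  sort_idx (map_tuple c (val x)).

Lemma symK_perm d n (c : 'I_d -> 'I_d) :
  symK (n := n) (kperm K c) =2 kperm K (@sym_map d n c).
Proof. by move=> x y; rewrite /symK Sy_fun /kperm [y == _]eq_sym sort_idxE. Qed.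

Lemma sym_mapE d n (c : 'I_d -> 'I_d) (x : sym_idx d n) :
  perm_eq (val (sym_map c x)) (map c (val x)).
Proof. exact: sort_idx_perm. Qed.

Lemma iter_sym_map d n (c : 'I_d -> 'I_d) (x : sym_idx d n) m :
  perm_eq (val (iter m (@sym_map d n c) x)) (map (iter m c) (val x)).
Proof.
elim: m => [|m IH]; first by rewrite map_id.
rewrite iterS (permPl (sym_mapE c _)).
by rewrite (permPl (perm_map c IH)) -map_comp.
Qed.

Lemma kpow_sym d n (A : 'I_d -> 'I_d -> K) m :
  kpow (symK (n := n) A) m =2 symK (kpow A m).
Proof.
elim: m => [|m IH] x y; first by rewrite symK_id.
by rewrite -symK_mul; apply: eq_kmul.
Qed.

Lemma kuni_sym q d n (A : 'I_d -> 'I_d -> K) : kuni q A -> kuni q (symK (n := n) A).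
Proof. by move=> uA x y; rewrite kpow_sym (eq_symK uA) symK_id. Qed.

Lemma sum_tuple_cons (J : finType) n (F : n.+1.-tuple J -> K) :
  \sum_t F t = \sum_v \sum_(u : n.-tuple J) F (cons_tuple v u).
Proof.
rewrite pair_bigA (reindex (fun vu : J * n.-tuple J => (cons_tuple vu.1 vu.2))) //=.
exists (fun t => (thead t, [tuple of behead t])) => [[v u]|t] _ /=.
  by congr pair; apply: val_inj.
by rewrite [RHS]tuple_eta; apply: val_inj.
Qed.

(** Splitting one argument off, f to (v, z) -> f(v :: z), commutes with the action of A. This is the
    symmetric half of the equivariance of the Koszul differential. *)
Lemma Sy_cons d e n (A : 'I_d -> 'I_e -> K) b (x : n.-tuple 'I_d) y :
  Sy A (cons_tuple b x) y =
  \sum_v \sum_(z : sym_idx e n) A b v * Sy A x (val z) * (perm_eq (v :: val z) y)%:R.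
Proof.
rewrite /Sy big_mkcond sum_tuple_cons; apply: eq_bigr => v _.
rewrite -sum_sym; apply: eq_bigr => z _; rewrite /Sy mulr_sumr mulr_suml.
apply: eq_bigr => t tz /=; rewrite -(permPl (_ : perm_eq (v :: t) (v :: val z))) ?perm_cons //.
case: ifP => _; last by rewrite mulr0.
rewrite mulr1 /Ten big_ord_recl; congr (_ * _).
by apply: eq_bigr => i _; rewrite !tnthS.
Qed.

End Symmetric.

Section Exterior.

Definition Ex d e n (A : 'I_d -> 'I_e -> K) (s : n.-tuple 'I_d) (u : n.-tuple 'I_e) : K :=
  \det (\matrix_(a < n, b < n) A (tnth s a) (tnth u b)).

Definition extK d e n (A : 'I_d -> 'I_e -> K) (x : ext_idx d n) (y : ext_idx e n) : K :=
  Ex A (val x) (val y).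

Lemma extpow_kmx d (g : 'M[K]_d) n : extpow g n = kmx (extK (n := n) (kmatrix g)).
Proof. by apply/matrixP => i j; rewrite !mxE. Qed.

Lemma eq_Ex d e n (A B : 'I_d -> 'I_e -> K) (s : n.-tuple 'I_d) u :
  A =2 B -> Ex A s u = Ex B s u.
Proof. by move=> E; congr (\det _); apply/matrixP => i j; rewrite !mxE E. Qed.

Lemma Ex_sum d e f n (A : 'I_d -> 'I_e -> K) (B : 'I_e -> 'I_f -> K)
    (s : n.-tuple _) (w : n.-tuple _) :
  Ex (kmul A B) s w = \sum_t Ten A s t * Ex B t w.
Proof.
rewrite /Ex /determinant.
under [RHS]eq_bigr do rewrite mulr_sumr.
rewrite exchange_big; apply: eq_bigr => pi _ /=.
transitivity ((-1) ^+ pi * \sum_t \prod_a (A (tnth s a) (tnth t a) * B (tnth t a) (tnth w (pi a)))).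
  congr (_ * _); rewrite (sum_tuple_prod (fun a j => A (tnth s a) j * B j (tnth w (pi a)))).
  by apply: eq_bigr => a _; rewrite mxE.
rewrite mulr_sumr; apply: eq_bigr => t _; rewrite big_split /= mulrCA; congr (_ * (_ * _)).
by apply: eq_bigr => a _; rewrite mxE.
Qed.

Lemma Ex_nuniq d e n (A : 'I_d -> 'I_e -> K) (t : n.-tuple 'I_d) w :
  ~~ uniq t -> Ex A t w = 0.
Proof.
case: n t w => [|n] t w; first by rewrite tuple0.
case/(uniqPn (thead t)) => i [j []]; rewrite size_tuple => ij jn E.
have iH := ltn_trans ij jn.
apply: (determinant_alternate (i1 := Ordinal iH) (i2 := Ordinal jn)).
  by apply/eqP => -[]; lia.
by move=> b; rewrite !mxE !(tnth_nth (thead t)) /= E.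
Qed.

Lemma Ex_act d e n (A : 'I_d -> 'I_e -> K) (t : n.-tuple 'I_d) w (pi : 'S_n) :
  Ex A (tperm_act t pi) w = (-1) ^+ pi * Ex A t w.
Proof.
rewrite /Ex -det_perm -det_mulmx; congr (\det _); rewrite -row_permE.
by apply/matrixP => i j; rewrite !mxE tnth_mktuple.
Qed.

Definition ord_lt d (x y : 'I_d) := (x < y)%N.

Lemma ord_lt_uniq d (s : seq 'I_d) : sorted (@ord_lt d) s -> uniq s.
Proof.
by apply: sorted_uniq => [y x z|x]; [exact: ltn_trans | rewrite /ord_lt ltnn].
Qed.

Lemma ext_uniq d n (x : ext_idx d n) : uniq (val x).
Proof. exact: ord_lt_uniq (valP x). Qed.

Lemma sort_lt d (s : seq 'I_d) : uniq s -> sorted (@ord_lt d) (sort (@ord_le d) s).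
Proof.
move=> us.
have H : sorted leq (map val (sort (@ord_le d) s)).
  by rewrite sorted_map; apply: sort_sorted (@ord_le_total d) s.
suff : sorted ltn (map val (sort (@ord_le d) s)) by rewrite sorted_map.
by rewrite ltn_sorted_uniq_leq H andbT (map_inj_uniq val_inj) sort_uniq.
Qed.

Lemma ext_idx_inj d n (x y : ext_idx d n) : perm_eq (val x) (val y) -> x = y.
Proof.
move=> H; apply/val_inj/val_inj.
apply: (@sorted_eq _ (@ord_lt d)) H; [| |exact: (valP x)|exact: (valP y)].
  by move=> b a c; apply: ltn_trans.
by move=> a b /andP[ab ba]; have := ltn_trans ab ba; rewrite ltnn.
Qed.

Lemma sum_ext d n (F : n.-tuple 'I_d -> K) : (forall t : n.-tuple 'I_d, ~~ uniq t -> F t = 0) ->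
  \sum_t F t = \sum_(y : ext_idx d n) \sum_(pi : 'S_n) F (tperm_act (val y) pi).
Proof.
move=> F0.
transitivity (\sum_(y : ext_idx d n) \sum_(t : n.-tuple 'I_d | perm_eq t (val y)) F t).
  rewrite (exchange_big_dep xpredT) //=; apply: eq_bigr => t _.
  case: (boolP (uniq t)) => [ut|nt]; last by rewrite (F0 t nt) big1.
  pose y : ext_idx d n := exist (fun t : n.-tuple 'I_d => is_true (sorted (@ord_lt d) t))
    (sort_tuple (@ord_le d) t) (sort_lt ut).
  have ty : perm_eq t (val y) by rewrite /= perm_sym perm_sort.
  rewrite (bigD1 y) //= big1 ?addr0 // => z /andP[tz /eqP[]].
  by apply: ext_idx_inj; rewrite -(permPl tz).
apply: eq_bigr => y _.
(* [h'] recovers the permutation from a rearrangement of y, uniquely because y has no repetition; on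
   rearrangements the default 1 is never met. *)
pose h' (t : n.-tuple 'I_d) : 'S_n := odflt 1%g [pick pi | t == tperm_act (val y) pi].
rewrite (reindex_onto (tperm_act (val y)) h') => [|t ty].
  apply: eq_bigl => pi; rewrite tperm_act_perm /= /h'; case: pickP => [s /eqP E /=|/(_ pi)]; last by rewrite eqxx.
  apply/eqP/permP => i; move/(congr1 (fun t => tnth t i)): E; rewrite !tnth_mktuple.
  by move=> /eqP; rewrite eq_sym (inj_eq (tuple_uniqP _ (ext_uniq y))) => /eqP.
rewrite /h'; case: pickP => [s /eqP //|H].
by case/tuple_permP: ty => s E; case/eqP: (H s); apply: val_inj.
Qed.

(** Cauchy-Binet. [Ex_sum] expands over all tuples; those with a repetition contribute 0, and the
    others are rearrangements of sorted tuples, whose signs rebuild the first determinant. *)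
Lemma Ex_mul d e f n (A : 'I_d -> 'I_e -> K) (B : 'I_e -> 'I_f -> K) (s : n.-tuple _) w :
  \sum_(y : ext_idx e n) Ex A s (val y) * Ex B (val y) w = Ex (kmul A B) s w.
Proof.
rewrite Ex_sum sum_ext => [|t nt]; last by rewrite Ex_nuniq ?mulr0.
apply: eq_bigr => y _; rewrite {1}/Ex /determinant mulr_suml; apply: eq_bigr => pi _.
rewrite Ex_act mulrCA mulrA; congr (_ * _ * _).
by apply: eq_bigr => a _; rewrite mxE tnth_mktuple.
Qed.

Lemma extK_mul d e f n (A : 'I_d -> 'I_e -> K) (B : 'I_e -> 'I_f -> K) :
  kmul (extK (n := n) A) (extK B) =2 extK (kmul A B).
Proof. by move=> x y; apply: Ex_mul. Qed.

Lemma eq_extK d e n (A B : 'I_d -> 'I_e -> K) : A =2 B -> extK (n := n) A =2 extK B.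
Proof. by move=> E x y; apply: eq_Ex. Qed.

Lemma extK_id d n : extK (n := n) (@kid K 'I_d) =2 @kid K _.
Proof.
move=> x y; rewrite /extK /kid; case: eqP => [->|ne].
  rewrite /Ex (_ : \matrix_(a, b) _ = 1%:M) ?det1 //; apply/matrixP => a b.
  by rewrite !mxE /kid (inj_eq (tuple_uniqP _ (ext_uniq y))).
case: (boolP [forall a, tnth (val x) a \in val (val y)]) => [/forallP H|].
  have sub : {subset val x <= val y} by move=> _ /tnthP[a ->].
  have [|_ E] := uniq_min_size (ext_uniq x) sub; first by rewrite !size_tuple.
  by case: ne; apply: ext_idx_inj; apply: uniq_perm (ext_uniq x) (ext_uniq y) E.
rewrite negb_forall => /existsP[a na]; rewrite /Ex (expand_det_row _ a) big1 // => b _.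
rewrite mxE /kid; case: eqP => [E|_]; last by rewrite mul0r.
by rewrite E mem_tnth in na.
Qed.

Lemma kpow_ext d n (A : 'I_d -> 'I_d -> K) m :
  kpow (extK (n := n) A) m =2 extK (kpow A m).
Proof.
elim: m => [|m IH] x y; first by rewrite extK_id.
by rewrite -extK_mul; apply: eq_kmul.
Qed.

Lemma kuni_ext q d n (A : 'I_d -> 'I_d -> K) : kuni q A -> kuni q (extK (n := n) A).
Proof. by move=> uA x y; rewrite kpow_ext (eq_extK uA) extK_id. Qed.

Definition tdel (T : Type) n (s : n.+1.-tuple T) (a : 'I_n.+1) : n.-tuple T :=
  [tuple tnth s (lift a i) | i < n].

Lemma Ex_cons d e n (A : 'I_d -> 'I_e -> K) (s : n.+1.-tuple _) v (u : n.-tuple _) :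
  Ex A s (cons_tuple v u) =
  \sum_(a < n.+1) (-1) ^+ a * A (tnth s a) v * Ex A (tdel s a) u.
Proof.
rewrite /Ex (expand_det_col _ ord0); apply: eq_bigr => a _.
rewrite mxE tnth0 /cofactor addn0 mulrCA mulrA; congr (_ * \det _).
by apply/matrixP => i j; rewrite !mxE tnth_mktuple tnthS.
Qed.

End Exterior.
End Tensors.

(** * The Koszul complex *)

Section Koszul.
Variable K : fieldType.
Notation Fn I := {ffun I -> K^o}.
Variables (q r m : nat).
Hypothesis rmq : (r + m)%N = q.

Lemma up_proof (v : 'I_m) : (r + v < q)%N.
Proof. by rewrite -rmq ltn_add2l. Qed.
Definition up v := Ordinal (up_proof v).

Lemma up_inj : injective up.
Proof. by move=> v w [] /addnI /val_inj. Qed.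

Lemma rstK_up v b : @rstK K r q m v b = (b == up v)%:R.
Proof. by []. Qed.

(* The Koszul differential, dual to multiplication by [U] inside [S(P)]: here
   [P] has basis [0..q-1], [U] is spanned by the basis vectors [r..q-1] and [up]
   is its inclusion. *)
Definition dK j i (xs : sym_idx q j * ext_idx m i.+1) (zu : sym_idx q j.+1 * ext_idx m i) : K :=
  \sum_v (perm_eq (val zu.1) (up v :: val xs.1))%:R *
         Ex (@kid K _) (val xs.2) (cons_tuple v (val zu.2)).

(** The wedge product of U with its n-th exterior power commutes with h: the exterior half of the
    equivariance. *)
Lemma Ex_cons_mul n (h : 'I_m -> 'I_m -> K) (s : n.+1.-tuple 'I_m) w (u' : n.-tuple 'I_m) :
  \sum_v \sum_(u : ext_idx m n) Ex (@kid K _) s (cons_tuple v (val u)) * (h v w * Ex h (val u) u') =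
  Ex h s (cons_tuple w u').
Proof.
rewrite Ex_cons.
transitivity (\sum_(a < n.+1) \sum_v \sum_(u : ext_idx m n)
   (-1) ^+ a * (kid K (tnth s a) v * h v w) * (Ex (@kid K _) (tdel s a) (val u) * Ex h (val u) u')).
  rewrite [RHS]exchange_big; apply: eq_bigr => v _ /=; rewrite [RHS]exchange_big; apply: eq_bigr => u _.
  rewrite Ex_cons mulr_suml; apply: eq_bigr => a _ /=.
  by rewrite -!mulrA; congr (_ * (_ * _)); rewrite mulrCA.
apply: eq_bigr => a _.
under eq_bigr => v _ do rewrite -mulr_sumr Ex_mul (eq_Ex _ _ (@kmul1l K _ _ h)).
by rewrite -mulr_suml -mulr_sumr kid_suml.
Qed.

Lemma sum_perm_Sy d e j (A : 'I_d -> 'I_e -> K) (w : j.-tuple 'I_d) y :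
  \sum_(z : sym_idx d j) (perm_eq (val z) w)%:R * Sy A (val z) y = Sy A w y.
Proof.
rewrite (bigD1 (sort_idx w)) //= perm_sort perm_refl mul1r big1 ?addr0.
  by apply: Sy_perml; rewrite /= perm_sort.
move=> z zw; case: (boolP (perm_eq _ _)) => [H|]; rewrite ?mul0r //.
by case/eqP: zw; apply/esym/eqP; rewrite sort_idxE perm_sym.
Qed.

(** [dK] is a composite of three equivariant maps: one argument is split off the symmetric factor
    ([Sy_cons]), restricted to the indices from r on (the hypothesis on g and h), and wedged with
    the exterior factor ([Ex_cons_mul]). *)
Lemma dK_equiv j i (g : 'I_q -> 'I_q -> K) (h : 'I_m -> 'I_m -> K) :
  kmul (@rstK K r q m) g =2 kmul h (@rstK K r q m) ->
  kmul (@dK j i) (ktens (symK g) (extK h)) =2 kmul (ktens (symK g) (extK h)) (@dK j i).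
Proof.
move=> rg [x s] [x' u'].
have gup v b : g (up v) b = \sum_w h v w * (b == up w)%:R.
  rewrite -[RHS]rg /kmul (bigD1 (up v)) //= rstK_up eqxx mul1r big1 ?addr0 // => c cv.
  by rewrite rstK_up (negbTE cv) mul0r.
transitivity (\sum_w \sum_(z : sym_idx q j)
   Sy g (val x) (val z) * (perm_eq (val x') (up w :: val z))%:R * Ex h (val s) (cons_tuple w (val u'))).
  rewrite /kmul -(pair_bigA _ (fun a b => dK (x, s) (a, b) * ktens (symK g) (extK h) (a, b) (x', u'))) /=.
  transitivity (\sum_v Sy g (cons_tuple (up v) (val x)) (val x') *
      \sum_(u : ext_idx m i) Ex (@kid K _) (val s) (cons_tuple v (val u)) * Ex h (val u) (val u')).
    rewrite /dK /ktens /=.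
    under eq_bigr => z _ do under eq_bigr => u _ do rewrite mulr_suml.
    under eq_bigr => z _ do rewrite exchange_big /=.
    rewrite exchange_big /=; apply: eq_bigr => v _.
    rewrite -sum_perm_Sy mulr_suml; apply: eq_bigr => z _.
    rewrite mulr_sumr; apply: eq_bigr => u _ /=.
    by rewrite /symK /extK mulrACA.
  under [LHS]eq_bigr => v _ do rewrite (Sy_cons g (up v) (val x) (val x')) mulr_suml.
  transitivity (\sum_v \sum_w \sum_(z : sym_idx q j) h v w * Sy g (val x) (val z) *
      (perm_eq (val x') (up w :: val z))%:R *
      \sum_(u : ext_idx m i) Ex (@kid K _) (val s) (cons_tuple v (val u)) * Ex h (val u) (val u')).
    apply: eq_bigr => v _.
    set S := \sum_(u : ext_idx m i) _.
    under eq_bigr do rewrite mulr_suml.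
    rewrite exchange_big [RHS]exchange_big /=; apply: eq_bigr => z _.
    under eq_bigr do rewrite gup.
    under eq_bigr do rewrite !mulr_suml.
    rewrite exchange_big /=; apply: eq_bigr => w _.
    rewrite (bigD1 (up w)) //= eqxx mulr1 big1 ?addr0 => [|b bw].
      by rewrite perm_sym.
    by rewrite (negbTE bw) mulr0 !mul0r.
  rewrite exchange_big /=; apply: eq_bigr => w _.
  rewrite exchange_big /=; apply: eq_bigr => z _.
  rewrite -Ex_cons_mul mulr_sumr; apply: eq_bigr => v _.
  rewrite [LHS]mulr_sumr [RHS]mulr_sumr; apply: eq_bigr => u _.
  by rewrite -!mulrA mulrCA; congr (_ * _); rewrite mulrCA; congr (_ * _); rewrite mulrCA.
rewrite /kmul -(pair_bigA _ (fun a b => ktens (symK g) (extK h) (x, s) (a, b) * dK (a, b) (x', u'))) /=.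
rewrite exchange_big; apply: eq_bigr => z _.
rewrite /dK /ktens /symK /extK /=.
under [RHS]eq_bigr do rewrite mulr_sumr.
rewrite [RHS]exchange_big /=; apply: eq_bigr => w _.
rewrite -(eq_Ex _ _ (@kmul1r K _ _ h)) -Ex_mul mulr_sumr; apply: eq_bigr => u _.
by rewrite mulrACA.
Qed.

Lemma Ex_swap n (s : n.+2.-tuple 'I_m) v w (u : n.-tuple 'I_m) :
  Ex (@kid K _) s (cons_tuple v (cons_tuple w u)) = - Ex (@kid K _) s (cons_tuple w (cons_tuple v u)).
Proof.
pose i0 : 'I_n.+2 := ord0; pose i1 : 'I_n.+2 := lift ord0 ord0.
rewrite /Ex; set M := \matrix_(a, b) _; rewrite -[RHS]mulN1r.
have -> : M = col_perm (tperm i0 i1) (\matrix_(a, b) kid K (tnth s a) (tnth (cons_tuple w (cons_tuple v u)) b)).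
  apply/matrixP => a b; rewrite !mxE; congr kid.
  case: tpermP => [->|->|] //.
  case: (unliftP ord0 b) => [b1|] -> //; case: (unliftP ord0 b1) => [b2|] -> //.
  by move=> _ _; rewrite !tnthS.
by rewrite col_permE tpermV det_mulmx det_perm odd_tperm /= mulrC.
Qed.

Lemma Ex_rep n (s : n.+2.-tuple 'I_m) v (u : n.-tuple 'I_m) :
  Ex (@kid K _) s (cons_tuple v (cons_tuple v u)) = 0.
Proof.
rewrite /Ex -det_tr; apply: (determinant_alternate (i1 := ord0) (i2 := lift ord0 ord0)) => // b.
by rewrite !mxE.
Qed.

(** The diagonal has its own hypothesis because antisymmetry says nothing about it in characteristic
    2. *)
Lemma alt_sum d (F : 'I_d -> 'I_d -> K) :
  (forall v w, F v w = - F w v) -> (forall v, F v v = 0) -> \sum_v \sum_w F v w = 0.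
Proof.
move=> FN F0.
have E : \sum_v \sum_w F v w = \sum_(v < d) \sum_(w < d | (v < w)%N) F v w +
                               \sum_(v < d) \sum_(w < d | (w < v)%N) F v w.
  rewrite -big_split; apply: eq_bigr => v _ /=.
  rewrite (bigD1 v) //= F0 add0r (bigID (fun w : 'I_d => v < w)%N) /=; congr (_ + _).
    apply: eq_bigl => w; case: (ltngtP v w) => H; rewrite ?andbF ?andbT //.
    by apply/eqP => E; rewrite E ltnn in H.
  apply: eq_bigl => w; rewrite -leqNgt; case: (ltngtP v w) => H; rewrite ?andbF ?andbT //.
    by apply/eqP => E; rewrite E ltnn in H.
  by rewrite (val_inj H) eqxx.
rewrite E [X in _ + X](exchange_big_dep xpredT) //= -big_split big1 // => v _ /=.
by rewrite -big_split big1 // => w _ /=; rewrite FN addNr.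
Qed.

(** Two arguments v, w are split off symmetrically and wedged antisymmetrically, so the double sum
    cancels. *)
Lemma dK_dK j i f : kop (@dK j i.+1) (kop (@dK j.+1 i) f) = 0.
Proof.
rewrite -kop_mul; apply/ffunP => -[x s]; rewrite ffunE kopE big1 // => -[z u'] _.
rewrite (_ : kmul _ _ _ _ = 0) ?mul0r //.
rewrite /kmul -(pair_bigA _ (fun a b => dK (x, s) (a, b) * dK (a, b) (z, u'))) /=.
transitivity (\sum_v \sum_w (perm_eq (val z) (up w :: up v :: val x))%:R *
    Ex (@kid K _) (val s) (cons_tuple v (cons_tuple w (val u')))); last first.
  apply: alt_sum => [v w|v]; last by rewrite Ex_rep mulr0.
  rewrite Ex_swap mulrN; congr (- (_%:R * _)); congr nat_of_bool.
  have H : perm_eq (up w :: up v :: val x) (up v :: up w :: val x).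
    by rewrite (perm_catCA [:: up w] [:: up v]).
  exact: (permPr H).
have Exx v w : Ex (@kid K _) (val s) (cons_tuple v (cons_tuple w (val u'))) =
    \sum_(u : ext_idx m i.+1) Ex (@kid K _) (val s) (cons_tuple v (val u)) *
                              Ex (@kid K _) (val u) (cons_tuple w (val u')).
  under [RHS]eq_bigr do rewrite Ex_cons mulr_suml.
  rewrite exchange_big Ex_cons; apply: eq_bigr => a _ /=.
  under [RHS]eq_bigr do rewrite -!mulrA.
  by rewrite -!mulr_sumr -mulrA Ex_mul (eq_Ex _ _ (@kmul1l K _ _ (@kid K _))).
rewrite /dK /=.
transitivity (\sum_(y : sym_idx q j.+1) \sum_(u : ext_idx m i.+1) \sum_v \sum_w
    ((perm_eq (val y) (up v :: val x))%:R * (perm_eq (val z) (up w :: val y))%:R) *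
    (Ex (@kid K _) (val s) (cons_tuple v (val u)) * Ex (@kid K _) (val u) (cons_tuple w (val u')))).
  apply: eq_bigr => y _; apply: eq_bigr => u _; rewrite big_distrlr /=.
  by apply: eq_bigr => v _; apply: eq_bigr => w _; rewrite mulrACA.
under [LHS]eq_bigr do rewrite exchange_big /=.
rewrite [LHS]exchange_big /=; apply: eq_bigr => v _.
under [LHS]eq_bigr do rewrite exchange_big /=.
rewrite [LHS]exchange_big /=; apply: eq_bigr => w _.
rewrite Exx; under [LHS]eq_bigr do rewrite -mulr_sumr.
rewrite -mulr_suml; congr (_ * _).
rewrite (bigD1 (sort_idx (cons_tuple (up v) (val x)))) //= perm_sort perm_refl mul1r big1 ?addr0.
  have H : perm_eq (up w :: val (sort_idx (cons_tuple (up v) (val x)))) (up w :: up v :: val x).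
    by rewrite perm_cons perm_sort.
  by congr (nat_of_bool _)%:R; exact: (permPr H).
move=> y yx; case: (boolP (perm_eq (val y) _)) => [H|]; rewrite ?mul0r //.
by case/eqP: yx; apply/esym/eqP; rewrite sort_idxE perm_sym.
Qed.

End Koszul.

(** * Exactness of the Koszul complex in positive exterior degree *)

Section KoszulExact.
Variable K : fieldType.
Notation Fn I := {ffun I -> K^o}.
Variables (q r m : nat).
Hypothesis rmq : (r + m)%N = q.
Let up := up rmq.

Lemma kop_pairE (I J L : finType) (B : L -> I * J -> K) f x :
  kop B f x = \sum_a \sum_b B x (a, b) * f (a, b).
Proof. by rewrite kopE pair_bigA; apply: eq_bigr => -[]. Qed.

(* The value at arbitrary sequences: [x] is taken up to order, and the result is
   [0] when [x] has the wrong size or [s] is not an index. *)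
Definition fev j i (f : Fn (sym_idx q j * ext_idx m i)%type) (x : seq 'I_q) (s : seq 'I_m) : K :=
  \sum_(z : sym_idx q j | perm_eq (val z) x)
    \sum_(u : ext_idx m i | (val u : seq _) == s) f (z, u).

Lemma fev_val j i f (z : sym_idx q j) (u : ext_idx m i) : fev f (val z) (val u) = f (z, u).
Proof.
rewrite /fev (big_pred1 z) => [|z']; last first.
  by apply/idP/eqP => [/sym_idx_inj|->].
by rewrite (big_pred1 u) // => u'; rewrite -!val_eqE.
Qed.

Lemma fev_perm j i (f : Fn (sym_idx q j * ext_idx m i)%type) x x' s :
  perm_eq x x' -> fev f x s = fev f x' s.
Proof. by move=> H; apply: eq_bigl => z; rewrite (permPr H). Qed.

Lemma fev_finfun j i (F : seq 'I_q -> seq 'I_m -> K) x s :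
  (forall x x', perm_eq x x' -> F x s = F x' s) ->
  size x = j -> size s = i -> sorted (@ord_lt m) s ->
  fev [ffun zu : sym_idx q j * ext_idx m i => F (val zu.1) (val zu.2)] x s = F x s.
Proof.
move=> Fp sx ss srt.
have sx' : size x == j by rewrite sx.
have ss' : size s == i by rewrite ss.
pose z := sort_idx (Tuple sx').
pose u : ext_idx m i := exist (fun t : i.-tuple 'I_m => is_true (sorted (@ord_lt m) t)) (Tuple ss') srt.
have px : perm_eq (val z) x by rewrite /= perm_sort.
rewrite -(fev_perm _ _ px) -[s in LHS]/(val (val u) : seq _) fev_val ffunE /=.
exact: Fp.
Qed.

Lemma tdel_sorted n (s : n.+1.-tuple 'I_m) a : sorted (@ord_lt m) s ->
  sorted (@ord_lt m) (tdel s a).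
Proof.
move=> srt; case: n s a srt => [|n] s a srt; first by rewrite [tdel s a]tuple0.
have tr : transitive (@ord_lt m) by move=> y x z; apply: ltn_trans.
apply/(sortedP (thead s)) => l; rewrite size_tuple => ln.
have l' : (l < n.+1)%N by apply: ltnW.
rewrite -[l]/(val (Ordinal l')) -[in X in ord_lt _ X]/(val (Ordinal ln)) /=.
rewrite -(tnth_nth _ (tdel s a) (Ordinal l')) -(tnth_nth _ (tdel s a) (Ordinal ln)).
rewrite !tnth_mktuple !(tnth_nth (thead s)).
apply: (sorted_ltn_nth tr _ srt); rewrite ?inE ?size_tuple ?ltn_ord //=.
by rewrite /bump; case: leqP; case: leqP; lia.
Qed.

Lemma Ex_kid n (s : n.-tuple 'I_m) (u : ext_idx m n) : sorted (@ord_lt m) s ->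
  Ex (@kid K _) s (val u) = (s == val u)%:R.
Proof.
move=> srt; pose z : ext_idx m n := exist (fun t : n.-tuple 'I_m => is_true (sorted (@ord_lt m) t)) s srt.
by have := @extK_id K m n z u; rewrite /extK /= => ->; rewrite /kid -val_eqE.
Qed.

Lemma kop_dK j i f (x : sym_idx q j) (s : ext_idx m i.+1) :
  kop (@dK K q r m rmq j i) f (x, s) =
  \sum_(a < i.+1) (-1) ^+ a * fev f (up (tnth (val s) a) :: val x) (tdel (val s) a).
Proof.
rewrite kop_pairE.
rewrite /dK /=.
transitivity (\sum_(z : sym_idx q j.+1) \sum_(u : ext_idx m i) \sum_(a < i.+1)
   (-1) ^+ a * ((perm_eq (val z) (up (tnth (val s) a) :: val x))%:R *
                (tdel (val s) a == val u)%:R * f (z, u))).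
  apply: eq_bigr => z _; apply: eq_bigr => u _.
  under eq_bigr do rewrite Ex_cons mulr_sumr.
  rewrite exchange_big mulr_suml; apply: eq_bigr => a _ /=.
  rewrite Ex_kid; last exact/tdel_sorted/(valP s).
  rewrite (bigD1 (tnth (val s) a)) //= /kid eqxx mulr1 big1 ?addr0 => [|v va].
    by rewrite mulrCA -!mulrA.
  by rewrite eq_sym (negbTE va) !(mul0r, mulr0).
under [LHS]eq_bigr do rewrite exchange_big /=.
rewrite [LHS]exchange_big /=; apply: eq_bigr => a _.
under [LHS]eq_bigr do rewrite -mulr_sumr.
rewrite -mulr_sumr; congr (_ * _); rewrite /fev [RHS]big_mkcond /=; apply: eq_bigr => z _.
case: ifP => _; last by rewrite big1 // => u _; rewrite !mul0r.
rewrite [RHS]big_mkcond; apply: eq_bigr => u _; rewrite mul1r eq_sym.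
by rewrite -val_eqE /=; case: ifP => _; rewrite ?mul1r ?mul0r.
Qed.

Definition minY (x : seq 'I_q) (s : seq 'I_m) : option 'I_m :=
  [pick k | ((k \in s) || (up k \in x)) &&
            [forall v, ((v \in s) || (up v \in x)) ==> (k <= v)%N]].

Lemma minY_ex (x : seq 'I_q) (s : seq 'I_m) v : (v \in s) || (up v \in x) ->
  exists2 k, minY x s = Some k & ((k \in s) || (up k \in x)) /\
    forall v, (v \in s) || (up v \in x) -> (k <= v)%N.
Proof.
move=> H; rewrite /minY; case: pickP => [k /andP[Hk /forallP Hmin]|no].
  by exists k => //; split=> // w Hw; have := Hmin w; rewrite Hw.
pose P w := (w \in s) || (up w \in x).
case: (arg_minnP (P := P) (fun w : 'I_m => w : nat) H) => k Pk Hmin.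
have /negP[] := negbT (no k); apply/andP; split => //.
by apply/forallP => w; apply/implyP; apply: Hmin.
Qed.

Lemma eq_minY (x x' : seq 'I_q) (s s' : seq 'I_m) :
  (forall v, (v \in s) || (up v \in x) = (v \in s') || (up v \in x')) ->
  minY x s = minY x' s'.
Proof.
move=> H; apply: eq_pick => k /=; rewrite H; congr (_ && _).
by apply: eq_forallb => v; rewrite H.
Qed.

Lemma perm_eq_rem (T : eqType) (a : T) x x' : perm_eq x x' -> perm_eq (rem a x) (rem a x').
Proof.
move=> H; case: (boolP (a \in x)) => ax; last first.
  by rewrite !rem_id // -(perm_mem H).
rewrite -(perm_cons a) -(permPl (perm_to_rem ax)) (permPl H) perm_to_rem //.
by rewrite -(perm_mem H).
Qed.

Section Homotopy.
Variables (j i : nat) (f : Fn (sym_idx q j * ext_idx m i.+1)%type).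

(* Contracting homotopy: the smallest index [k] of [U] occurring in [x] or [s] is
   moved from the symmetric to the exterior factor. *)
Definition homotopy_fun (x : seq 'I_q) (s : seq 'I_m) : K :=
  if minY x s is Some k then
    if k \in s then 0 else fev f (rem (up k) x) (k :: s)
  else 0.

Lemma homotopy_fun_perm x x' s : perm_eq x x' -> homotopy_fun x s = homotopy_fun x' s.
Proof.
move=> H; rewrite /homotopy_fun (@eq_minY x x' s s) => [|v]; last by rewrite (perm_mem H).
case: minY => // k; case: ifP => // _; apply: fev_perm.
exact: perm_eq_rem.
Qed.

Definition homotopy : Fn (sym_idx q j.+1 * ext_idx m i)%type :=
  [ffun zu : sym_idx q j.+1 * ext_idx m i => homotopy_fun (val zu.1) (val zu.2) : K^o].

Lemma mem_tdel n (s : n.+1.-tuple 'I_m) a c : c != a -> tnth s c \in tdel s a.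
Proof.
move=> ca; case: (unliftP a c) => [b ->|E]; last by rewrite E eqxx in ca.
by apply/tnthP; exists b; rewrite tnth_mktuple.
Qed.

Lemma tdel_sub n (s : n.+1.-tuple 'I_m) a : {subset tdel s a <= s}.
Proof. by move=> _ /tnthP[b ->]; rewrite tnth_mktuple mem_tnth. Qed.

Lemma tdel_notin n (s : n.+1.-tuple 'I_m) a : uniq s -> tnth s a \notin tdel s a.
Proof.
move=> us; apply/tnthP => -[b]; rewrite tnth_mktuple => /eqP.
by rewrite (inj_eq (tuple_uniqP _ us)) (negbTE (neq_lift a b)).
Qed.

Lemma tdel_cons0 n k (s : n.-tuple 'I_m) : tdel (cons_tuple k s) ord0 = s.
Proof. by apply: eq_from_tnth => b; rewrite tnth_mktuple tnthS. Qed.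

Lemma tdel_consS n k (s : n.+1.-tuple 'I_m) a :
  tdel (cons_tuple k s) (lift ord0 a) = cons_tuple k (tdel s a).
Proof.
apply: eq_from_tnth => b; rewrite tnth_mktuple.
case: (unliftP ord0 b) => [b'|] ->.
  have -> : lift (lift ord0 a) (lift ord0 b') = lift ord0 (lift a b').
    by apply: val_inj; rewrite /= /bump /=; lia.
  by rewrite !tnthS tnth_mktuple.
by rewrite tnth0 (_ : lift _ _ = ord0) ?tnth0 //; apply: val_inj.
Qed.

Lemma tdel_eta n (s : n.+1.-tuple 'I_m) : s = cons_tuple (tnth s ord0) (tdel s ord0).
Proof.
apply: eq_from_tnth => b; case: (unliftP ord0 b) => [b'|] ->; last by rewrite tnth0.
by rewrite tnthS tnth_mktuple.
Qed.

(** The hypothesis is df = 0 at (x minus k, k :: s), solved for f(x, s). It is asked only where k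
    precedes all of s and occurs in x, so it is void in symmetric degree 0, and follows from df = 0
    in positive degree. *)
Lemma kop_homotopy :
  (forall (x : sym_idx q j) (s : ext_idx m i.+1) k, sorted (@ord_lt m) (k :: val s) ->
    up k \in val x ->
    fev f (val x) (val s) =
    \sum_(a < i.+1) (-1) ^+ a * fev f (up (tnth (val s) a) :: rem (up k) (val x)) (k :: tdel (val s) a)) ->
  kop (@dK K q r m rmq j i) homotopy = f.
Proof.
move=> H; apply/ffunP => -[x s]; rewrite kop_dK.
have us := ext_uniq s.
have Hhom a : fev homotopy (up (tnth (val s) a) :: val x) (tdel (val s) a) =
              homotopy_fun (up (tnth (val s) a) :: val x) (tdel (val s) a).
  rewrite /homotopy fev_finfun ?size_tuple //= ?size_tuple //.
    by move=> y y'; apply: homotopy_fun_perm.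
  exact/tdel_sorted/(valP s).
under eq_bigr do rewrite Hhom.
have [|k Ek [Pk kmin]] := @minY_ex (val x) (val s) (tnth (val s) ord0).
  by rewrite mem_tnth.
(* Moving an index from s to x does not change the set of indices of U occurring in the pair, so all
   terms of the differential share the same minimum k. *)
have EY a : minY (up (tnth (val s) a) :: val x) (tdel (val s) a) = Some k.
  rewrite -Ek; apply: eq_minY => v; rewrite inE (inj_eq (@up_inj _ _ _ rmq)).
  case: (boolP (up v \in val x)) => [_|_]; first by rewrite !orbT.
  rewrite !orbF; apply/orP/idP => [[/tdel_sub|/eqP ->]|/tnthP[c ->]] //.
    exact: mem_tnth.
  by case: (eqVneq c a) => [->|/mem_tdel]; [right | left].
rewrite -fev_val.
have tr : transitive (@ord_lt m) by move=> y a z; apply: ltn_trans.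
(* If k is in s, it is the first entry. For a > 0 it stays in the exterior part, where the homotopy
   is 0, and the term a = 0 gives back f. *)
case: (boolP (k \in val s)) => ks.
  have k0 : tnth (val s) ord0 = k.
    apply: val_inj; apply/eqP; rewrite eqn_leq kmin ?mem_tnth // andbT.
    case/tnthP: ks => c ->; rewrite !(tnth_nth (thead (val s))).
    case: (eqVneq c ord0) => [-> //|c0]; apply/ltnW.
    apply: (sorted_ltn_nth tr _ (valP s)); rewrite ?inE ?size_tuple ?ltn_ord //.
    by rewrite lt0n.
  rewrite big_ord_recl big1 ?addr0 => [|a _]; last first.
    rewrite /homotopy_fun EY ifT ?mulr0 // -k0; apply: mem_tdel.
    exact: neq_lift.
  rewrite mul1r /homotopy_fun EY -{1}k0 (negbTE (tdel_notin _ us)) k0 /= eqxx.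
  by congr fev; rewrite -k0 [in RHS](tdel_eta (val s)).
move: Pk; rewrite (negbTE ks) /= => kx.
rewrite [RHS](H x s k) //; last first.
  have srt : sorted (@ord_lt m) (cons_tuple (tnth (val s) ord0) (tdel (val s) ord0)).
    by rewrite -tdel_eta; apply: (valP s).
  rewrite (tdel_eta (val s)) /=; move: srt => /= ->; rewrite andbT /ord_lt.
  rewrite ltn_neqAle kmin ?mem_tnth // andbT; apply/eqP => /val_inj E.
  by rewrite E mem_tnth in ks.
apply: eq_bigr => a _; congr (_ * _); rewrite /homotopy_fun EY.
rewrite (negbTE (contra (@tdel_sub _ _ _ k) ks)) /= (inj_eq (@up_inj _ _ _ rmq)).
case: eqP => // E; by rewrite -E mem_tnth in ks.
Qed.

End Homotopy.

Lemma dK_exact0 i (f : Fn (sym_idx q 0 * ext_idx m i.+1)%type) :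
  exists g, kop (@dK K q r m rmq 0 i) g = f.
Proof.
exists (homotopy f); apply: kop_homotopy => x s k _.
by rewrite [val x]tuple0.
Qed.

Lemma dK_exactS j i (f : Fn (sym_idx q j.+1 * ext_idx m i.+1)%type) :
  kop (@dK K q r m rmq j i.+1) f = 0 ->
  exists g, kop (@dK K q r m rmq j.+1 i) g = f.
Proof.
move=> df; exists (homotopy f); apply: kop_homotopy => x s k srt kx.
have sr : size (rem (up k) (val x)) == j by rewrite size_rem // size_tuple.
pose x' := sort_idx (Tuple sr).
pose s' : ext_idx m i.+2 :=
  exist (fun t : i.+2.-tuple 'I_m => is_true (sorted (@ord_lt m) t)) (cons_tuple k (val s)) srt.
move/ffunP/(_ (x', s')): df; rewrite kop_dK ffunE big_ord_recl.
have -> : val s' = cons_tuple k (val s) by [].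
rewrite mul1r tdel_cons0 tnth0.
move/eqP; rewrite addr_eq0 => /eqP E.
have px (b : 'I_q) : perm_eq (b :: val x') (b :: rem (up k) (val x)).
  by rewrite perm_cons /= perm_sort.
rewrite (fev_perm _ _ (perm_to_rem kx)) -(fev_perm _ _ (px _)) E -sumrN.
apply: eq_bigr => a _; rewrite tnthS tdel_consS (fev_perm _ _ (px _)).
by rewrite [(-1) ^+ _]exprS mulN1r mulNr opprK.
Qed.

End KoszulExact.

Lemma count_sum_mem (T : finType) (P : pred T) (s : seq T) :
  count P s = (\sum_(b | P b) count_mem b s)%N.
Proof.
elim: s => [|x s IH] /=; first by rewrite big1.
rewrite IH big_split /=; congr (_ + _)%N.
case: (boolP (P x)) => Px; last first.
  by rewrite big1 // => b Pb; case: eqP => // E; rewrite E Pb in Px.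
by rewrite (bigD1 x) //= eqxx big1 ?addn0 // => b /andP[_ /negbTE]; rewrite eq_sym => ->.
Qed.

Lemma count_mem_map_inj (T T' : eqType) (c : T -> T') a s : injective c ->
  count_mem (c a) (map c s) = count_mem a s.
Proof. by move=> ic; rewrite count_map; apply: eq_count => x /=; rewrite (inj_eq ic). Qed.

Lemma eq_kop_at (K : fieldType) (I J : finType) (A B : I -> J -> K) f :
  A =2 B -> kop A f = kop B f.
Proof. by move/eq_kop ->. Qed.

(** * Symmetric powers of the regular module *)

Section Idempotent.
Variables (K : fieldType) (p k n : nat).
Hypothesis cK : p \in [pchar K].
Notation Fn I := {ffun I -> K^o}.
Let q := (p ^ k.+1)%N.
Let w := (p ^ k)%N.
Let p_pr : prime p := pcharf_prime cK.
Let w0 : (0 < w)%N. Proof. by rewrite expn_gt0 prime_gt0. Qed.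
Let q0 : (0 < q)%N. Proof. by rewrite expn_gt0 prime_gt0. Qed.
Let wq : (w <= q)%N. Proof. by rewrite leq_exp2l ?prime_gt1. Qed.
Let wdq : (w %| q)%N. Proof. by rewrite dvdn_exp2l. Qed.

Definition modw (a : 'I_q) : 'I_w := Ordinal (ltn_pmod a w0).

Lemma modw_S a : modw (ordS a) = ordS (modw a).
Proof.
apply: val_inj; rewrite /= modn_dvdm // -[in RHS]addn1 modnDml.
by rewrite addn1.
Qed.

Lemma ordS_inj : injective (@ordS q).
Proof. exact: (iter_id_inj cK (@ordS_period p k)). Qed.

Let sg := @sym_map q n (@ordS q).

Lemma sg_period t : iter q sg t = t.
Proof.
apply: sym_idx_inj; rewrite (permPl (iter_sym_map _ _ _)).
rewrite (eq_map (g := id)) ?map_id // => a; exact: ordS_period.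
Qed.

Definition zf (t : sym_idx q n) := zfix p k sg t.

Lemma zf_count t a : zf t -> count_mem (iter w (@ordS q) a) (val t) = count_mem a (val t).
Proof.
move=> /eqP zt; have := iter_sym_map (@ordS q) t w; rewrite zt.
move/seq.permP => ->; apply: count_mem_map_inj.
by elim: w => // l IH; apply: inj_comp ordS_inj IH.
Qed.

Definition base (c : 'I_q) : 'I_q := Ordinal (leq_trans (ltn_pmod c w0) wq).

Lemma zf_base t c : zf t -> count_mem c (val t) = count_mem (base c) (val t).
Proof.
move=> zt; have E : c = iter (c %/ w * w) (@ordS q) (base c).
  by apply: val_inj; rewrite /= iter_ordS /= addnC -divn_eq modn_small.
rewrite [in LHS]E {E}.
elim: (c %/ w)%N => [|l IH]; first by rewrite mul0n.
by rewrite mulSn iterD zf_count.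
Qed.

Lemma zf_fiber t a b : zf t -> modw a = modw b ->
  count_mem a (val t) = count_mem b (val t).
Proof.
move=> zt /(congr1 val) /= E; rewrite zf_base // [RHS]zf_base //.
by rewrite (_ : base a = base b) //; apply: val_inj.
Qed.

(** The multiplicities of an invariant multiset are constant on the fibres of [modw], so each
    multiplicity of the image is the fibre size times the one upstairs. The cancellation is one of
    natural numbers, so the characteristic does no harm. *)
Lemma zf_uniq t t' : zf t -> zf t' ->
  perm_eq (map modw (val t)) (map modw (val t')) -> t = t'.
Proof.
move=> zt zt' /seq.permP H; apply: sym_idx_inj; apply/allP => a _ /=; apply/eqP.
have cnt (u : sym_idx q n) : zf u -> count_mem (modw a) (map modw (val u)) =
    (#|[pred b | modw b == modw a]| * count_mem a (val u))%N.
  move=> zu; rewrite count_map count_sum_mem.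
  rewrite (eq_bigr (fun=> count_mem a (val u))) ?sum_nat_const // => b /eqP E.
  exact: zf_fiber.
have := H (pred1 (modw a)); rewrite !cnt // => /eqP; rewrite eqn_pmul2l => [/eqP //|].
by apply/card_gt0P; exists a; rewrite inE.
Qed.

Lemma zf_sg t : zf (sg t) = zf t.
Proof. exact: (zfixS cK sg_period). Qed.

(* A multiset on [Z/q] invariant under the subgroup of order [p] is determined by
   its image in [Z/(q/p)]. [Pk] evaluates a function at the invariant multiset
   with the same image as [t], if there is one; its kernel consists of functions
   on free orbits. *)
Definition Pk (t t' : sym_idx q n) : K :=
  (zf t' && perm_eq (map modw (val t')) (map modw (val t)))%:R.

Lemma Pk_zf t t' : zf t -> Pk t t' = (t' == t)%:R.
Proof.
move=> zt; rewrite /Pk; congr (nat_of_bool _)%:R.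
by apply/andP/eqP => [[zt' /zf_uniq -> //]|->].
Qed.

(** The nonzero columns of [Pk] are at invariant multisets, where its rows are those of the
    identity. *)
Lemma Pk_idem : kmul Pk Pk =2 Pk.
Proof.
move=> t t''; rewrite /kmul -[RHS]kid_sumr; apply: eq_bigr => t' _.
case: (boolP (zf t')) => zt'; last by rewrite [Pk t t']/Pk (negbTE zt') !mul0r.
by rewrite (Pk_zf _ zt') /kid eq_sym.
Qed.

Lemma Pk_perm : kmul Pk (kperm K sg) =2 kmul (kperm K sg) Pk.
Proof.
move=> t t''; pose t0 := iter q.-1 sg t''.
have E : t'' = sg t0 by rewrite /t0 -iterS prednK // sg_period.
have isg : injective sg by apply: (iter_id_inj cK sg_period).
transitivity (Pk t t0).
  rewrite -[RHS]kid_sumr; apply: eq_bigr => t' _.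
  by rewrite /kperm {1}E (inj_eq isg) /kid eq_sym.
rewrite /kmul (bigD1 (sg t)) //= /kperm eqxx mul1r big1 ?addr0 => [|y yt].
  rewrite E /Pk zf_sg; congr (nat_of_bool (_ && _))%:R.
  have H u : perm_eq (map modw (val (sg u))) (map (@ordS w) (map modw (val u))).
    rewrite (permPl (perm_map modw (sym_mapE _ _))) -!map_comp.
    by rewrite (eq_map (g := @ordS w \o modw)) // => a /=; rewrite modw_S.
  rewrite (permPl (H t0)) (permPr (H t)).
  have iw : injective (@ordS w).
    move=> a b /(congr1 val) /= H'; apply: val_inj; apply/eqP.
    have := eqn_modDr 1 a b w; rewrite !addn1 => E'.
    by move/eqP: H'; rewrite E' !modn_small.
  by apply/idP/idP => [/(perm_map (@ordS w))|/(perm_map_inj iw)].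
by rewrite (negbTE yt) mul0r.
Qed.

Definition kfun (I J : finType) (c : I -> J) (i : I) (j : J) : K := (j == c i)%:R.

(** For i < w the function a -> C(a, i) has period w in K, so functions supported below w in Jordan
    coordinates are pulled back along [modw]. *)
Lemma qK_inc : kmul (@qK K q q) (@incK K q w) =2 kmul (kfun modw) (@qK K w w).
Proof.
move=> a i; rewrite /kmul.
under eq_bigr => l _ do rewrite mulrC /incK /qK.
rewrite (sum_ord_nat q i (fun l => 'C(a, l)%:R)) (leq_trans (ltn_ord i)) //.
rewrite (bigD1 (modw a)) //= /kfun eqxx mul1r big1 ?addr0 => [|b ba].
  by rewrite /qK /= (bin_mod (p := p) (k := k) cK).
by rewrite (negbTE ba) mul0r.
Qed.

Definition PW (u : sym_idx w n) (t' : sym_idx q n) : K :=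
  (zf t' && perm_eq (map modw (val t')) (val u))%:R.

Lemma Pk_fact : Pk =2 kmul (symK (kfun modw)) PW.
Proof.
move=> t t'; rewrite /kmul (bigD1 (sort_idx (map_tuple modw (val t)))) //=.
rewrite /symK Sy_fun /= perm_sym perm_sort perm_refl mul1r big1 ?addr0 => [|u ut].
  by rewrite /PW (permPr (sort_idx_perm (map_tuple modw (val t)))).
rewrite Sy_fun; case: (boolP (perm_eq _ _)) => [H|]; rewrite ?mul0r //.
by case/eqP: ut; apply/esym/eqP; rewrite sort_idxE.
Qed.

(* On the image of the idempotent, functions are constant on the cosets of the
   subgroup of order [p] in each argument; in Jordan coordinates they are
   supported on the indices below [q/p]. *)
Lemma Pk_jordan (Y : 'I_q -> 'I_q -> K) :
  kmul Y (@qK K q q) =2 @kid K _ ->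
  exists R, kmul (symK Y) Pk =2 kmul (symK (@incK K q w)) R.
Proof.
move=> YQ; have [Yw _ QYw] := qK_inv K w.
exists (kmul (symK Yw) PW) => x t.
rewrite (eq_kmul (fun _ _ => erefl) Pk_fact) !kmulA.
apply: (eq_kmul _ (fun _ _ => erefl)) => a b; rewrite !symK_mul; apply: eq_symK => c d.
rewrite -[kfun modw in LHS]/(kfun modw) -(kmul1r (kmul Y (kfun modw))).
rewrite -(eq_kmul (fun _ _ => erefl) QYw) kmulA.
apply: (eq_kmul _ (fun _ _ => erefl)) => e f; rewrite -kmulA.
rewrite -(eq_kmul (fun _ _ => erefl) qK_inc) kmulA.
by rewrite (eq_kmul YQ (fun _ _ => erefl)) kmul1l.
Qed.

End Idempotent.

(** * The Heller shift along the Koszul complex *)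

Section Resolution.
Variables (K : fieldType) (p k : nat).
Hypothesis cK : p \in [pchar K].
Notation Fn I := {ffun I -> K^o}.
Let q := (p ^ k.+1)%N.
Let w := (p ^ k)%N.
Let p_pr : prime p := pcharf_prime cK.
Let q0 : (0 < q)%N. Proof. by rewrite expn_gt0 prime_gt0. Qed.
Variables (r m : nat).
Hypotheses (wr : (w <= r)%N) (rmq : (r + m)%N = q).
Let rq : (r <= q)%N. Proof. by rewrite -rmq leq_addr. Qed.
Let mq : (m <= q)%N. Proof. by rewrite -rmq leq_addl. Qed.
Local Notation "a =~ b" := (eqm a b) (at level 70).

Definition koszul_mod j i := ktens (symK (n := j) (kmatrix (Vmod K q))) (extK (n := i) (kmatrix (Vmod K m))).
Local Notation G j i := (@koszul_mod j i).
Local Notation D j i := (kop (@dK K q r m rmq j i)).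

Lemma Sy_inc_big e n (x : n.-tuple 'I_q) y a : a \in (x : seq _) -> (e <= a)%N ->
  Sy (@incK K q e) x y = 0.
Proof.
move=> /tnthP[b ->] le; rewrite /Sy big1 // => t _; rewrite /Ten (bigD1 b) //=.
rewrite /incK (_ : _ == _ = false) ?mul0r //; apply/eqP => E.
by have := ltn_ord (tnth t b); rewrite -E ltnNge le.
Qed.

(** The differential evaluates only at multisets containing an index from r on, and there these
    functions vanish. *)
Lemma dK_inc e j i f : (e <= r)%N -> D j i (kop (ktens (symK (@incK K q e)) (@kid K _)) f) = 0.
Proof.
move=> er; rewrite -kop_mul; apply/ffunP => -[x s]; rewrite ffunE kopE big1 // => -[y u] _.
rewrite (_ : kmul _ _ _ _ = 0) ?mul0r // /kmul big1 // => -[z u'] _.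
rewrite /dK /ktens /= mulr_suml big1 // => v _.
case: (boolP (perm_eq _ _)) => [H|_]; last by rewrite !mul0r.
rewrite /symK (@Sy_inc_big e _ (val z) _ (up rmq v)) ?mul0r ?mulr0 //.
  by rewrite (perm_mem H) mem_head.
by rewrite /= (leq_trans er) // leq_addr.
Qed.

Lemma D_equiv j i f : D j i (kN (G j.+1 i) f) = kN (G j i.+1) (D j i f).
Proof. by apply: kop_kmulN; apply: dK_equiv; apply: rstK_V. Qed.

(** This is [gcl_split] for the idempotent [Pk] tensored with the identity. It is applied in the
    permutation basis, where [Pk] lives, and the conclusion is carried back along [phi]. *)
Lemma koszul_step j i :
  gcl q (kN (G j.+1 i)) (lker (D j i)) =~
  kcl q (G j.+1 i) + Omega (gcl q (kN (G j i.+1)) (limg (D j i))).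
Proof.
have [Y YQ QY] := qK_inv K q.
pose n := j.+1.
pose G' := ktens (kperm K (@sym_map q n (@ordS q))) (extK (n := i) (kmatrix (Vmod K m))).
pose phi := ktens (symK (n := n) Y) (@kid K (ext_idx m i)).
pose psi := ktens (symK (n := n) (@qK K q q)) (@kid K (ext_idx m i)).
have phipsi : kmul phi psi =2 @kid K _.
  move=> a b; rewrite ktens_mul -ktens_id; apply: eq_ktens => c d; last exact: kmul1l.
  by rewrite symK_mul (eq_symK YQ) symK_id.
have psiphi : kmul psi phi =2 @kid K _.
  move=> a b; rewrite ktens_mul -ktens_id; apply: eq_ktens => c d; last exact: kmul1l.
  by rewrite symK_mul (eq_symK QY) symK_id.
have YP := kmul_conj YQ QY (qK_shift cK : kmul (@qK K q q) _ =2 _).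
have phiG : kmul phi G' =2 kmul (G n i) phi.
  move=> a b; rewrite !ktens_mul; apply: eq_ktens => c d; last by rewrite kmul1l kmul1r.
  rewrite -(eq_kmul (fun _ _ => erefl) (@symK_perm K q n _)) !symK_mul.
  exact: eq_symK.
have phiN u : kop phi (kN G' u) = kN (G n i) (kop phi u) by apply: kop_kmulN.
have phiK u : kop phi (kop psi u) = u by rewrite -kop_mul (eq_kop phipsi) kop_id.
pose e := kop (ktens (@Pk K p k n cK) (@kid K (ext_idx m i))).
pose f := (D j i \o kop phi)%VF.
have eN u : e (kN G' u) = kN G' (e u).
  apply: kop_kmulN => a b; rewrite !ktens_mul; apply: eq_ktens => c d.
    exact: Pk_perm.
  by rewrite kmul1l kmul1r.
have fN u : f (kN G' u) = kN (G j i.+1) (f u) by rewrite !comp_lfunE phiN D_equiv.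
have ee u : e (e u) = e u.
  rewrite -kop_mul; apply: eq_kop_at => a b; rewrite ktens_mul.
  by apply: eq_ktens => c d; [exact: Pk_idem | exact: kmul1l].
(* Here q/p <= r enters: by [Pk_jordan] the image of e becomes supported on indices below q/p, out
   of reach of the differential. *)
have fe u : f (e u) = 0.
  have [R ER] := @Pk_jordan K p k n cK Y YQ.
  rewrite comp_lfunE.
  suff -> : kop phi (e u) = kop (ktens (symK (@incK K q w)) (@kid K _)) (kop (ktens R (@kid K _)) u).
    exact: dK_inc.
  rewrite -!kop_mul; apply: eq_kop_at => a b.
  by rewrite !ktens_mul; apply: eq_ktens => c d; rewrite ?ER // kmul1l.
(* The kernel of e consists of the functions vanishing at all multisets fixed by Z. *)
have free : free_on q (kN G') (lker e).
  apply: (free_perm cK (@sg_period p k n)) => [|u].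
    by apply: kuni_ext; apply: kuni_Vmod.
  rewrite memv_ker; apply: (iffP eqP) => [eu x y zx|H].
    move/ffunP/(_ (x, y)): eu; rewrite kop_ktensE ffunE => <-.
    under [RHS]eq_bigr => a _.
      under eq_bigr do rewrite -mulrA.
      rewrite -mulr_sumr kid_suml (Pk_zf cK _ zx); over.
    rewrite (bigD1 x) //= eqxx mul1r big1 ?addr0 // => a /negbTE ->.
    by rewrite mul0r.
  apply/ffunP => -[x y]; rewrite kop_ktensE ffunE big1 // => a _.
  rewrite big1 // => b _; rewrite /Pk; case: (boolP (zf _)) => za; last by rewrite !mul0r.
  by rewrite H ?mulr0.
have := gcl_split (M := kN (G j i.+1)) q0 eN fN ee fe free.
have surj : (fullv = kop phi @: fullv)%VS.
  apply/eqP; rewrite eq_sym eqEsubv subvf; apply/subvP => u _; apply/memv_imgP.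
  by exists (kop psi u); [exact: memvf | rewrite phiK].
have inj : lker (kop phi) = 0%VS.
  apply/eqP; rewrite -subv0; apply/subvP => u; rewrite memv_ker memv0 => /eqP E.
  by rewrite -[u]kop_id -(eq_kop psiphi) kop_mul E linear0.
have -> : limg f = limg (D j i) by rewrite limg_comp -surj.
have -> : gcl q (kN G') fullv = kcl q (G n i) by apply: (kcl_iso _ psiphi phipsi).
suff -> : gcl q (kN G') (lker f) = gcl q (kN (G n i)) (lker (D j i)) by [].
have -> : lker (D j i) = (kop phi @: lker f)%VS.
  apply/vspaceP => u; apply/idP/memv_imgP => [|[v]]; rewrite !memv_ker.
    move=> Du; exists (kop psi u); last by rewrite phiK.
    by rewrite memv_ker comp_lfunE phiK.
  by rewrite comp_lfunE => fv ->.
apply: eq_gcl => l; apply/esym/rk_inj.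
- have := stable_ker (M := kN (G j i.+1)) (f := f) (stablef (kN G')) (fun u _ => fN u).
  by rewrite capfv.
- by move=> u _; rewrite phiN.
by rewrite inj capv0.
Qed.

(** No differential leaves symmetric degree 0, so everything is a cycle there; with this convention
    exactness takes the uniform shape of [limg_D]. *)
Definition cycles j i : {vspace Fn (sym_idx q j * ext_idx m i)%type} :=
  match j with 0 => fullv | j'.+1 => lker (kop (@dK K q r m rmq j' i)) end.

Lemma limg_D j i : limg (D j i) = cycles j i.+1.
Proof.
apply/vspaceP => u; case: j u => [|j] u /=.
  by rewrite memvf; apply/memv_imgP; have [g <-] := dK_exact0 rmq u; exists g; rewrite ?memvf.
rewrite memv_ker; apply/memv_imgP/eqP => [[g _ ->]|/(dK_exactS (rmq := rmq)) [g <-]].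
  exact: dK_dK.
by exists g; rewrite ?memvf.
Qed.

(** Each [koszul_step] trades one symmetric degree for one exterior degree and one Omega, until
    symmetric degree 0. *)
Lemma cycles_class j i :
  gcl q (kN (G j i)) (cycles j i) =~
  \sum_(l < j.+1) iter l (@Omega q) (kcl q (G (j - l) (i + l))).
Proof.
elim: j i => [|j IH] i; first by rewrite big_ord1 /= addn0.
apply: eqm_trans (koszul_step j i) _; rewrite limg_D big_ord_recl /= subn0 addn0.
apply: eqmD => //; apply: eqm_trans (eqm_Omega (IH i.+1)) _.
rewrite raddf_sum; apply: eqm_sum => l _ /=.
by rewrite addSnnS.
Qed.

End Resolution.

Lemma Sy_map (K : fieldType) d d' e n (A : 'I_d' -> 'I_e -> K) (c : 'I_d -> 'I_d')
    (s : n.-tuple 'I_d) y :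
  Sy A (map_tuple c s) y = Sy (fun i j => A (c i) j) s y.
Proof. by apply: eq_bigr => t _; apply: eq_bigr => a _; rewrite tnth_map. Qed.

(** * The symmetric powers of V_r modulo projectives *)

Section SymmetricResolution.
Variables (K : fieldType) (p k : nat).
Hypothesis cK : p \in [pchar K].
Notation Fn I := {ffun I -> K^o}.
Let q := (p ^ k.+1)%N.
Let w := (p ^ k)%N.
Let p_pr : prime p := pcharf_prime cK.
Let w0 : (0 < w)%N. Proof. by rewrite expn_gt0 prime_gt0. Qed.
Variables (r m : nat).
Hypotheses (wr : (w <= r)%N) (rmq : (r + m)%N = q).
Let rq : (r <= q)%N. Proof. by rewrite -rmq leq_addr. Qed.
Let mq : (m <= q)%N. Proof. by rewrite -rmq leq_addl. Qed.
Local Notation "a =~ b" := (eqm a b) (at level 70).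
Local Notation G j i := (@koszul_mod K p k m j i).

Definition ext_nil d : ext_idx d 0 :=
  exist (fun t : 0.-tuple 'I_d => is_true (sorted (@ord_lt d) t)) [tuple] isT.

Lemma ext_nilE d (u : ext_idx d 0) : u = ext_nil d.
Proof. by apply/val_inj; rewrite [val u]tuple0. Qed.

Lemma sum_ext_nil d (F : ext_idx d 0 -> K) : \sum_u F u = F (ext_nil d).
Proof.
rewrite (bigD1 (ext_nil d)) //= big1 ?addr0 // => u.
by rewrite (ext_nilE u) eqxx.
Qed.

(** In exterior degree 0, df = 0 says that f vanishes on every multiset containing an index from r
    on. What remains are the functions on multisets of indices below r, a copy of the symmetric
    power of V_r. *)
Lemma cycles_end n :
  gcl q (kN (G n.+1 0)) (cycles K rmq n.+1 0) = kcl q (symK (n := n.+1) (kmatrix (Vmod K r))).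
Proof.
pose E2 (zu : sym_idx q n.+1 * ext_idx m 0) (y : sym_idx r n.+1) : K := symK (@incK K q r) zu.1 y.
pose J : 'I_r -> 'I_q -> K := fun i j => (j == widen_ord rq i)%:R.
have JE : kmul J (@incK K q r) =2 @kid K _.
  move=> a b; rewrite /kmul (bigD1 (widen_ord rq a)) //= /J eqxx mul1r big1 ?addr0 //.
  by move=> c /negbTE ->; rewrite mul0r.
have E2e f : kop E2 f = kop (ktens (symK (@incK K q r)) (@kid K _)) [ffun yu => f yu.1].
  apply/ffunP => -[z u]; rewrite kop_ktensE kopE; apply: eq_bigr => y _.
  by rewrite sum_ext_nil (ext_nilE u) /kid eqxx mulr1 ffunE.
have EN : kmul E2 (symK (kmatrix (Vmod K r))) =2 kmul (G n.+1 0) E2.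
  move=> [z u] y; rewrite /kmul -(pair_bigA _ (fun a b => G n.+1 0 (z, u) (a, b) * E2 (a, b) y)) /=.
  rewrite -[LHS]/(kmul (symK (@incK K q r)) (symK (kmatrix (Vmod K r))) z y).
  rewrite symK_mul -(eq_symK (incK_V K rq)) -symK_mul /kmul; apply: eq_bigr => z' _.
  rewrite sum_ext_nil /koszul_mod /ktens /= /extK /Ex det_mx00 mulr1 //.
have -> : cycles K rmq n.+1 0 = (kop E2 @: fullv)%VS.
  apply/vspaceP => f; rewrite memv_ker; apply/eqP/memv_imgP => [Df|[g _ ->]]; last first.
    by rewrite E2e; apply: dK_inc.
  pose f' : Fn (sym_idx r n.+1) := [ffun y => f (sort_idx (map_tuple (widen_ord rq) (val y)), ext_nil m)].
  exists f'; first exact: memvf.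
  apply/ffunP => -[z u]; rewrite (ext_nilE u) kopE.
  case: (boolP [exists v, up rmq v \in val (val z)]) => [/existsP[v vz]|nv].
    rewrite [RHS]big1 => [|y _]; last first.
      by rewrite /E2 /symK (@Sy_inc_big K p k r n.+1 (val z) _ (up rmq v)) ?mul0r //= leq_addr.
    have sr : size (rem (up rmq v) (val (val z))) == n by rewrite size_rem // size_tuple.
    pose x := sort_idx (Tuple sr).
    pose s : ext_idx m 1 :=
      exist (fun t : 1.-tuple 'I_m => is_true (sorted (@ord_lt m) t)) (cons_tuple v [tuple]) isT.
    move/ffunP/(_ (x, s)): Df; rewrite kop_dK ffunE big_ord1 mul1r.
    rewrite -[val s]/(cons_tuple v [tuple]) tnth0 tdel_cons0 => Ef.
    rewrite -fev_val -[RHS]Ef; apply: fev_perm.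
    rewrite (permPl (perm_to_rem vz)) perm_cons perm_sym /= perm_sort //.
  have r0 : (0 < r)%N by apply: leq_trans wr.
  pose y0 := sort_idx (map_tuple (fun b : 'I_q => insubd (Ordinal r0) (val b)) (val z)).
  have zy : perm_eq (map (widen_ord rq) (val y0)) (val z).
    rewrite (permPl (perm_map _ (sort_idx_perm _))) -map_comp map_id_in // => b bz.
    apply: val_inj; rewrite /= val_insubd; case: ltnP => // rb.
    case/negP: nv; apply/existsP.
    have H : (b - r < m)%N by have := ltn_ord b; rewrite -{2}rmq; clear -rb; lia.
    exists (Ordinal H); rewrite (_ : up rmq _ = b) //; apply: val_inj => /=.
    by rewrite subnKC.
  have Sz y : E2 (z, ext_nil m) y = @kid K _ y0 y.
    rewrite /E2 /symK /= -(@Sy_perml _ _ _ _ _ (map_tuple (widen_ord rq) (val y0))) //.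
    by rewrite Sy_map -symK_id; apply: eq_Sy.
  under eq_bigr do rewrite Sz.
  rewrite kid_suml ffunE; congr (f (_, _)); apply/esym/eqP; rewrite sort_idxE.
  exact: zy.
apply: eq_gcl => l; apply: rk_inj; first exact: stablef.
  by move=> f _; apply: kop_kmulN.
apply/eqP; rewrite -subv0; apply/subvP => f; rewrite memv_cap memv_ker memv0 => /andP[_ /eqP Ef].
rewrite -[f]kop_id -(eq_kop (@symK_id K r n.+1)) -(eq_kop (eq_symK JE)).
rewrite -(eq_kop (symK_mul _ _)) kop_mul; apply/eqP.
rewrite (_ : kop (symK (incK K (m:=r))) f = 0) ?linear0 //.
apply/ffunP => z; move/ffunP/(_ (z, ext_nil m)): Ef; rewrite !ffunE => <-.
by rewrite !kopE.
Qed.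

Lemma kcl_point (I : finType) (A : I -> I -> K) : #|I| = 1%N ->
  (forall x y, A x y = 1) -> kcl q A = V q 1.
Proof.
move=> /eqP/fintype1P[x0 Hx] A1; rewrite -(@kcl_unit K p k.+1).
rewrite -(@kcl_reindex K q unit I (fun=> x0)); last first.
  by exists (fun=> tt) => [[]|x] //; rewrite (Hx x).
by apply: eq_kcl => x y; rewrite A1.
Qed.

Lemma kcl_sym0 d (A : 'I_d -> 'I_d -> K) : kcl q (symK (n := 0) A) = V q 1.
Proof.
have E (x y : sym_idx d 0) : x = y by apply: val_inj; rewrite [val x]tuple0 [val y]tuple0.
apply: kcl_point => [|x y].
  apply/eqP/fintype1P; exists (sort_idx [tuple]) => x; exact: E.
rewrite (E y x) /symK /Sy (bigD1 (val x)) //= big1 ?addr0.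
  by rewrite /Ten big_ord0.
by move=> t /andP[_]; rewrite [t]tuple0 [val x]tuple0 => /eqP[].
Qed.

Lemma kcl_ext0 d (A : 'I_d -> 'I_d -> K) : kcl q (extK (n := 0) A) = V q 1.
Proof.
apply: kcl_point => [|x y]; last by rewrite /extK /Ex det_mx00.
by apply/eqP/fintype1P; exists (ext_nil d) => x; rewrite (ext_nilE x).
Qed.

Theorem sym_resolution n :
  kcl q (symK (n := n) (kmatrix (Vmod K r))) =~
  \sum_(l < n.+1) iter l (@Omega q)
    (gmul K (kcl q (symK (n := n - l) (kmatrix (Vmod K q)))) (kcl q (extK (n := l) (kmatrix (Vmod K m))))).
Proof.
have uq : kuni q (kmatrix (Vmod K q)) by apply: kuni_Vmod.
have um : kuni q (kmatrix (Vmod K m)) by apply: kuni_Vmod.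
case: n => [|n].
  rewrite big_ord1 /= !kcl_sym0 kcl_ext0 (gmul1r cK).
  exact: eqm_refl.
rewrite -cycles_end; apply: eqm_trans (cycles_class cK wr rmq n.+1 0) _.
apply: eqm_sum => l _; rewrite add0n (gmul_kcl cK (kuni_sym uq) (kuni_ext um)).
exact: eqm_refl.
Qed.

End SymmetricResolution.

(** * Adams operations of the regular module *)

Section FixedMultisets.
Variables (d h : nat) (c : 'I_d -> 'I_d).
Hypotheses (h0 : (0 < h)%N) (ch : forall x, iter h c x = x)
  (uc : forall x, uniq (traject c x h)).

Definition inv_sym n (t : sym_idx d n) := perm_eq (map c (val t)) (val t).
Definition num_inv n := #|[pred t : sym_idx d n | inv_sym t]|.
Definition mult_sum x n := (\sum_(t : sym_idx d n | inv_sym t) count_mem x (val t))%N.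

Lemma c_inj : injective c.
Proof. by move=> x y E; rewrite -(ch x) -(ch y) -(prednK h0) !iterSr E. Qed.

Lemma orbit_inv x : perm_eq (map c (traject c x h)) (traject c x h).
Proof.
have -> : map c (traject c x h) = traject c (c x) h.
  by elim: h x => //= l IH y; rewrite IH.
by rewrite -(perm_cons x) -trajectS trajectSr ch perm_rcons.
Qed.

Lemma inv_count n (t : sym_idx d n) x j : inv_sym t ->
  count_mem (iter j c x) (val t) = count_mem x (val t).
Proof.
move=> it; elim: j => //= j IH; rewrite -IH.
by rewrite -(seq.permP it) count_mem_map_inj //; apply: c_inj.
Qed.

Definition add_orbit x n (u : sym_idx d n) : sym_idx d (n + h) :=
  sort_idx [tuple of val u ++ Tuple (introT eqP (size_traject c x h))].

Lemma add_orbitE x n (u : sym_idx d n) :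
  perm_eq (val (add_orbit x u)) (val u ++ traject c x h).
Proof. exact: sort_idx_perm. Qed.

Lemma add_orbit_inj x n : injective (@add_orbit x n).
Proof.
move=> u v /(congr1 (fun t : sym_idx d (n + h) => val (val t))) E.
apply: sym_idx_inj; rewrite -(perm_cat2r (traject c x h)).
by rewrite -(permPl (add_orbitE x u)) -(permPr (add_orbitE x v)) E.
Qed.

Lemma inv_add_orbit x n (u : sym_idx d n) : inv_sym (add_orbit x u) = inv_sym u.
Proof.
rewrite /inv_sym (permPl (perm_map c (add_orbitE x u))) (permPr (add_orbitE x u)).
by rewrite map_cat (permPl (perm_cat (perm_refl _) (orbit_inv x))) perm_cat2r.
Qed.

Lemma orbit_mem x : x \in traject c x h.
Proof. by rewrite -(prednK h0) mem_head. Qed.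

(** An invariant multiset containing x contains its whole orbit, and taking this orbit away leaves
    an invariant multiset. *)
Lemma add_orbit_img x n :
  [set t : sym_idx d (n + h) | inv_sym t & x \in val t] =
  @add_orbit x n @: [set u | inv_sym u].
Proof.
apply/setP => t; rewrite inE; apply/andP/imsetP => [[it xt]|[u]]; last first.
  rewrite inE => iu ->; rewrite inv_add_orbit iu (perm_mem (add_orbitE x u)).
  by rewrite mem_cat orbit_mem orbT.
have /count_subseqP[s sub ps] : forall y, (count_mem y (traject c x h) <= count_mem y (val t))%N.
  move=> y; rewrite (count_uniq_mem _ (uc x)); case: (boolP (y \in _)) => // /trajectP[j _ ->].
  by rewrite inv_count // -has_count has_pred1.
have [s3 pt] := perm_to_subseq sub.
have sz : size s3 == n.
  have := perm_size pt; rewrite size_cat -(perm_size ps) size_traject size_tuple.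
  by move/eqP; rewrite addnC eqn_add2l eq_sym.
exists (sort_idx (Tuple sz)); last first.
  apply: sym_idx_inj; rewrite (permPr (add_orbitE _ _)) (permPl pt).
  by rewrite perm_catC perm_cat // perm_sym ?perm_sort // perm_sym.
have pT : perm_eq (val t) (val (sort_idx (Tuple sz)) ++ traject c x h).
  rewrite (permPl pt) perm_catC perm_cat //; first by rewrite perm_sym perm_sort.
  by rewrite perm_sym.
rewrite inE -(inv_add_orbit x) /inv_sym.
rewrite (permPl (perm_map c (add_orbitE _ _))) (permPr (add_orbitE _ _)).
by rewrite -(permPl (perm_map c pT)) -(permPr pT).
Qed.

(** Removing the orbit of x lowers the multiplicity of x by one and is a bijection onto the
    invariant multisets of size n; the multisets without x contribute 0. *)
Lemma mult_sumD x n : mult_sum x (n + h) = (num_inv n + mult_sum x n)%N.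
Proof.
rewrite /mult_sum (bigID (fun t : sym_idx d (n + h) => x \in val t)) /=.
rewrite [X in (_ + X)%N]big1 ?addn0 => [|t /andP[_]]; last by move/count_memPn.
rewrite (eq_bigl (fun t => t \in [set t : sym_idx d (n + h) | inv_sym t & x \in val t])) => [|t]; last by rewrite !inE.
rewrite add_orbit_img big_imset /=; last by move=> u v _ _; apply: add_orbit_inj.
under eq_bigr => u _ do rewrite (seq.permP (add_orbitE x u)) count_cat (count_uniq_mem _ (uc x)) orbit_mem.
rewrite big_split /= sum1_card addnC; congr (_ + _)%N; first by apply: eq_card => u; rewrite !inE.
by apply: eq_bigl => u; rewrite inE.
Qed.

Lemma mult_sum_small x n : (n < h)%N -> mult_sum x n = 0%N.
Proof.
move=> nh; rewrite /mult_sum big1 // => t it; apply/count_memPn/negP => xt.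
have := uniq_leq_size (uc x) (s2 := val t); rewrite size_traject size_tuple leqNgt nh => H.
suff : false by []; apply: H => _ /trajectP[j _ ->].
by rewrite -has_pred1 has_count inv_count // -has_count has_pred1.
Qed.

Lemma mult_sum_total n : (\sum_x mult_sum x n = n * num_inv n)%N.
Proof.
rewrite /mult_sum (exchange_big_dep (fun t => inv_sym t)) //= mulnC -sum_nat_const.
apply: eq_big => [t|t H]; first by rewrite inE.
rewrite -[RHS](size_tuple (val t)) -count_predT count_sum_mem; apply: eq_bigl => x.
  by rewrite H.
Qed.

(** The generating function of [num_inv] is (1 - t^h)^(-d/h), as c has d/h orbits of length h, and
    this is its logarithmic derivative. The proof counts the members of all invariant multisets, by
    size and through [mult_sumD]. *)
Lemma num_inv_rec n :
  (n * num_inv n = \sum_(i < n) (h %| i.+1) * d * num_inv (n - i.+1))%N.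
Proof.
have [b] := ubnP n; elim: b n => // b IH n; rewrite ltnS => nb.
rewrite -mult_sum_total; case: (ltnP n h) => nh.
  rewrite big1 => [|x _]; last exact: mult_sum_small.
  rewrite big1 // => i _; rewrite gtnNdvd //; apply: leq_trans nh.
  exact: ltn_ord.
have [n' En] : exists n', n = (n' + h)%N by exists (n - h)%N; rewrite subnK.
rewrite En; under eq_bigr do rewrite mult_sumD.
rewrite big_split /= mult_sum_total sum_nat_const card_ord IH; last by clear -En h0 nb; lia.
(* The terms with i + 1 < h vanish, i + 1 = h gives the new summand, and the rest is the recursion
   for n' shifted by h. *)
rewrite -(big_mkord xpredT (fun i => (h %| i.+1) * d * num_inv (n' + h - i.+1)))%N.
rewrite (@big_cat_nat _ _ _ h.-1.+1) //=; last by rewrite prednK // leq_addl.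
have E1 : (\sum_(0 <= i < h.-1) (h %| i.+1) * d * num_inv (n' + h - i.+1) = 0)%N.
  rewrite big_nat_cond big1 // => i /andP[/andP[_ ih] _].
  by rewrite gtnNdvd //; clear -ih h0; lia.
rewrite big_nat_recr //= E1 add0n prednK // dvdnn mul1n addnK.
congr (_ + _)%N; rewrite -[X in index_iota X _]add0n big_addn addnK big_mkord; apply: eq_bigr => i _.
by rewrite -addSn dvdn_addl // subnDr.
Qed.

End FixedMultisets.

Lemma iter_iter (T : Type) (f : T -> T) l m x : iter l (iter m f) x = iter (l * m) f x.
Proof. by elim: l => // l IH; rewrite iterS IH -iterD mulSn. Qed.

Section RegularAdams.
Variables (K : fieldType) (p k : nat).
Hypothesis cK : p \in [pchar K].
Let q := (p ^ k)%N.
Let p_pr : prime p := pcharf_prime cK.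
Let q0 : (0 < q)%N. Proof. by rewrite expn_gt0 prime_gt0. Qed.

Lemma fix_card_ordS m N : fix_card (@ordS m) N = ((m %| N) * m)%N.
Proof.
rewrite /fix_card; case: (boolP (m %| N)%N) => mN.
  rewrite mul1n -[RHS]card_ord; apply: eq_card => x; rewrite !inE.
  apply/eqP/val_inj; rewrite /= iter_ordS -modnDmr (eqP mN) addn0.
  by rewrite modn_small.
apply: eq_card0 => x; rewrite !inE; apply/negP => /eqP/(congr1 val) /=.
rewrite iter_ordS => E; case/negP: mN.
have := eqn_modDl x N 0 m; rewrite addn0 E modn_small // eqxx.
by move=> /esym; rewrite mod0n.
Qed.

Lemma fix_card_prod (X Y : finType) (a : X -> X) (b : Y -> Y) N :
  fix_card (fun z : X * Y => (a z.1, b z.2)) N = (fix_card a N * fix_card b N)%N.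
Proof.
have E z : iter N (fun z : X * Y => (a z.1, b z.2)) z = (iter N a z.1, iter N b z.2).
  by elim: N => [|N IH]; [case: z | rewrite iterS IH].
rewrite /fix_card -cardX; apply: eq_card => -[x y].
by rewrite !inE E xpair_eqE.
Qed.

Lemma fix_card_sym n a : (a <= k)%N ->
  fix_card (@sym_map q n (@ordS q)) (p ^ a) = num_inv (iter (p ^ a) (@ordS q)) n.
Proof.
move=> ak; apply: eq_card => t; rewrite !inE /inv_sym.
rewrite -(permPl (iter_sym_map (@ordS q) t (p ^ a))).
by apply/eqP/idP => [-> //|]; apply: sym_idx_inj.
Qed.

Lemma traject_uniq a x : (a <= k)%N ->
  uniq (traject (iter (p ^ a) (@ordS q)) x (p ^ (k - a))).
Proof.
move=> ak; apply/(uniqP x) => i j; rewrite !inE size_traject => ih jh.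
rewrite !nth_traject // => /(congr1 val) /=.
have pa : (0 < p ^ a)%N by rewrite expn_gt0 prime_gt0.
have lt l : (l < p ^ (k - a))%N -> (l * p ^ a < q)%N.
  by move=> lh; rewrite /q -(subnK ak) expnD ltn_pmul2r.
rewrite !iter_iter !iter_ordS => /eqP; rewrite eqn_modDl !modn_small ?lt //.
by rewrite eqn_pmul2r // => /eqP.
Qed.

(** Translation by p^a on Z/q has orbits of length h = p^(k-a). With g = (i + 1, q), g times the
    number of fixed points of this translation on Z/(q/g) is q or 0 according to whether h divides i
    + 1; so this is [num_inv_rec]. *)
Lemma regular_fix n a : (a <= k)%N ->
  (n * fix_card (@sym_map q n (@ordS q)) (p ^ a) =
   \sum_(i < n) gcdn i.+1 q * (fix_card (@ordS (q %/ gcdn i.+1 q)) (p ^ a) *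
      fix_card (@sym_map q (n - i.+1) (@ordS q)) (p ^ a)))%N.
Proof.
move=> ak; rewrite fix_card_sym // (@num_inv_rec q (p ^ (k - a))).
- apply: eq_bigr => i _; rewrite fix_card_sym // mulnA; congr (_ * _)%N.
  rewrite fix_card_ordS mulnCA; set g := gcdn _ _.
  have gq : (g %| q)%N by apply: dvdn_gcdr.
  have g0 : (0 < g)%N by rewrite gcdn_gt0 q0 orbT.
  rewrite [(g * _)%N]mulnC divnK //; congr (nat_of_bool _ * _)%N.
  have pa : (0 < p ^ a)%N by rewrite expn_gt0 prime_gt0.
  have -> : (q %/ g %| p ^ a)%N = (q %| p ^ a * g)%N by rewrite -{2}(divnK gq) dvdn_pmul2r.
  have qE : q = (p ^ a * p ^ (k - a))%N by rewrite -expnD subnKC.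
  by rewrite {1}qE dvdn_pmul2l // dvdn_gcd [X in _ && X](_ : _ = true) ?andbT // qE dvdn_mull.
- by rewrite expn_gt0 prime_gt0.
- move=> x; rewrite iter_iter -expnD subnK //.
  by apply: val_inj; rewrite /= iter_ordS modnDr modn_small.
- by move=> x; apply: traject_uniq.
Qed.

Definition shift_sym n := @sym_map q n (@ordS q).

Lemma ordS_periodp b x : (b <= k)%N -> iter q (@ordS (p ^ b)) x = x.
Proof.
move=> bk; apply: val_inj; rewrite /= iter_ordS -modnDmr.
have -> : (q %% p ^ b = 0)%N by apply/eqP/dvdn_exp2l.
by rewrite addn0 modn_small.
Qed.

Lemma shift_sym_periodp n x : iter q (@shift_sym n) x = x.
Proof.
apply: sym_idx_inj; rewrite (permPl (iter_sym_map _ _ _)).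
by rewrite (eq_map (g := id)) ?map_id // => a; apply: ordS_periodp.
Qed.

Definition cprod n i (z : 'I_(q %/ gcdn i.+1 q) * sym_idx q (n - i.+1)) := (ordS z.1, shift_sym z.2).

Lemma div_gcd_pow i : exists2 b, (b <= k)%N & (q %/ gcdn i.+1 q)%N = (p ^ b)%N.
Proof. by apply/(dvdn_pfactor _ _ p_pr)/dvdn_div/dvdn_gcdr. Qed.

Lemma cprod_period n i z : iter q (@cprod n i) z = z.
Proof.
have E N : iter N (@cprod n i) z = (iter N (@ordS _) z.1, iter N (@shift_sym _) z.2).
  by elim: N => [|N IH]; [case: z | rewrite iterS IH].
rewrite E shift_sym_periodp; case: z {E} => x t /=; congr (_, _).
have [b bk Eb] := div_gcd_pow i; move: x; rewrite Eb => x; exact: ordS_periodp.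
Qed.

(** By [rk_perm] ranks are linear in fixed point counts, so the identity of counts carries over. The
    passage is made in the rationals because numbers of points are divided by orbit lengths. *)
Lemma regular_rk n l :
  (n * rk (kN (kperm K (@shift_sym n))) fullv l =
   \sum_(i < n) gcdn i.+1 q * rk (kN (kperm K (@cprod n i))) fullv l)%N.
Proof.
apply/eqP; rewrite -(eqr_nat rat) natrM natr_sum.
rewrite (rk_perm l cK (@shift_sym_periodp n)).
under [X in _ == X]eq_bigr => i _ do
  rewrite natrM (rk_perm l cK (@cprod_period n i)) mulr_sumr.
rewrite exchange_big mulr_sumr; apply/eqP; apply: eq_bigr => a _ /=.
under [RHS]eq_bigr do rewrite mulrCA.
rewrite -mulr_sumr mulrCA; congr (_ * _).
have F b : (b <= k)%N -> n%:R * (fix_card (@shift_sym n) (p ^ b))%:R =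
    \sum_(i < n) (gcdn i.+1 q)%:R * (fix_card (@cprod n i) (p ^ b))%:R :> rat.
  move=> bk; rewrite -natrM regular_fix // natr_sum.
  by apply: eq_bigr => i _; rewrite natrM fix_card_prod.
have ak : (a <= k)%N by rewrite -ltnS.
rewrite /fix_diff mulrBr F //; under [RHS]eq_bigr do rewrite mulrBr.
rewrite sumrB; congr (_ - _); case: (a : nat) ak => [|b] bk.
  by rewrite mulr0 big1 // => i _; rewrite mulr0.
by rewrite F // ltnW.
Qed.

Definition Ecl n := kcl q (symK (n := n) (kmatrix (Vmod K q))).

Lemma Ecl_perm n : Ecl n = kcl q (kperm K (@shift_sym n)).
Proof.
have [Y YQ QY] := qK_inv K q.
rewrite -(eq_kcl q (@symK_perm K q n (@ordS q))).
apply: (kcl_iso _ (X := symK (@qK K q q)) (Y := symK Y)).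
- by move=> x y; rewrite symK_mul (eq_symK YQ) symK_id.
- by move=> x y; rewrite symK_mul (eq_symK QY) symK_id.
by move=> x y; rewrite !symK_mul; apply: eq_symK; apply: qK_shift.
Qed.

Lemma V_perm b : kcl q (kperm K (@ordS (p ^ b))) = V q (p ^ b).
Proof.
have [Y YQ QY] := qK_inv K (p ^ b).
rewrite -(kcl_Vmod K); apply/esym/(kcl_iso _ YQ QY).
exact: qK_shift.
Qed.

(** Second differences are linear in the ranks of [regular_rk]. This is the recursion of psi_S for
    V_q solved by (i, q) V_(q/(i,q)), in the Green ring itself and not only modulo V_q. *)
Lemma regular_adams n :
  Ecl n *~ n%:Z =
  \sum_(i < n) gmul K (V q (q %/ gcdn i.+1 q) *~ (gcdn i.+1 q)%:Z) (Ecl (n - i.+1)).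
Proof.
have H (i : 'I_n) : gmul K (V q (q %/ gcdn i.+1 q) *~ (gcdn i.+1 q)%:Z) (Ecl (n - i.+1)) =
    kcl q (kperm K (@cprod n i)) *~ (gcdn i.+1 q)%:Z.
  rewrite -[LHS]/(gmulr K _ (_ *~ _)) raddfMz; congr (_ *~ _).
  rewrite /gmulr Ecl_perm.
  have -> : V q (q %/ gcdn i.+1 q) = kcl q (kperm K (@ordS (q %/ gcdn i.+1 q))).
    by have [b bk ->] := div_gcd_pow i; rewrite V_perm.
  rewrite -[LHS]/(gmul K _ _) (@gmul_kcl K p k cK); last by apply: kuni_perm => x; apply: shift_sym_periodp.
    apply: eq_kcl => -[x s] [y t]; rewrite /ktens /kperm /cprod /= xpair_eqE.
    by rewrite -natrM mulnb.
  apply: kuni_perm; have [b bk ->] := div_gcd_pow i.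
  by move=> x; apply: ordS_periodp.
under eq_bigr do rewrite H.
rewrite Ecl_perm; apply/ffunP => l; rewrite sum_ffunE green_mulz ffunE.
under eq_bigr do rewrite green_mulz ffunE.
have R j : (rk (kN (kperm K (@shift_sym n))) fullv j)%:Z *~ n%:Z =
    \sum_(i < n) (rk (kN (kperm K (@cprod n i))) fullv j)%:Z *~ (gcdn i.+1 q)%:Z.
  rewrite mulrzz mulrC -PoszM regular_rk rk_sumz.
  by apply: eq_bigr => i _; rewrite mulrzz mulrC PoszM.
transitivity (\sum_(i < n) ((rk (kN (kperm K (@cprod n i))) fullv l)%:Z *~ (gcdn i.+1 q)%:Z -
    (rk (kN (kperm K (@cprod n i))) fullv l.+1)%:Z *~ (gcdn i.+1 q)%:Z *+ 2 +
    (rk (kN (kperm K (@cprod n i))) fullv l.+2)%:Z *~ (gcdn i.+1 q)%:Z)).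
  rewrite big_split sumrB sumrMnl -!R /=; ring.
by apply: eq_bigr => i _; ring.
Qed.

End RegularAdams.

(** * Adams operations and the logarithmic derivative *)

Section TriangularSums.
Variable W : zmodType.

Lemma sum_triangle n (F : nat -> nat -> W) :
  \sum_(l < n.+1) \sum_(i < n - l) F l i = \sum_(i < n) \sum_(l < n - i) F l i.
Proof.
transitivity (\sum_(l < n.+1) \sum_(i < n | (i < n - l)%N) F l i).
  by apply: eq_bigr => l _; rewrite (big_ord_widen n (F l)) // leq_subr.
rewrite (exchange_big_dep xpredT) //=; apply: eq_bigr => i _.
rewrite (big_ord_widen n.+1 (fun l => F l i)); last by rewrite leqW // leq_subr.
by apply: eq_bigl => l; rewrite !ltn_subRL addnC.
Qed.

Lemma sum_triangle_shift n (F : nat -> nat -> W) :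
  \sum_(l < n.+1) \sum_(i < l) F l i = \sum_(i < n) \sum_(l < n - i) F (i.+1 + l)%N i.
Proof.
rewrite big_ord_recl big_ord0 add0r.
transitivity (\sum_(l < n) \sum_(i < n | (i <= l)%N) F l.+1 i).
  apply: eq_bigr => l _; rewrite (big_ord_widen n (F (lift ord0 l))) //.
  exact: ltn_ord.
rewrite (exchange_big_dep xpredT) //=; apply: eq_bigr => i _.
rewrite -(big_geq_mkord i n (fun=> true) (fun l => F l.+1 i)) -{1}[i : nat]add0n big_addn big_mkord.
by apply: eq_bigr => l _; rewrite addSn addnC.
Qed.

End TriangularSums.

Section AdamsRecursion.
Variables (K : fieldType) (q : nat).

Lemma size_adamsS (sym : nat -> green q) n : size (adamsS_seq K sym n) = n.
Proof. by elim: n => //= n IH; rewrite size_rcons IH. Qed.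

Lemma nth_adamsS (sym : nat -> green q) n i : (i < n)%N ->
  nth 0 (adamsS_seq K sym n) i = nth 0 (adamsS_seq K sym i.+1) i.
Proof.
elim: n => // n IH; rewrite ltnS leq_eqVlt => /orP[/eqP -> //|lt].
by rewrite [LHS]/= nth_rcons size_adamsS lt IH.
Qed.

Lemma adamsS_last (sym : nat -> green q) n :
  nth 0 (adamsS_seq K sym n.+1) n =
  sym n.+1 *~ n.+1%:Z -
  \sum_(i < n) gmul K (nth 0 (adamsS_seq K sym i.+1) i) (sym (n.+1 - i.+1)%N).
Proof.
rewrite [LHS]/= nth_rcons size_adamsS ltnn eqxx; congr (_ - _).
by apply: eq_bigr => i _; rewrite nth_adamsS.
Qed.

Lemma adamsL_rcons (lam : nat -> green q) n :
  adamsL_seq K lam n.+1 = rcons (adamsL_seq K lam n)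
    ((lam n.+1 *~ n.+1%:Z -
      \sum_(i < n) gmul K (nth 0 (adamsL_seq K lam n) i) (lam (n.+1 - i.+1)%N) *~ ((-1) ^+ i))
     *~ ((-1) ^+ n)).
Proof. exact: erefl. Qed.

Lemma size_adamsL (lam : nat -> green q) n : size (adamsL_seq K lam n) = n.
Proof. by elim: n => // n IH; rewrite adamsL_rcons size_rcons IH. Qed.

Lemma nth_adamsL (lam : nat -> green q) n i : (i < n)%N ->
  nth 0 (adamsL_seq K lam n) i = nth 0 (adamsL_seq K lam i.+1) i.
Proof.
elim: n => // n IH; rewrite ltnS leq_eqVlt => /orP[/eqP -> //|lt].
by rewrite adamsL_rcons nth_rcons size_adamsL lt IH.
Qed.

Lemma adamsL_last (lam : nat -> green q) n :
  nth 0 (adamsL_seq K lam n.+1) n =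
  (lam n.+1 *~ n.+1%:Z -
  \sum_(i < n) gmul K (nth 0 (adamsL_seq K lam i.+1) i) (lam (n.+1 - i.+1)%N) *~ ((-1) ^+ i))
  *~ ((-1) ^+ n).
Proof.
rewrite adamsL_rcons nth_rcons.
rewrite size_adamsL ltnn eqxx.
under eq_bigr => i _.
  rewrite nth_adamsL //.
  over.
by [].
Qed.

End AdamsRecursion.

(** * The logarithmic derivative of the product formula *)

Section Final.
Variables (K : fieldType) (p k : nat).
Hypothesis cK : p \in [pchar K].
Let q := (p ^ k.+1)%N.
Local Notation "a =~ b" := (eqm a b) (at level 70).
Local Notation Om l := (iter l (@Omega q)).
Implicit Types a b : green q.

(** The recursion defining psi_S, with its last term moved into the sum, where the cofactor S^0 =
    V_1 is the unit. *)
Lemma adamsS_sum (sym : nat -> green q) n : sym 0%N = V q 1 ->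
  sym n *~ n%:Z = \sum_(i < n) gmul K (nth 0 (adamsS_seq K sym i.+1) i) (sym (n - i.+1)%N).
Proof.
move=> s0; case: n => [|n]; first by rewrite mulr0z big_ord0.
by rewrite big_ord_recr /= subnn s0 (@gmul1r K p k.+1 cK) -/(adamsS_seq K sym n.+1) adamsS_last addrC subrK.
Qed.

Lemma adamsL_sum (lam : nat -> green q) n : lam 0%N = V q 1 ->
  lam n *~ n%:Z =
  \sum_(i < n) gmul K (nth 0 (adamsL_seq K lam i.+1) i) (lam (n - i.+1)%N) *~ ((-1) ^+ i).
Proof.
move=> s0; case: n => [|n]; first by rewrite mulr0z big_ord0.
rewrite big_ord_recr /= subnn s0 (@gmul1r K p k.+1 cK) -/(adamsL_seq K lam n.+1) adamsL_last.
by rewrite -mulrzA -expr2 sqrr_sign mulr1z addrC subrK.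
Qed.

Lemma iter_Omega_sum l (I : Type) (r : seq I) (F : I -> green q) :
  Om l (\sum_(i <- r) F i) = \sum_(i <- r) Om l (F i).
Proof. by elim: l => //= l ->; rewrite raddf_sum. Qed.

Lemma iter_OmegaZ l a (z : int) : Om l (a *~ z) = Om l a *~ z.
Proof. by elim: l => //= l ->; rewrite raddfMz. Qed.

Lemma gmul_iter_Omega l a b : gmul K (Om l a) b =~ Om l (gmul K a b).
Proof.
elim: l => [|l IH]; first exact: eqm_refl.
exact: eqm_trans (gmul_Omega cK _ _) (eqm_Omega IH).
Qed.

Lemma gmul_iter_Omega_r l a b : gmul K a (Om l b) =~ Om l (gmul K a b).
Proof. by rewrite !(@gmulC K p k.+1 cK a); apply: gmul_iter_Omega. Qed.

(* The logarithmic derivative of the product formula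
   [sum H_n t^n = (sum E_n t^n) (sum Omega^n(L_n) t^n)]. *)
Lemma log_derivative (L E H lam e : nat -> green q) n :
  (forall n, L n *~ n%:Z = \sum_(i < n) gmul K (lam i) (L (n - i.+1)%N) *~ ((-1) ^+ i)) ->
  (forall n, E n *~ n%:Z = \sum_(i < n) gmul K (e i) (E (n - i.+1)%N)) ->
  (forall n, H n =~ \sum_(l < n.+1) Om l (gmul K (E (n - l)%N) (L l))) ->
  H n *~ n%:Z =~ \sum_(i < n) gmul K (Om i.+1 (lam i) *~ ((-1) ^+ i) + e i) (H (n - i.+1)%N).
Proof.
move=> EL EE EH.
(* Leibniz rule: n is split as (n - l) + l, the degrees of the two factors. *)
have split_n (l : 'I_n.+1) : Om l (gmul K (E (n - l)%N) (L l)) *~ n%:Z =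
    Om l (gmul K (E (n - l)%N *~ (n - l)%N%:Z) (L l)) + Om l (gmul K (E (n - l)%N) (L l *~ l%:Z)).
  rewrite raddfMz -[gmul K (_ *~ _) _]/(gmulr K _ (_ *~ _)) raddfMz /= !iter_OmegaZ -mulrzDr.
  by congr (_ *~ _); rewrite -PoszD subnK // -ltnS.
apply: eqm_trans (eqmZ _ (EH n)) _; rewrite mulrz_suml.
under eq_bigr do rewrite split_n.
rewrite big_split /=.
have -> : \sum_(i < n) gmul K (Om i.+1 (lam i) *~ ((-1) ^+ i) + e i) (H (n - i.+1)%N) =
    \sum_(i < n) gmul K (e i) (H (n - i.+1)%N) +
    \sum_(i < n) gmul K (Om i.+1 (lam i)) (H (n - i.+1)%N) *~ ((-1) ^+ i).
  rewrite -big_split /=; apply: eq_bigr => i _; rewrite addrC.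
  by rewrite -[LHS]/(gmulr K _ (_ + _)) raddfD /= raddfMz.
apply: eqmD.
  rewrite (_ : \sum_(l < n.+1) _ = \sum_(l < n.+1) \sum_(i < n - l)
      Om l (gmul K (gmul K (e i) (E (n - l - i.+1)%N)) (L l))); last first.
    apply: eq_bigr => l _; rewrite EE -iter_Omega_sum; congr (iter _ _ _).
    by rewrite -[LHS]/(gmulr K _ (\sum_(i < _) _)) raddf_sum.
  rewrite (sum_triangle n (fun l i => Om l (gmul K (gmul K (e i) (E (n - l - i.+1)%N)) (L l)))).
  apply: eqm_sum => i _; have in_ := ltn_ord i.
  apply: eqm_sym; apply: eqm_trans (eqm_gmul cK (eqm_refl _) (EH _)) _.
  rewrite raddf_sum -subSn // subSS; apply: eqm_sum => l _ /=.
  apply: eqm_trans (gmul_iter_Omega_r _ _ _) _.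
  by rewrite (@gmulA K p k.+1 cK) subnAC; apply: eqm_refl.
(* The terms where the derivative falls on L. A term of exterior degree i + 1 + l carries as many
   copies of Omega: i + 1 of them go to [lam i], which is the origin of Omega^n before psi_Lambda^n,
   and l stay with H. *)
rewrite (_ : \sum_(l < n.+1) _ = \sum_(l < n.+1) \sum_(i < l)
    Om l (gmul K (E (n - l)%N) (gmul K (lam i) (L (l - i.+1)%N))) *~ ((-1) ^+ i)); last first.
  apply: eq_bigr => l _; rewrite EL raddf_sum iter_Omega_sum.
  by apply: eq_bigr => i _; rewrite raddfMz iter_OmegaZ.
rewrite (sum_triangle_shift n (fun l i =>
    Om l (gmul K (E (n - l)%N) (gmul K (lam i) (L (l - i.+1)%N))) *~ ((-1) ^+ i))).
apply: eqm_sum => i _; have in_ := ltn_ord i.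
rewrite -mulrz_suml; apply: eqmZ; apply: eqm_sym.
apply: eqm_trans (eqm_gmul cK (eqm_refl _) (EH _)) _.
rewrite raddf_sum -subSn // subSS; apply: eqm_sum => l _ /=.
rewrite -iterS; apply: eqm_trans (gmul_iter_Omega _ _ _) _.
rewrite iterD; apply: eqm_iter_Omega; apply: eqm_trans (gmul_iter_Omega_r _ _ _) _.
rewrite addKn (@gmulA K p k.+1 cK) (@gmulC K p k.+1 cK (lam i)) -(@gmulA K p k.+1 cK).
by rewrite subnDA; apply: eqm_refl.
Qed.

End Final.

Theorem theorem6p2 (K : fieldType) (p k : nat) (pP : prime p)
    (charK : p \in [pchar K]) (k_gt0 : (0 < k)%N) (r n : nat)
    (hr1 : (p ^ k %/ p <= r)%N) (hr2 : (r <= p ^ k)%N) (hn : (0 < n)%N) :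
  let q := (p ^ k)%N in
  exists m : int,
    psiS q n (Vmod K r)
      - ((iter n (@Omega q) (psiL q n (Vmod K (q - r)))) *~ ((-1) ^+ n.-1)
         + V q (q %/ gcdn n q) *~ (gcdn n q)%:Z)
    = V q q *~ m.
Proof.
(* The exponent is positive and is written k + 1 from here on, so that q/p is p^k. *)
case: k k_gt0 hr1 hr2 => // {}k _ hr1 hr2 q.
have wr : (p ^ k <= r)%N by move: hr1; rewrite expnS mulKn // prime_gt0.
apply/eqmP; case: n hn => // n _ /=; rewrite /psiS /psiL -/q.
pose Hs m := cls q (sympow (Vmod K r) m).
pose Ls m := cls q (extpow (Vmod K (q - r)) m).
have HE m : Hs m = kcl q (symK (n := m) (kmatrix (Vmod K r))).
  by rewrite /Hs sympow_kmx (cls_kmx charK) //; apply/kuni_sym/kuni_Vmod.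
have LE m : Ls m = kcl q (extK (n := m) (kmatrix (Vmod K (q - r)))).
  by rewrite /Ls extpow_kmx (cls_kmx charK) //; apply/kuni_ext/kuni_Vmod/leq_subr.
have H0 : Hs 0%N = V q 1 by rewrite HE kcl_sym0.
have L0 : Ls 0%N = V q 1 by rewrite LE kcl_ext0.
(* Shifted by one: [psi i], [lam i] and [e i] belong to the operations of degree i + 1. *)
pose psi i := nth 0 (adamsS_seq K Hs i.+1) i.
pose lam i := nth 0 (adamsL_seq K Ls i.+1) i.
pose e i : green q := V q (q %/ gcdn i.+1 q) *~ (gcdn i.+1 q)%:Z.
have key m := @log_derivative K p k charK Ls (Ecl K p k.+1) Hs lam e m
  (fun m => adamsL_sum charK m L0) (@regular_adams K p k.+1 charK) _.
have {key} key m : eqm (Hs m *~ m%:Z)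
    (\sum_(i < m) gmul K (iter i.+1 (@Omega q) (lam i) *~ ((-1) ^+ i) + e i) (Hs (m - i.+1)%N)).
  apply: key => l; rewrite HE.
  apply: eqm_trans (sym_resolution charK wr (subnKC hr2) l) _.
  by apply: eqm_sum => j _; rewrite LE; apply: eqm_refl.
pose rho i := iter i.+1 (@Omega q) (lam i) *~ ((-1) ^+ i) + e i.
(* Both sequences satisfy the same recursion modulo V_q, triangular because H_0 is the unit. So they
   agree by strong induction, without any division by n. *)
suff psi_rho i : eqm (psi i) (rho i) by apply: psi_rho.
have [b] := ubnP i; elim: b i => // b IH i; rewrite ltnS => ib.
have E1 : psi i = Hs i.+1 *~ i.+1%:Z - \sum_(j < i) gmul K (psi j) (Hs (i.+1 - j.+1)%N).
  by rewrite (@adamsS_sum K p k charK Hs i.+1 H0) big_ord_recr /= subnn H0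
    (@gmul1r K p k.+1 charK) addrC addrK.
have E2 : rho i = \sum_(j < i.+1) gmul K (rho j) (Hs (i.+1 - j.+1)%N) -
                  \sum_(j < i) gmul K (rho j) (Hs (i.+1 - j.+1)%N).
  by rewrite big_ord_recr /= subnn H0 (@gmul1r K p k.+1 charK) addrC addrK.
rewrite E1 E2; apply: eqmD (key i.+1) _; apply: eqmN; apply: eqm_sum => j _.
apply: (eqm_gmul charK) (eqm_refl _); apply: IH.
exact: leq_trans (ltn_ord j) ib.
Qed.
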